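(* Let $\mathscr X$ be a rigid $C^*$-tensor category with simple unit object such that $Irr(\mathscr X)$ is finite. Let $p=2m\ge 1$ be an even integer and $A$ a (trivially $\mathbb Z_2$-graded) algebra over $\mathbb C$. Let $\{(\mathbf H,\mathbf F_t):t\in[0,1]\}$ be a family of $p$-summable Fredholm modules over $A$ (with the same $\mathbb Z_2$-graded object $\mathbf H$ of $\mathbf{Hilb}(\mathscr X)$) with the same underlying graded homomorphism $\rho:A\to\mathbf{Hilb}(\mathscr X)(\mathbf H,\mathbf H)$. Assume that $t\mapsto\mathbf F_t$ is a strongly $C^1$ map $[0,1]\to\mathbf{Hilb}(\mathscr X)(\mathbf H,\mathbf H)$. Then the $(p+2)$-dimensional character $ch^{p+2}(\mathbf H,\mathbf F_t)\in H^{p+2}_\lambda(A)$ of $(\mathbf H,\mathbf F_t)$ is independent of $t\in[0,1]$.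
   Context: **Rigid $C^*$-tensor category.** $\mathscr X$ is an abelian $\mathbb C$-linear strict monoidal category $(\mathscr X,\otimes,1)$ with finite-dimensional hom-spaces, equipped with antilinear maps $(\cdot)^*:\mathscr X(a,b)\to\mathscr X(b,a)$ with $f^{**}=f$, $(g\circ f)^*=f^*\circ g^*$, $(g\otimes f)^*=g^*\otimes f^*$ (structure isomorphisms unitary), such that (i) for each $f\in\mathscr X(a,b)$ there is $g\in\mathscr X(a,a)$ with $f^*\circ f=g^*\circ g$; (ii) $\|f\|^2:=\sup\{|\xi|: f^*\circ f-\xi 1_a \text{ not invertible}\}$ defines complete submultiplicative norms with $\|f^*\circ f\|=\|f\|^2$. Every object has a dual and a predual, and the unit object $1$ is simple. (Then $\mathscr X$ is semisimple: each object is a finite direct sum of simple objects.) $Irr(\mathscr X)$ is a fixed set of representatives of isomorphism classes of simple objects. **$\mathbf{Hilb}(\mathscr X)$.** $\mathbf{Hilb}$ is the category of separable complex Hilbert spaces and bounded operators. Objects of $\mathbf{Hilb}(\mathscr X)$ are linear dagger functors $\mathbf H:\mathscr X^{op}\to\mathbf{Hilb}$; morphisms $\mathbf H\to\mathbf K$ are natural transformations $\theta=(\theta_c)_c$ with $\sup_{c\in\mathscr X}|\theta_c|<\infty$, $|\cdot|$ the operator norm. **Schatten classes.** For $p\in[1,\infty)$, $\mathcal S_p(\mathbf H)$ is the set of $\theta\in\mathbf{Hilb}(\mathscr X)(\mathbf H,\mathbf H)$ with $\theta_c$ compact for all $c\in\mathscr X$ and $\sup_{c\in Irr(\mathscr X)}\|\theta_c\|_p<\infty$,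 where $\|T\|_p=(\sum_n s_n(T)^p)^{1/p}$ with $s_n(T)$ the singular values of $T$. **Strongly $C^1$.** A map $t\mapsto\theta_t$, $[0,1]\to\mathbf{Hilb}(\mathscr X)(\mathbf H,\mathbf K)$, is strongly $C^1$ if it is continuously differentiable for the strong operator topology: for every $c\in\mathscr X$ and $h\in\mathbf H(c)$, $t\mapsto(\theta_t)_c(h)\in\mathbf K(c)$ is $C^1$. **Fredholm modules.** A $p$-summable Fredholm module $(\mathbf H,\mathbf F)$ over an algebra $A$ consists of: a $\mathbb Z_2$-graded object $\mathbf H=\mathbf H^+\oplus\mathbf H^-$ of $\mathbf{Hilb}(\mathscr X)$ with grading operator $\varepsilon$ ($\varepsilon=\pm1$ on $\mathbf H^\pm$); an algebra homomorphism $\rho:A\to\mathbf{Hilb}(\mathscr X)(\mathbf H,\mathbf H)$ of degree zero ($A$ concentrated in degree zero, i.e. each $\rho(a)$ commutes with $\varepsilon$); and $\mathbf F\in\mathbf{Hilb}(\mathscr X)(\mathbf H,\mathbf H)$ with $\mathbf F^2=id$, $\mathbf F\varepsilon=-\varepsilon\mathbf F$, and $\mathbf F\rho(a)-\rho(a)\mathbf F\in\mathcal S_p(\mathbf H)$ for all $a\in A$. **Character.** An element $\theta\in\mathbf{Hilb}(\mathscr X)(\mathbf H,\mathbf H)$ is even (resp. odd) if it commutes (resp. anticommutes) with $\varepsilon$. The graded commutator is $[\mathbf F,\theta]=\mathbf F\theta-(-1)^{\deg\theta}\theta\mathbf F$ for homogeneous $\theta$, extended linearly, and $d\theta:=i[\mathbf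 F,\theta]$. For $\theta\in\mathcal S_1(\mathbf H)$, $Trace(\theta):=\sum_{c\in Irr(\mathscr X)}trace(\theta_c)$. If $[\mathbf F,\theta]\in\mathcal S_1(\mathbf H)$, $Tr_s(\theta):=\frac12Trace(\varepsilon\mathbf F[\mathbf F,\theta])$. For an even integer $n=2k\ge p-1$, the $n$-dimensional character of $(\mathbf H,\mathbf F)$ is the linear map $\tau^n:A^{\otimes(n+1)}\to\mathbb C$, $$\tau^n(a_0\otimes\dots\otimes a_n)=(2i\pi)^k\,k!\,Tr_s\big(\rho(a_0)d\rho(a_1)\cdots d\rho(a_n)\big).$$ It is a cyclic cocycle, $\tau^n\in Z^n_\lambda(A)$, and $ch^n(\mathbf H,\mathbf F):=[\tau^n]\in H^n_\lambda(A)$. **Cyclic cohomology.** $C^k(A)$ is the space of linear maps $A^{\otimes(k+1)}\to\mathbb C$; $C^k_\lambda(A)$ is the subspace of $\psi$ with $\psi(x_0,\dots,x_k)=(-1)^k\psi(x_1,\dots,x_k,x_0)$; the differential is $(b\psi)(x_0,\dots,x_{k+1})=\sum_{i=0}^k(-1)^i\psi(x_0,\dots,x_ix_{i+1},\dots,x_{k+1})+(-1)^{k+1}\psi(x_{k+1}x_0,x_1,\dots,x_k)$. $Z^\bullet_\lambda(A)$ and $H^\bullet_\lambda(A)$ are the cocycles and cohomology of $(C^\bullet_\lambda(A),b)$. *)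

(* Defs.v *)
From HB Require Import structures.
From mathcomp Require Import all_boot all_order all_algebra.
From mathcomp Require Import all_classical all_reals all_analysis.
From mathcomp.real_closed Require Import complex.
Set Implicit Arguments.
Unset Strict Implicit.
Unset Printing Implicit Defensive.
Import Order.TTheory GRing.Theory Num.Theory.
Import numFieldNormedType.Exports.
Local Open Scope classical_set_scope.
Local Open Scope complex_scope.
Local Open Scope ring_scope.

Record linear_category (R : realType) := LinearCategory {
  obj :> Type;
  hom : obj -> obj -> vectType R[i];
  cmp : forall {a b c : obj}, hom b c -> hom a b -> hom a c;
  idm : forall a : obj, hom a a;
  cmpA : forall (a b c d : obj) (h : hom c d) (g : hom b c) (f : hom a b),
    cmp h (cmp g f) = cmp (cmp h g) f;
  cmp1m : forall (a b : obj) (f : hom a b), cmp (idm b) f = f;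
  cmpm1 : forall (a b : obj) (f : hom a b), cmp f (idm a) = f;
  cmp_linl : forall (a b c : obj) (f : hom a b),
    linear (fun g : hom b c => cmp g f);
  cmp_linr : forall (a b c : obj) (g : hom b c),
    linear (fun f : hom a b => cmp g f) }.

Arguments hom {R l} a b.
Arguments cmp {R l a b c}.
Arguments idm {R l} a.

Section CategoryNotions.
Context (R : realType) (X : linear_category R).
Implicit Types a b c k q z : X.

Definition idto a b (e : a = b) : hom a b :=
  match e in _ = b' return hom a b' with erefl => idm a end.

Definition inverse_of a b (f : hom a b) (g : hom b a) : Prop :=
  cmp g f = idm a /\ cmp f g = idm b.

Definition invertible a b (f : hom a b) : Prop := exists g, inverse_of f g.

Definition isomorphic a b : Prop := exists f : hom a b, invertible f.

Definition mono a b (f : hom a b) : Prop :=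
  forall c (u v : hom c a), cmp f u = cmp f v -> u = v.

Definition epi a b (f : hom a b) : Prop :=
  forall c (u v : hom b c), cmp u f = cmp v f -> u = v.

Definition zero_object z : Prop :=
  (forall a (u v : hom z a), u = v) /\ (forall a (u v : hom a z), u = v).

Definition biproduct a b s : Prop :=
  exists (ia : hom a s) (ib : hom b s) (pa : hom s a) (pb : hom s b),
  [/\ cmp pa ia = idm a, cmp pb ib = idm b, cmp pb ia = 0, cmp pa ib = 0
    & cmp ia pa + cmp ib pb = idm s].

Definition is_kernel a b (f : hom a b) k (i : hom k a) : Prop :=
  cmp f i = 0 /\
  forall c (g : hom c a), cmp f g = 0 -> exists! u : hom c k, cmp i u = g.

Definition is_cokernel a b (f : hom a b) q (p : hom b q) : Prop :=
  cmp p f = 0 /\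
  forall c (g : hom b c), cmp g f = 0 -> exists! u : hom q c, cmp u p = g.

Record abelian : Prop := Abelian {
  ab_zero : exists z, zero_object z;
  ab_sum : forall a b, exists s, biproduct a b s;
  ab_ker : forall a b (f : hom a b), exists k (i : hom k a), is_kernel f i;
  ab_coker : forall a b (f : hom a b), exists q (p : hom b q), is_cokernel f p;
  ab_mono : forall a b (f : hom a b), mono f ->
    exists c (g : hom b c), is_kernel g f;
  ab_epi : forall a b (f : hom a b), epi f ->
    exists c (g : hom c a), is_cokernel g f }.

Definition simple_object a : Prop :=
  ~ zero_object a /\
  forall b (f : hom b a), mono f -> zero_object b \/ invertible f.

Definition irr_representatives (I : Type) (irr : I -> X) : Prop :=
  [/\ forall i, simple_object (irr i),
      forall i j, isomorphic (irr i) (irr j) -> i = j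
    & forall a, simple_object a -> exists i, isomorphic a (irr i)].

End CategoryNotions.

(* Strictness is equality of objects, so the associativity and unit
   constraints are the transported identities [idto _]; only their naturality
   has to be required. Pentagon and triangle identities hold automatically. *)
Record tensor_category (R : realType) := TensorCategory {
  tcat :> linear_category R;
  one : tcat;
  tens : tcat -> tcat -> tcat;
  tensm : forall {a b c d : tcat},
    hom a b -> hom c d -> hom (tens a c) (tens b d);
  tensm_id : forall a b : tcat, tensm (idm a) (idm b) = idm (tens a b);
  tensm_cmp : forall (a b c a' b' c' : tcat)
      (g : hom b c) (f : hom a b) (g' : hom b' c') (f' : hom a' b'),
    tensm (cmp g f) (cmp g' f') = cmp (tensm g g') (tensm f f');
  tensm_linl : forall (a b c d : tcat) (g : hom c d),
    linear (fun f : hom a b => tensm f g);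
  tensm_linr : forall (a b c d : tcat) (f : hom a b),
    linear (fun g : hom c d => tensm f g);
  tensA : forall a b c : tcat, tens (tens a b) c = tens a (tens b c);
  tens1x : forall a : tcat, tens one a = a;
  tensx1 : forall a : tcat, tens a one = a;
  tensmA : forall (a b c a' b' c' : tcat)
      (f : hom a a') (g : hom b b') (h : hom c c'),
    cmp (idto (tensA a' b' c')) (tensm (tensm f g) h) =
    cmp (tensm f (tensm g h)) (idto (tensA a b c));
  tensm1x : forall (a b : tcat) (f : hom a b),
    cmp (idto (tens1x b)) (tensm (idm one) f) = cmp f (idto (tens1x a));
  tensmx1 : forall (a b : tcat) (f : hom a b),
    cmp (idto (tensx1 b)) (tensm f (idm one)) = cmp f (idto (tensx1 a)) }.

Arguments one {R} t.
Arguments tens {R t} a b.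
Arguments tensm {R _ a b c d}.

(* [is_dual a b]: [b] is a dual of [a], equivalently [a] is a predual of [b]. *)
Definition is_dual (R : realType) (X : tensor_category R) (a b : X) : Prop :=
  exists (ev : hom (tens b a) (one X)) (coev : hom (one X) (tens a b)),
  [/\ cmp (idto (tensx1 a)) (cmp (tensm (idm a) ev)
        (cmp (idto (tensA a b a)) (tensm coev (idm a)))) = idto (tens1x a)
    & cmp (idto (tens1x b)) (cmp (tensm ev (idm b))
        (cmp (idto (esym (tensA b a b))) (tensm (idm b) coev))) =
      idto (tensx1 b)].

Definition rigid (R : realType) (X : tensor_category R) : Prop :=
  forall a : X, (exists b, is_dual a b) /\ (exists b, is_dual b a).

Record dagger_tensor_category (R : realType) := DaggerTensorCategory {
  dcat :> tensor_category R;
  dag : forall {a b : dcat}, hom a b -> hom b a;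
  dag_antilinear : forall (a b : dcat) (z : R[i]) (f g : hom a b),
    dag (z *: f + g) = (z^*)%C *: dag f + dag g;
  dagK : forall (a b : dcat) (f : hom a b), dag (dag f) = f;
  dag_cmp : forall (a b c : dcat) (g : hom b c) (f : hom a b),
    dag (cmp g f) = cmp (dag f) (dag g);
  dag_tensm : forall (a b c d : dcat) (g : hom a b) (f : hom c d),
    dag (tensm g f) = tensm (dag g) (dag f) }.

Arguments dag {R _ a b}.

Section CStar.
Context (R : realType) (X : dagger_tensor_category R).

(* The supremum is over a finite set, empty exactly when [a] is a zero object;
   [sup set0 = 0]. *)
Definition hom_norm (a b : X) (f : hom a b) : R :=
  Num.sqrt (sup [set r : R | exists xi : R[i],
    r%:C = `|xi| /\ ~ invertible (cmp (dag f) f - xi *: idm a)]).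

Record cstar : Prop := CStar {
  cstar_pos : forall (a b : X) (f : hom a b), exists g : hom a a,
    cmp (dag f) f = cmp (dag g) g;
  cstar_norm0 : forall (a b : X) (f : hom a b), hom_norm f = 0 -> f = 0;
  cstar_normZ : forall (a b : X) (z : R[i]) (f : hom a b),
    (hom_norm (z *: f))%:C = `|z| * (hom_norm f)%:C;
  cstar_normD : forall (a b : X) (f g : hom a b),
    hom_norm (f + g) <= hom_norm f + hom_norm g;
  cstar_complete : forall (a b : X) (u : nat -> hom a b),
    (forall e : R, 0 < e -> exists N, forall m n,
      (N <= m)%N -> (N <= n)%N -> hom_norm (u m - u n) < e) ->
    exists l : hom a b, forall e : R, 0 < e -> exists N, forall n,
      (N <= n)%N -> hom_norm (u n - l) < e;
  cstar_submult : forall (a b c : X) (g : hom b c) (f : hom a b),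
    hom_norm (cmp g f) <= hom_norm g * hom_norm f;
  cstar_id : forall (a b : X) (f : hom a b),
    hom_norm (cmp (dag f) f) = hom_norm f ^+ 2 }.

End CStar.

Record rigid_cstar_category (R : realType) := RigidCstarCategory {
  rcat :> dagger_tensor_category R;
  rcat_abelian : abelian rcat;
  rcat_cstar : cstar rcat;
  rcat_rigid : rigid rcat;
  rcat_simple1 : simple_object (one rcat) }.

Record hilbert (R : realType) := Hilbert {
  hspace :> completeNormedModType R[i];
  ip : hspace -> hspace -> R[i];
  ip_linear : forall y, linear_for *%R (ip ^~ y);
  ip_conj : forall x y, ip y x = ((ip x y)^*)%C;
  ip_norm : forall x, ip x x = `|x| ^+ 2;
  hseparable : exists D : set hspace, countable D /\ dense D }.

Arguments ip {R h}.

Section Operators.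
Context (R : realType) (V : hilbert R).
Implicit Type T : V -> V.

Definition compact_op T : Prop := compact (closure (T @` [set x | `|x| <= 1])).

(* [T^* T x = l ^ 2 x], that is [x] is in the eigenspace of [|T|] for [l]. *)
Definition abs_eigen T (l : R) (x : V) : Prop :=
  forall y, ip (T x) (T y) = (l ^+ 2)%:C * ip x y.

(* [s] lists, in decreasing order and with multiplicity, the positive
   eigenvalues of [|T|], followed by zeros if there are finitely many: the
   vectors [e n] with [s n > 0] are orthonormal eigenvectors, and no further
   eigenvector is orthogonal to all of them. *)
Definition singular_values T (s : nat -> R) : Prop :=
  [/\ forall n, 0 <= s n, forall m n, (m <= n)%N -> s n <= s m
    & exists e : nat -> V,
      [/\ forall m n, 0 < s m -> 0 < s n -> ip (e m) (e n) = (m == n)%:R,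
          forall n, 0 < s n -> abs_eigen T (s n) (e n)
        & forall (l : R) (x : V), 0 < l -> abs_eigen T l x ->
            (forall n, 0 < s n -> ip x (e n) = 0) -> x = 0]].

(* A countable orthonormal basis, padded with zero vectors so that spaces of
   finite dimension are covered. *)
Definition orthonormal_basis (e : nat -> V) : Prop :=
  [/\ forall m n, m != n -> ip (e m) (e n) = 0,
      forall n, e n = 0 \/ ip (e n) (e n) = 1
    & forall x, (forall n, ip x (e n) = 0) -> x = 0].

Definition is_trace T (z : R[i]) : Prop :=
  forall e, orthonormal_basis e ->
    series (fun n => ip (T (e n)) (e n) : R[i]^o) @ \oo --> (z : R[i]^o).

Definition trace T : R[i] := xget 0 (is_trace T).

End Operators.

Definition lp_norm (R : realType) (p : R) (s : nat -> R) : \bar R :=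
  ((\sum_(n <oo) (s n `^ p)%:E) `^ p^-1)%E.

Record hfunctor (R : realType) (X : dagger_tensor_category R) := HFunctor {
  hobj :> X -> hilbert R;
  hmap : forall {a b : X}, hom a b -> hobj b -> hobj a;
  hmap_op_linear : forall (a b : X) (f : hom a b), linear (hmap f);
  hmap_bounded : forall (a b : X) (f : hom a b), exists M : R,
    forall x, `|hmap f x| <= M%:C * `|x|;
  hmap_id : forall (a : X) x, hmap (idm a) x = x;
  hmap_cmp : forall (a b c : X) (g : hom b c) (f : hom a b) x,
    hmap (cmp g f) x = hmap f (hmap g x);
  hmap_linear : forall (a b : X) (z : R[i]) (f g : hom a b) x,
    hmap (z *: f + g) x = z *: hmap f x + hmap g x;
  hmap_dag : forall (a b : X) (f : hom a b) x y,
    ip (hmap f x) y = ip x (hmap (dag f) y) }.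

Arguments hmap {R X} h {a b}.

(* The last field says that every [happ c] is a bounded operator and that the
   operator norms are uniformly bounded in [c]. *)
Record hmor (R : realType) (X : dagger_tensor_category R)
    (H K : hfunctor X) := HMor {
  happ :> forall c : X, H c -> K c;
  happ_linear : forall c, linear (@happ c);
  happ_natural : forall (a b : X) (f : hom a b) x,
    happ (hmap H f x) = hmap K f (happ x);
  happ_bounded : exists M : R, forall (c : X) (x : H c), `|happ x| <= M%:C * `|x| }.

Arguments happ {R X H K} h c x : rename.

#[local] Obligation Tactic := idtac.

Section HMorAlgebra.
Context (R : realType) (X : dagger_tensor_category R).

Lemma hmorP (H K : hfunctor X) (f g : hmor H K) :
  (forall c x, f c x = g c x) -> f = g.
Proof.
case: f g => [f fl fn fb] [g gl gn gb] /= fg.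
have e : f = g by apply: functional_extensionality_dep => c; apply/funext/fg.
case: _ / e gl gn gb {fg} => gl gn gb.
by congr HMor; exact: Prop_irrelevance.
Qed.

Section Linear.
Context (H K : hfunctor X).

Lemma hmap_op0 (L : hfunctor X) a b (f : hom a b) : hmap L f 0 = 0.
Proof.
have := hmap_op_linear (h := L) f (-1) 0 0.
by rewrite scaler0 addr0 scaleN1r addNr.
Qed.

Program Definition hmor0 : hmor H K := @HMor _ _ _ _ (fun c _ => 0) _ _ _.
Next Obligation. by move=> c z x y; rewrite scaler0 addr0. Qed.
Next Obligation. by move=> a b f x; rewrite hmap_op0. Qed.
Next Obligation. by exists 0 => c x; rewrite normr0 mul0r. Qed.

Program Definition hmor_lin (z : R[i]) (f g : hmor H K) : hmor H K :=
  @HMor _ _ _ _ (fun c x => z *: f c x + g c x) _ _ _.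
Next Obligation.
move=> z f g c w x y; rewrite !happ_linear !scalerDr !scalerA (mulrC z).
by rewrite addrACA.
Qed.
Next Obligation.
by move=> z f g a b h x /=; rewrite hmap_op_linear !happ_natural.
Qed.
Next Obligation.
move=> z f g; have [M fM] := happ_bounded f; have [N gN] := happ_bounded g.
have zE : (complex.Re `|z|)%:C = `|z| by rewrite RRe_real ?normr_real.
have E : (complex.Re `|z| * M + N)%:C = `|z| * M%:C + N%:C.
  by rewrite -zE -!rmorphM -rmorphD.
exists (complex.Re `|z| * M + N) => c x; rewrite E mulrDl /=.
apply: le_trans (ler_normD _ _) _; apply: lerD => //.
by rewrite normrZ -mulrA; apply: ler_wpM2l => //; exact: fM.
Qed.

HB.instance Definition _ := gen_eqMixin (hmor H K).
HB.instance Definition _ := gen_choiceMixin (hmor H K).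

Definition hmor_add (f g : hmor H K) := hmor_lin 1 f g.
Definition hmor_scale z (f : hmor H K) := hmor_lin z f hmor0.
Definition hmor_opp (f : hmor H K) := hmor_scale (-1) f.

Let addA : associative hmor_add.
Proof. by move=> f g h; apply: hmorP => c x /=; rewrite !scale1r addrA. Qed.
Let addC : commutative hmor_add.
Proof. by move=> f g; apply: hmorP => c x /=; rewrite !scale1r addrC. Qed.
Let add0 : left_id hmor0 hmor_add.
Proof. by move=> f; apply: hmorP => c x /=; rewrite scaler0 add0r. Qed.
Let addN : left_inverse hmor0 hmor_opp hmor_add.
Proof.
by move=> f; apply: hmorP => c x /=; rewrite addr0 scale1r scaleN1r addNr.
Qed.
HB.instance Definition _ := GRing.isZmodule.Build (hmor H K) addA addC add0 addN.

Let scaleA z w (f : hmor H K) :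
  hmor_scale z (hmor_scale w f) = hmor_scale (z * w) f.
Proof. by apply: hmorP => c x /=; rewrite !addr0 scalerA. Qed.
Let scale1 : left_id 1 hmor_scale.
Proof. by move=> f; apply: hmorP => c x /=; rewrite addr0 scale1r. Qed.
Let scaleDr : right_distributive hmor_scale +%R.
Proof.
by move=> z f g; apply: hmorP => c x /=; rewrite !addr0 !scale1r scalerDr.
Qed.
Let scaleDl (f : hmor H K) : {morph hmor_scale ^~ f : z w / z + w}.
Proof. by move=> z w; apply: hmorP => c x /=; rewrite !addr0 scale1r scalerDl. Qed.
HB.instance Definition _ :=
  GRing.Zmodule_isLmodule.Build R[i] (hmor H K) scaleA scale1 scaleDr scaleDl.

Lemma hmor_addE (f g : hmor H K) c x : (f + g) c x = f c x + g c x.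
Proof. by rewrite [LHS]/= scale1r. Qed.

Lemma hmor_oppE (f : hmor H K) c x : (- f) c x = - f c x.
Proof. by rewrite [LHS]/= addr0 scaleN1r. Qed.

Lemma hmor_scaleE z (f : hmor H K) c x : (z *: f) c x = z *: f c x.
Proof. by rewrite [LHS]/= addr0. Qed.

End Linear.

Section Ring.
Context (H : hfunctor X).

Program Definition hmor1 : hmor H H := @HMor _ _ _ _ (fun c x => x) _ _ _.
Next Obligation. by []. Qed.
Next Obligation. by []. Qed.
Next Obligation. by exists 1 => c x; rewrite mul1r. Qed.

Program Definition hmor_mul (f g : hmor H H) : hmor H H :=
  @HMor _ _ _ _ (fun c x => f c (g c x)) _ _ _.
Next Obligation. by move=> f g c z x y /=; rewrite !happ_linear. Qed.
Next Obligation. by move=> f g a b h x /=; rewrite !happ_natural. Qed.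
Next Obligation.
move=> f g; have [M fM] := happ_bounded f; have [N gN] := happ_bounded g.
have E : (`|M| * N)%:C = `|M|%:C * N%:C by rewrite -rmorphM.
exists (`|M| * N) => c x /=; rewrite E -mulrA; apply: le_trans (fM _ _) _.
have M0 : M%:C <= `|M|%:C by rewrite lecR ler_norm.
apply: le_trans (ler_wpM2r (normr_ge0 _) M0) _.
by apply: ler_wpM2l (gN _ _); rewrite lecR.
Qed.

Let mulA : associative hmor_mul.
Proof. by move=> f g h; apply: hmorP. Qed.
Let mul1 : left_id hmor1 hmor_mul.
Proof. by move=> f; apply: hmorP. Qed.
Let mul_1 : right_id hmor1 hmor_mul.
Proof. by move=> f; apply: hmorP. Qed.
Let mulDl : left_distributive hmor_mul +%R.
Proof. by move=> f g h; apply: hmorP. Qed.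
Let mulDr : right_distributive hmor_mul +%R.
Proof.
by move=> f g h; apply: hmorP => c x /=; rewrite happ_linear.
Qed.
HB.instance Definition _ :=
  GRing.Zmodule_isPzRing.Build (hmor H H) mulA mul1 mul_1 mulDl mulDr.

Lemma hmor_mulE (f g : hmor H H) c x : (f * g) c x = f c (g c x).
Proof. by []. Qed.

Lemma hmor_oneE c x : (1 : hmor H H) c x = x.
Proof. by []. Qed.

End Ring.
End HMorAlgebra.

Section Schatten.
Context (R : realType) (X : dagger_tensor_category R).

(* A compact operator has exactly one sequence of singular values, so [s] is
   determined by [th]. *)
Definition schatten (I : Type) (irr : I -> X) (p : R)
    (H : hfunctor X) (th : hmor H H) : Prop :=
  (forall c, compact_op (th c)) /\
  exists s : I -> nat -> R,
    (forall i, singular_values (th (irr i)) (s i)) /\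
    (ereal_sup (range (fun i => lp_norm p (s i))) < +oo)%E.

Definition Trace (I : finType) (irr : I -> X)
    (H : hfunctor X) (th : hmor H H) : R[i] :=
  \sum_(i : I) trace (th (irr i)).

Definition strongly_C1 (H K : hfunctor X) (th : R -> hmor H K) : Prop :=
  forall (c : X) (h : H c), exists g : R -> K c,
    {within `[0, 1]%classic, continuous g} /\
    forall t : R, 0 <= t <= 1 ->
      ((s - t)^-1)%:C *: (th s c h - th t c h)
        @[s --> within `[0, 1]%classic t^'] --> g t.

End Schatten.

(* [gobj] is the orthogonal direct sum of the ranges of the isometries
   [gincp] and [gincm]. *)
Record graded_object (R : realType) (X : dagger_tensor_category R) :=
    GradedObject {
  gobj :> hfunctor X;
  gplus : hfunctor X;
  gminus : hfunctor X;
  gincp : hmor gplus gobj;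
  gincm : hmor gminus gobj;
  gincp_isometry : forall c x y, ip (gincp c x) (gincp c y) = ip x y;
  gincm_isometry : forall c x y, ip (gincm c x) (gincm c y) = ip x y;
  ginc_orthogonal : forall c x y, ip (gincp c x) (gincm c y) = 0;
  ginc_sum : forall c h, exists x y, h = gincp c x + gincm c y;
  grading : hmor gobj gobj;
  gradingp : forall c x, grading c (gincp c x) = gincp c x;
  gradingm : forall c x, grading c (gincm c x) = - gincm c x }.

Arguments grading {R X} g.

(* Associative algebras over the complex numbers, not necessarily unital. *)
Record calgebra (R : realType) := CAlgebra {
  cmod :> lmodType R[i];
  amul : cmod -> cmod -> cmod;
  amulA : associative amul;
  amul_linl : forall y, linear (amul ^~ y);
  amul_linr : forall x, linear (amul x) }.

Arguments amul {R c}.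

Record degree0_hom (R : realType) (X : dagger_tensor_category R)
    (A : calgebra R) (H : graded_object X) := Degree0Hom {
  rep :> A -> hmor H H;
  rep_linear : linear rep;
  rep_mul : forall a b, rep (amul a b) = rep a * rep b;
  rep_even : forall a, rep a * grading H = grading H * rep a }.

Record summable_fredholm_module (R : realType) (X : dagger_tensor_category R)
    (I : Type) (irr : I -> X) (p : R) (A : calgebra R) (H : graded_object X)
    (rho : degree0_hom A H) (F : hmor H H) : Prop := SummableFredholmModule {
  fred_sqr : F * F = 1;
  fred_odd : F * grading H = - (grading H * F);
  fred_comm : forall a, schatten irr p (F * rho a - rho a * F) }.

Section CyclicCohomology.
Context (R : realType) (A : calgebra R).

(* Linear maps on [A^{\otimes (n+1)}] are multilinear maps of [n+1] variables. *)
Definition cochain (n : nat) := ('I_n.+1 -> A) -> R[i].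

Definition subst_at n (x : 'I_n.+1 -> A) (i : 'I_n.+1) (u : A) :=
  fun j => if j == i then u else x j.

Definition multilinear n (psi : cochain n) : Prop :=
  forall (x : 'I_n.+1 -> A) i, linear_for *%R (fun u => psi (subst_at x i u)).

Definition cyclic_cochain n : set (cochain n) :=
  [set psi | multilinear psi /\
    forall x, psi x = (-1) ^+ n * psi (fun i => x (ordS i))].

Definition inner_face n (x : 'I_n.+2 -> A) (i : nat) : 'I_n.+1 -> A := fun j =>
  if (j < i)%N then x (inord j)
  else if (j == i :> nat) then amul (x (inord j)) (x (inord j.+1))
  else x (inord j.+1).

Definition last_face n (x : 'I_n.+2 -> A) : 'I_n.+1 -> A := fun j =>
  if j == ord0 then amul (x ord_max) (x ord0) else x (inord j).

Definition hochschild n (psi : cochain n) : cochain n.+1 := fun x =>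
  \sum_(i < n.+1) (-1) ^+ i * psi (inner_face x i)
  + (-1) ^+ n.+1 * psi (last_face x).

Definition cyclic_cocycle n : set (cochain n) :=
  [set psi | cyclic_cochain psi /\ forall x, hochschild psi x = 0].

Definition cyclic_coboundary n : set (cochain n) :=
  match n with
  | 0 => [set (fun=> 0)]
  | k.+1 => @hochschild k @` @cyclic_cochain k
  end.

Definition cohomology_class n (psi : cochain n) : set (cochain n) :=
  [set (fun x => psi x + beta x) | beta in @cyclic_coboundary n].

Definition cyclic_cohomology n : set (set (cochain n)) :=
  @cohomology_class n @` @cyclic_cocycle n.

End CyclicCohomology.

Arguments cyclic_cohomology {R} A n.

Section Character.
Context (R : realType) (X : dagger_tensor_category R).
Context (I : finType) (irr : I -> X).
Context (A : calgebra R) (H : graded_object X).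
Context (rho : degree0_hom A H) (F : hmor H H).

Definition even_part (th : hmor H H) : hmor H H :=
  (2^-1 : R[i]) *: (th + grading H * th * grading H).

Definition odd_part (th : hmor H H) : hmor H H :=
  (2^-1 : R[i]) *: (th - grading H * th * grading H).

Definition gcomm (th : hmor H H) : hmor H H :=
  (F * even_part th - even_part th * F) + (F * odd_part th + odd_part th * F).

Definition gdiff (th : hmor H H) : hmor H H := 'i%C *: gcomm th.

Definition Tr_s (th : hmor H H) : R[i] :=
  2^-1 * Trace irr (grading H * F * gcomm th).

(* Meaningful for [n] even, [n = 2k] with [k = n./2]. *)
Definition character_cocycle (n : nat) : cochain A n := fun x =>
  (2 * 'i%C * pi%:C) ^+ n./2 * (n./2)`!%:R *
  Tr_s (rho (x ord0) * \prod_(j < n) gdiff (rho (x (lift ord0 j)))).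

Definition chern_character (n : nat) : set (cochain A n) :=
  cohomology_class (character_cocycle (n := n)).

End Character.

Arguments chern_character {R X I} irr {A H} rho F n.

(* Main.v *)
Require Import Defs.
From HB Require Import structures.
From mathcomp Require Import all_boot all_order all_algebra.
From mathcomp Require Import all_classical all_reals all_analysis.
From mathcomp.real_closed Require Import complex.
From mathcomp Require Import ring lra zify.
Import Order.TTheory GRing.Theory Num.Theory.
Import numFieldNormedType.Exports.
Local Open Scope classical_set_scope.
Local Open Scope ring_scope.

Set Implicit Arguments.
Unset Strict Implicit.
Unset Printing Implicit Defensive.

(** A morphism of functors is determined by its components, and the trace only
    sees the components at the finitely many simple objects. Evaluating at a
    simple object ([component]) turns the Fredholm modules into operators [F t]
    on one Hilbert space, with a grading [e] and a representation [rho], and up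
    to one constant factor the character becomes the sum over the simple objects
    of the cochains
      [tau (F t) e : (a_0, .., a_n) |-> trace (e F [F, a_0] .. [F, a_n])]
    with [n = p + 2] ([character_cocycleE]). So it suffices that the class of
    each of these cochains is constant in [t].

    Strong differentiability makes every orbit Lipschitz, and uniform boundedness
    makes [F] Lipschitz in norm ([norm_lipschitz]). After a subdivision of the
    interval it is enough to compare [F0] and [F1] with [|(F1 - F0) F0| <= 1].
    Put [v = (F1 F0 - 1) / 2], a small operator. Then [F1 (1 + v) = (1 + v) F0]
    ([gen_intertwines]), and [1 + s v] is invertible for [0 <= s <= 1], with
    inverse [w s]. Conjugating everything by [1 + v] therefore exchanges the
    change of [F] for a change of the representation: the cochain of [F1] for
    [rho] is the cochain of [F0] for [w 1 rho (1 + v)]. The representations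
    [w s rho (1 + s v)] connect the latter to [rho], and they move by inner
    derivations, namely the commutators with [v * w s].

    Inner derivations act trivially on cyclic cohomology, and here this is an
    explicit formula: the derivative of [tau] along the commutator with [y] is,
    up to sign, the coboundary of the cochain that inserts [[F, y]] with
    alternating signs between the factors [[F, a_i]]
    ([supertrace_insertions_coboundary]). Integrating over [s] gives a cyclic
    cochain of degree [p + 1] whose coboundary is the difference of the two
    characters ([transgression_hochschild]).

    What remains is to differentiate under the trace. The singular values bound
    the approximation numbers ([singular_values_approx]). For a decreasing
    sequence [r] in [l^p], the operators whose approximation numbers are dominated
    by [r ^ k] form a filtration compatible with products; from [k = p] on they
    are nuclear, and the trace is finite, linear and cyclic ([gauge_nuclear]).
    Since [v] commutes with [rho a] up to products containing [[F0, rho a]] or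
    [[F1, rho a]], all the products above stay in the filtration along the path.
    Their Taylor remainders are quadratic there ([dprod_diff]), hence so are those
    of their traces. *)

(** * Hilbert spaces *)
Notation "x %:C" := (real_complex _ x) (format "x %:C") : ring_scope.
Notation "x ^*" := (conjc x) : ring_scope.

Section ComplexModulus.
Context {R : realType}.
Implicit Types (z w : R[i]) (r : R).

Lemma rcD r s : (r + s)%:C = r%:C + s%:C. Proof. exact: rmorphD. Qed.
Lemma rcB r s : (r - s)%:C = r%:C - s%:C. Proof. exact: rmorphB. Qed.
Lemma rcN r : (- r)%:C = - r%:C. Proof. exact: rmorphN. Qed.
Lemma rcM r s : (r * s)%:C = r%:C * s%:C. Proof. exact: rmorphM. Qed.
Lemma rcX r n : (r ^+ n)%:C = r%:C ^+ n. Proof. exact: rmorphXn. Qed.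
Lemma rc_nat n : n%:R%:C = n%:R :> R[i]. Proof. exact: rmorph_nat. Qed.
Lemma conjcM z w : (z * w)^* = z^* * w^*. Proof. exact: rmorphM. Qed.
Lemma conjcD z w : (z + w)^* = z^* + w^*. Proof. exact: rmorphD. Qed.
Lemma conjcN z : (- z)^* = - z^*. Proof. exact: rmorphN. Qed.

(** The modulus takes complex values; [cm], and [nm] below for vectors, are its
    real version, on which ordered-field tactics apply. *)
Definition cm z : R := complex.Re `|z|.

Lemma cmE z : `|z| = (cm z)%:C.
Proof. by rewrite /cm RRe_real ?normr_real. Qed.

Lemma cm_ge0 z : 0 <= cm z.
Proof. by rewrite -ler0c -cmE. Qed.

Lemma cmM z w : cm (z * w) = cm z * cm w.
Proof. by apply: complexI; rewrite rcM -!cmE normrM. Qed.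

Lemma cmD z w : cm (z + w) <= cm z + cm w.
Proof. by rewrite -lecR rcD -!cmE ler_normD. Qed.

Lemma cm0 : cm 0 = 0.
Proof. by apply: complexI; rewrite -cmE normr0. Qed.

Lemma cmN z : cm (- z) = cm z.
Proof. by apply: complexI; rewrite -!cmE normrN. Qed.

Lemma cmB z w : cm (z - w) <= cm z + cm w.
Proof. by rewrite -(cmN w) cmD. Qed.

Lemma cmBC z w : cm (z - w) = cm (w - z).
Proof. by rewrite -cmN opprB. Qed.

Lemma cm_real r : cm r%:C = `|r|.
Proof. by apply: complexI; rewrite -cmE normc_def /= expr0n /= addr0 sqrtr_sqr. Qed.

Lemma cm_eq0 z : cm z = 0 -> z = 0.
Proof. by move=> h; apply: normr0_eq0; rewrite cmE h. Qed.

Lemma cm_sqr z : z * z^* = (cm z ^+ 2)%:C.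
Proof. by rewrite -sqr_normc cmE rcX. Qed.

Lemma Re_le_cm z : `|complex.Re z| <= cm z.
Proof. by rewrite -lecR -cmE; exact: normc_ge_Re. Qed.

Lemma Im_le_cm z : `|complex.Im z| <= cm z.
Proof.
rewrite -ler_sqr ?nnegrE ?cm_ge0 // real_normK ?num_real //.
by rewrite -lecR (rcX (cm z)) -cmE -add_Re2_Im2 lecR lerDr sqr_ge0.
Qed.

Lemma cm_le_ReIm z : cm z <= `|complex.Re z| + `|complex.Im z|.
Proof.
have {1}-> : z = (complex.Re z)%:C + 'i%C * (complex.Im z)%:C by exact: complexE.
apply: le_trans (cmD _ _) _; rewrite cmM !cm_real.
suff -> : cm 'i%C = 1 by rewrite mul1r.
by apply: complexI; rewrite -cmE normc_def /= expr0n expr1n add0r sqrtr1.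
Qed.

Lemma cm_sum (I : Type) (s : seq I) (P : pred I) (F : I -> R[i]) :
  cm (\sum_(i <- s | P i) F i) <= \sum_(i <- s | P i) cm (F i).
Proof.
elim/big_rec2: _ => [|i x y _ h]; first by rewrite cm0.
by apply: le_trans (cmD _ _) _; rewrite lerD2l.
Qed.

(** The Cauchy-Schwarz discriminant argument, kept apart because it serves
    both the inner product and the defect form of an operator. *)
Lemma discriminant_le (a b c : R) : 0 <= b -> 0 <= c ->
  (forall s : R, 0 <= a - 2 * s * b + s ^+ 2 * b * c) -> b <= a * c.
Proof.
move=> b0; rewrite le_eqVlt => /predU1P[<-|c0] h.
  rewrite mulr0 leNgt; apply/negP => bp.
  have := h ((a + 1) / b); rewrite mulr0 addr0.
  suff -> : a - 2 * ((a + 1) / b) * b = - a - 2.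
    have := h 0; rewrite mulr0 mul0r subr0 !mulr0 addr0; lra.
  by field; rewrite gt_eqF.
have := h c^-1.
suff -> : a - 2 / c * b + c^-1 ^+ 2 * b * c = (a * c - b) / c.
  by rewrite pmulr_lge0 ?invr_gt0 // subr_ge0.
by field; rewrite gt_eqF.
Qed.

End ComplexModulus.

Section Hilbert.
Context {R : realType} {V : hilbert R}.
Implicit Types (x y z : V) (a b : R[i]).

Definition nm x : R := complex.Re `|x|.

Lemma nmE x : `|x| = (nm x)%:C.
Proof. by rewrite /nm RRe_real ?normr_real. Qed.

Lemma nm_ge0 x : 0 <= nm x.
Proof. by rewrite -ler0c -nmE. Qed.

Lemma nmD x y : nm (x + y) <= nm x + nm y.
Proof. by rewrite -lecR rcD -!nmE ler_normD. Qed.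

Lemma nmZ a x : nm (a *: x) = cm a * nm x.
Proof. by apply: complexI; rewrite rcM -cmE -!nmE normrZ. Qed.

Lemma nm0 : nm (0 : V) = 0.
Proof. by apply: complexI; rewrite -nmE normr0. Qed.

Lemma nmN x : nm (- x) = nm x.
Proof. by apply: complexI; rewrite -!nmE normrN. Qed.

Lemma nmB x y : nm (x - y) <= nm x + nm y.
Proof. by rewrite -(nmN y) nmD. Qed.

Lemma nmBC x y : nm (x - y) = nm (y - x).
Proof. by rewrite -nmN opprB. Qed.

Lemma nm_eq0 x : nm x = 0 -> x = 0.
Proof. by move=> h; apply: normr0_eq0; rewrite nmE h. Qed.

Lemma ipPl a x y z : ip (a *: x + y) z = a * ip x z + ip y z.
Proof. exact: (ip_linear z). Qed.

Lemma ip0l z : ip 0 z = 0 :> R[i].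
Proof. by have := ipPl (-1) 0 0 z; rewrite scaler0 addr0 mulN1r addNr. Qed.

Lemma ipDl x y z : ip (x + y) z = ip x z + ip y z.
Proof. by rewrite -{1}(scale1r x) ipPl mul1r. Qed.

Lemma ipZl a x z : ip (a *: x) z = a * ip x z.
Proof. by rewrite -(addr0 (a *: x)) ipPl ip0l addr0. Qed.

Lemma ipNl x z : ip (- x) z = - ip x z.
Proof. by rewrite -scaleN1r ipZl mulN1r. Qed.

Lemma ipBl x y z : ip (x - y) z = ip x z - ip y z.
Proof. by rewrite ipDl ipNl. Qed.

Lemma ip0r z : ip z 0 = 0 :> R[i].
Proof. by rewrite ip_conj ip0l conjc0. Qed.

Lemma ipDr x y z : ip z (x + y) = ip z x + ip z y.
Proof. by rewrite !(ip_conj _ z) ipDl conjcD. Qed.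

Lemma ipZr a x z : ip z (a *: x) = a^* * ip z x.
Proof. by rewrite !(ip_conj _ z) ipZl conjcM. Qed.

Lemma ipNr x z : ip z (- x) = - ip z x.
Proof. by rewrite !(ip_conj _ z) ipNl conjcN. Qed.

Lemma ipBr x y z : ip z (x - y) = ip z x - ip z y.
Proof. by rewrite ipDr ipNr. Qed.

Lemma ip_suml (I : Type) (s : seq I) (P : pred I) (F : I -> V) z :
  ip (\sum_(i <- s | P i) F i) z = \sum_(i <- s | P i) ip (F i) z.
Proof.
by elim/big_rec2: _ => [|i x y _ h]; rewrite ?ip0l // ipDl h.
Qed.

Lemma ip_sumr (I : Type) (s : seq I) (P : pred I) (F : I -> V) z :
  ip z (\sum_(i <- s | P i) F i) = \sum_(i <- s | P i) ip z (F i).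
Proof.
by elim/big_rec2: _ => [|i x y _ h]; rewrite ?ip0r // ipDr h.
Qed.

Lemma ipxx x : ip x x = (nm x ^+ 2)%:C.
Proof. by rewrite ip_norm nmE rcX. Qed.

Lemma Cauchy_Schwarz x y : cm (ip x y) <= nm x * nm y.
Proof.
rewrite -ler_sqr ?nnegrE ?cm_ge0 ?mulr_ge0 ?nm_ge0 // exprMn.
apply: discriminant_le; rewrite ?exprn_ge0 ?cm_ge0 ?nm_ge0 // => s.
have := sqr_ge0 (nm (x - (s%:C * ip x y) *: y)).
rewrite -(@ler0c R) -ipxx ipBl !ipBr !ipZl !ipZr !ipxx.
rewrite conjcM conjc_real (ip_conj x y).
set b := ip x y; set n1 := nm x; set n2 := nm y.
have -> : (n1 ^+ 2)%:C - s%:C * b^* * b -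
  (s%:C * b * b^* - s%:C * b * (s%:C * b^* * (n2 ^+ 2)%:C))
  = ((n1 ^+ 2 - 2 * s * cm b ^+ 2 + s ^+ 2 * cm b ^+ 2 * n2 ^+ 2))%:C.
  have := cm_sqr b; set b2 := cm b ^+ 2; set m1 := n1 ^+ 2; set m2 := n2 ^+ 2.
  move=> hb; rewrite rcD rcB (rcM _ m2) !(rcM _ b2) -hb (rcM 2) rc_nat rcX; ring.
by rewrite ler0c.
Qed.

Lemma nm_sqrD x y : nm (x + y) ^+ 2 = nm x ^+ 2 + nm y ^+ 2 + 2 * complex.Re (ip x y).
Proof.
apply: complexI; rewrite -ipxx ipDl !ipDr !ipxx (ip_conj x y) !rcD [RHS]addrC.
rewrite (rcM 2) rc_nat -addcJ; ring.
Qed.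

Lemma pythagoras x y : ip x y = 0 -> nm (x + y) ^+ 2 = nm x ^+ 2 + nm y ^+ 2.
Proof. by move=> h; rewrite nm_sqrD h mulr0 addr0. Qed.

(** Completeness, restated with real radii. *)
Lemma nm_complete (u : nat -> V) :
  (forall e : R, 0 < e -> exists N, forall m n, (N <= m)%N -> (N <= n)%N ->
     nm (u m - u n) < e) ->
  exists l, forall e : R, 0 < e -> exists N, forall n, (N <= n)%N -> nm (u n - l) < e.
Proof.
move=> cu.
have : cauchy (u @ \oo).
  apply: cauchy_exP => e e0.
  have eE : e = (complex.Re e)%:C by rewrite RRe_real // gtr0_real.
  have [|N hN] := cu (complex.Re e); first by rewrite -ltcR -eE.
  exists (u N); exists N => // n /= Nn.
  by rewrite -ball_normE /= nmE eE ltcR; apply: hN.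
move/cauchy_cvg/cvg_ex => [l ul]; exists l => e e0.
have e0' : 0 < e%:C :> R[i] by rewrite ltcR.
have /cvgrPdist_lt /(_ _ e0') [N _ hN] := ul.
by exists N => n Nn; have := hN n Nn; rewrite /= nmE ltcR nmBC.
Qed.

End Hilbert.

Section OrthonormalSystems.
Context {R : realType} {V : hilbert R}.
Implicit Types (x y : V) (e g : nat -> V).

(** Zero vectors are allowed, so that any sequence of vectors can be
    orthonormalized without reindexing. *)
Definition orthonormal_seq e :=
  (forall m n, m != n -> ip (e m) (e n) = 0) /\
  (forall n, e n = 0 \/ ip (e n) (e n) = 1).

Definition proj e n x : V := \sum_(k < n) ip x (e k) *: e k.

Lemma projD e n x y : proj e n (x + y) = proj e n x + proj e n y.
Proof. by rewrite -big_split; apply: eq_bigr => k _; rewrite ipDl scalerDl. Qed.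

Lemma projZ e n a x : proj e n (a *: x) = a *: proj e n x.
Proof. by rewrite scaler_sumr; apply: eq_bigr => k _; rewrite ipZl scalerA. Qed.

Lemma proj_sum e n (I : Type) (s : seq I) (P : pred I) (F : I -> V) :
  proj e n (\sum_(i <- s | P i) F i) = \sum_(i <- s | P i) proj e n (F i).
Proof.
elim/big_rec2: _ => [|i x y _ h]; last by rewrite projD h.
by rewrite /proj big1 // => k _; rewrite ip0l scale0r.
Qed.

Lemma proj_residue e n x k : orthonormal_seq e -> (k < n)%N ->
  ip (x - proj e n x) (e k) = 0.
Proof.
move=> [eo e1] kn; rewrite ipBl ip_suml (bigD1 (Ordinal kn)) //= big1 => [|i ik].
  rewrite ipZl addr0; case: (e1 k) => ->; first by rewrite ip0r mul0r subr0.
  by rewrite mulr1 subrr.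
by rewrite ipZl eo ?mulr0.
Qed.

Lemma proj_orthogonal e n x : orthonormal_seq e -> ip (x - proj e n x) (proj e n x) = 0.
Proof.
move=> eo; rewrite ip_sumr big1 // => k _.
by rewrite ipZr proj_residue ?mulr0.
Qed.

Lemma nm_proj_sqr e n x : orthonormal_seq e ->
  nm (proj e n x) ^+ 2 = \sum_(k < n) cm (ip x (e k)) ^+ 2.
Proof.
move=> eo; elim: n => [|n IHn]; first by rewrite /proj !big_ord0 nm0 expr0n.
rewrite /proj big_ord_recr /= big_ord_recr /= -IHn.
rewrite pythagoras; last first.
  rewrite ip_suml big1 // => k _; rewrite ipZl ipZr eo.1 ?mulr0 //.
  by rewrite ltn_eqF.
rewrite nmZ exprMn; congr (_ + _).
case: (eo.2 n) => [->|]; first by rewrite ip0r cm0 expr0n mul0r.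
by rewrite ipxx => /complexI->; rewrite mulr1.
Qed.

Lemma nm_proj_residue e n x : orthonormal_seq e ->
  nm x ^+ 2 = nm (x - proj e n x) ^+ 2 + nm (proj e n x) ^+ 2.
Proof. by move=> eo; rewrite -pythagoras ?subrK //; exact: proj_orthogonal. Qed.

Lemma proj_le e n x : orthonormal_seq e -> nm (proj e n x) <= nm x.
Proof.
move=> eo; rewrite -ler_sqr ?nnegrE ?nm_ge0 // (nm_proj_residue n x eo).
by rewrite lerDr sqr_ge0.
Qed.

Lemma residue_le e n x : orthonormal_seq e -> nm (x - proj e n x) <= nm x.
Proof.
move=> eo; rewrite -ler_sqr ?nnegrE ?nm_ge0 // (nm_proj_residue n x eo).
by rewrite lerDl sqr_ge0.
Qed.

(** A vector fixed by one projection has full norm under it, and the norms of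
    the projections increase up to the norm of the vector. *)
Lemma proj_id e n m x : orthonormal_seq e -> (n <= m)%N ->
  proj e n x = x -> proj e m x = x.
Proof.
move=> eo nm_ h; apply/eqP; rewrite eq_sym -subr_eq0; apply/eqP.
apply: nm_eq0; apply/eqP; rewrite -sqrf_eq0 eq_le sqr_ge0 andbT.
have hm := nm_proj_residue m x eo; have hn := nm_proj_residue n x eo.
rewrite [X in x - X]h subrr nm0 expr0n add0r in hn; rewrite hn in hm.
have : \sum_(k < n) cm (ip x (e k)) ^+ 2 <= \sum_(k < m) cm (ip x (e k)) ^+ 2.
  rewrite -(big_mkord xpredT (fun k => cm (ip x (e k)) ^+ 2)).
  rewrite -(big_mkord xpredT (fun k => cm (ip x (e k)) ^+ 2)).
  rewrite [leRHS](big_cat_nat (leq0n n) nm_) /= lerDl.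
  by apply: sumr_ge0 => k _; rewrite sqr_ge0.
rewrite -!nm_proj_sqr // => hle; lra.
Qed.

(** Gram-Schmidt, with zero vectors in place of the linearly dependent ones. *)
Lemma Gram_Schmidt g : exists e, orthonormal_seq e /\
  forall k n, (k < n)%N -> proj e n (g k) = g k.
Proof.
pose res (s : seq V) x := x - \sum_(v <- s) ip x v *: v.
pose unit x : V := ((nm x)^-1)%:C *: x.
pose f := fix f n := if n is k.+1 then rcons (f k) (unit (res (f k) (g k))) else [::].
pose e n := unit (res (f n) (g n)).
have fE n : f n = [seq e k | k <- iota 0 n].
  by elim: n => // n IHn; rewrite -addn1 iotaD map_cat -IHn /= cats1 addn1.
have resE n x : res (f n) x = x - proj e n x.
  by rewrite /res fE big_map -/(iota _ _) /proj -(big_mkord xpredT (fun k => ip x (e k) *: e k)) /index_iota subn0.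
have eE n : e n = unit (g n - proj e n (g n)) by rewrite /e resE.
have e1 n : e n = 0 \/ ip (e n) (e n) = 1.
  rewrite eE; set y := _ - _; have [y0|y0] := eqVneq (nm y) 0.
    by left; rewrite /unit (nm_eq0 y0) scaler0.
  right; rewrite /unit ipxx nmZ cm_real ger0_norm ?invr_ge0 ?nm_ge0 //.
  by rewrite mulVf // expr1n.
have eo n : forall m, (m < n)%N -> ip (e n) (e m) = 0.
  elim/ltn_ind: n => n IHn m mn.
  rewrite eE /unit ipZl ipBl ip_suml (bigD1 (Ordinal mn)) //= big1 => [|i im].
    rewrite ipZl addr0; case: (e1 m) => ->; first by rewrite ip0r mul0r subr0 mulr0.
    by rewrite mulr1 subrr mulr0.
  rewrite ipZl; have [lt|gt|eq] := ltngtP i m.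
  - by rewrite [ip (e i) _]ip_conj (IHn m mn i lt) conjc0 mulr0.
  - by rewrite (IHn i (ltn_ord i) m gt) mulr0.
  - by case/eqP: im; apply: val_inj.
have eon : orthonormal_seq e.
  split=> // m n; have [lt _|gt _|//] := ltngtP m n; last exact: eo.
  by rewrite ip_conj eo // conjc0.
exists e; split=> // k n kn; apply: (proj_id eon kn).
rewrite /proj big_ord_recr /= -/(proj e k (g k)).
set y := proj e k (g k); set r := g k - y.
suff -> : ip (g k) (e k) *: e k = r by rewrite /r addrCA subrr addr0.
have -> : ip (g k) (e k) = ip r (e k).
  rewrite /r ipBl [X in _ - X](_ : _ = 0) ?subr0 // ip_suml big1 // => i _.
  by rewrite ipZl eon.1 ?mulr0 // ltn_eqF.
rewrite eE -/y -/r /unit ipZr conjc_real ipxx scalerA -!rcM.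
have [r0|r0] := eqVneq (nm r) 0; first by rewrite (nm_eq0 r0) scaler0.
by rewrite expr2 mulKf // mulfV // scale1r.
Qed.

(** Orthonormalize a dense sequence: a vector orthogonal to it lies at distance
    at least its own norm from each of its terms. *)
Lemma orthonormal_basis_exists : exists e : nat -> V, orthonormal_basis e.
Proof.
have [D [cD dD]] := hseparable V.
have [g hg] : exists g : nat -> V, forall d, D d -> exists k, g k = d.
  have [->|/set0P[d0 Dd0]] := eqVneq D set0; first by exists (fun=> 0).
  have /pfcard_geP[D0|[g]] := cD; first by move: Dd0; rewrite D0.
  exists g => d Dd; have [k _ gk] := surj (f := g) Dd; by exists k.
have [e [eo eg]] := Gram_Schmidt g.
exists e; split; [exact: eo.1|exact: eo.2|move=> x xe].
apply: nm_eq0; apply/eqP/negPn/negP => x0.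
have xp : 0 < nm x by rewrite lt_def x0 nm_ge0.
have : ball x (nm x)%:C `&` D !=set0.
  apply: dD; last exact: ball_open.
  by exists x; apply: ballxx; rewrite ltcR.
move=> [d [xd /hg [k gk]]].
move: xd; rewrite -ball_normE /= nmE ltcR; apply/negP; rewrite -leNgt.
have xd : ip x d = 0.
  rewrite -gk -(eg k k.+1 (ltnSn k)) ip_sumr big1 // => i _.
  by rewrite ipZr xe mulr0.
rewrite -ler_sqr ?nnegrE ?nm_ge0 // pythagoras ?nmN ?lerDl ?sqr_ge0 //.
by rewrite ipNr xd oppr0.
Qed.

Lemma basis_orthonormal e : orthonormal_basis e -> orthonormal_seq e.
Proof. by case. Qed.

(** The Fourier expansion: the partial sums are Cauchy by Bessel's inequality,
    and the residue of their limit is orthogonal to the whole basis. *)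
Lemma proj_cvg e x : orthonormal_basis e ->
  forall d : R, 0 < d -> exists N, forall n, (N <= n)%N -> nm (proj e n x - x) < d.
Proof.
move=> eb; have eo := basis_orthonormal eb.
pose u n := \sum_(k < n) cm (ip x (e k)) ^+ 2.
have uE n : u n = nm (proj e n x) ^+ 2 by rewrite nm_proj_sqr.
have du m n : (m <= n)%N -> nm (proj e n x - proj e m x) ^+ 2 = u n - u m.
  move=> mn.
  have -> : proj e m x = proj e m (proj e n x).
    rewrite /proj; apply: eq_bigr => k _; congr (_ *: _).
    apply/eqP; rewrite -subr_eq0 -ipBl proj_residue //.
    exact: leq_trans mn.
  rewrite !uE; have := nm_proj_residue m (proj e n x) eo.
  rewrite (_ : proj e m (proj e n x) = proj e m x) => [->|]; first by rewrite addrK.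
  rewrite {1 3}/proj; apply: eq_bigr => k _; congr (_ *: _).
  apply/esym/eqP; rewrite -subr_eq0 -ipBl proj_residue //.
  exact: leq_trans mn.
have u_mono m n : (m <= n)%N -> u m <= u n.
  by move=> mn; rewrite -subr_ge0 -du // sqr_ge0.
have u_ub n : u n <= nm x ^+ 2.
  by rewrite uE ler_sqr ?nnegrE ?nm_ge0 // proj_le.
have u_cauchy d : 0 < d -> exists N, forall m n, (N <= m)%N -> (N <= n)%N -> `|u m - u n| < d.
  move=> d0; have /cvg_ex [/= l ul] : cvgn u.
    apply: nondecreasing_is_cvgn => [m n|]; first exact: u_mono.
    by exists (nm x ^+ 2) => _ [n _ <-].
  have d2 : 0 < d / 2 by rewrite divr_gt0.
  have /cvgrPdist_lt /(_ _ d2) [N _ hN] := ul.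
  exists N => m n Nm Nn.
  have /= hm := hN m Nm; have /= hn := hN n Nn.
  have -> : u m - u n = (l - u n) - (l - u m) by ring.
  apply: le_lt_trans (ler_normB _ _) _; lra.
have [l hl] : exists l, forall d : R, 0 < d -> exists N, forall n, (N <= n)%N -> nm (proj e n x - l) < d.
  apply: nm_complete => d d0; have [|N hN] := u_cauchy (d ^+ 2); first by rewrite exprn_gt0.
  exists N => m n Nm Nn; rewrite -ltr_sqr ?nnegrE ?nm_ge0 ?ltW //.
  have [mn|nm_] := leqP m n.
    by rewrite nmBC du // (le_lt_trans (ler_norm _)) // hN.
  by rewrite du ?(ltnW nm_) // (le_lt_trans (ler_norm _)) // hN.
suff lx : x = l by rewrite -lx in hl.
apply/eqP; rewrite -subr_eq0; apply/eqP; case: eb => _ _; apply => k.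
apply: cm_eq0; apply/eqP; rewrite eq_le cm_ge0 andbT; apply/ler_addgt0Pr => d d0; rewrite add0r.
have [N hN] := hl _ d0; set n := maxn N k.+1.
have kn : (k < n)%N by rewrite leq_maxr.
have -> : ip (x - l) (e k) = ip (proj e n x - l) (e k).
  apply/eqP; rewrite -subr_eq0 -ipBl opprB addrA subrK.
  by rewrite proj_residue.
apply: le_trans (Cauchy_Schwarz _ _) _.
have ek : nm (e k) <= 1.
  case: (eo.2 k) => [->|]; first by rewrite nm0.
  rewrite ipxx => /complexI h; have := nm_ge0 (e k); nra.
apply: le_trans (ler_wpM2l (nm_ge0 _) ek) _; rewrite mulr1 ltW // hN //.
by rewrite leq_maxl.
Qed.

End OrthonormalSystems.

(** * Bounded operators *)

(** Bundled, so that the bounded operators on [V] are a ring; the zero space gives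
    the trivial one. *)
Record bop (R : realType) (V : hilbert R) := Bop {
  bfun :> V -> V;
  bop_linear : linear bfun;
  bop_bounded : exists M : R, forall x, nm (bfun x) <= M * nm x }.

Section BopAlgebra.
Context {R : realType} {V : hilbert R}.

Lemma bopP (S T : bop V) : (forall x, S x = T x) -> S = T.
Proof.
case: S T => [f fl fb] [g gl gb] /= fg.
have e : f = g by apply/funext.
by case: _ / e gl gb {fg} => gl gb; congr Bop; exact: Prop_irrelevance.
Qed.

Fact bop0_linear : linear (fun _ : V => 0 : V).
Proof. by move=> a x y; rewrite scaler0 addr0. Qed.

Fact bop0_bounded : exists M : R, forall x : V, nm (0 : V) <= M * nm x.
Proof. by exists 0 => x; rewrite nm0 mul0r. Qed.

Definition bop0 := Bop bop0_linear bop0_bounded.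

Fact bop_comb_linear a (S T : bop V) : linear (fun x => a *: S x + T x).
Proof.
move=> b x y; rewrite !bop_linear !scalerDr !scalerA (mulrC a b).
by rewrite addrACA.
Qed.

Fact bop_comb_bounded a (S T : bop V) :
  exists M : R, forall x, nm (a *: S x + T x) <= M * nm x.
Proof.
have [M SM] := bop_bounded S; have [N TN] := bop_bounded T.
exists (cm a * M + N) => x; rewrite mulrDl.
apply: le_trans (nmD _ _) _; apply: lerD => //.
by rewrite nmZ -mulrA ler_wpM2l ?cm_ge0.
Qed.

Definition bop_comb a S T := Bop (bop_comb_linear a S T) (bop_comb_bounded a S T).

Fact bop_id_bounded : exists M : R, forall x : V, nm (idfun x) <= M * nm x.
Proof. by exists 1 => x; rewrite mul1r. Qed.

Definition bop1 := Bop (fun a (x y : V) => erefl (a *: idfun x + idfun y)) bop_id_bounded.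

Fact bop_comp_linear (S T : bop V) : linear (S \o T).
Proof. by move=> a x y; rewrite /= !bop_linear. Qed.

Fact bop_comp_bounded (S T : bop V) :
  exists M : R, forall x, nm ((S \o T) x) <= M * nm x.
Proof.
have [M SM] := bop_bounded S; have [N TN] := bop_bounded T.
exists (`|M| * N) => x /=; rewrite -mulrA; apply: le_trans (SM _) _.
apply: le_trans (ler_wpM2r (nm_ge0 _) (ler_norm M)) _.
by rewrite ler_wpM2l.
Qed.

Definition bop_comp S T := Bop (bop_comp_linear S T) (bop_comp_bounded S T).

HB.instance Definition _ := gen_eqMixin (bop V).
HB.instance Definition _ := gen_choiceMixin (bop V).

Definition bop_add := bop_comb 1.
Definition bop_scale a T := bop_comb a T bop0.
Definition bop_opp := bop_scale (-1).

Fact bop_addA : associative bop_add.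
Proof. by move=> f g h; apply: bopP => x /=; rewrite !scale1r addrA. Qed.
Fact bop_addC : commutative bop_add.
Proof. by move=> f g; apply: bopP => x /=; rewrite !scale1r addrC. Qed.
Fact bop_add0 : left_id bop0 bop_add.
Proof. by move=> f; apply: bopP => x /=; rewrite scaler0 add0r. Qed.
Fact bop_addN : left_inverse bop0 bop_opp bop_add.
Proof. by move=> f; apply: bopP => x /=; rewrite addr0 scale1r scaleN1r addNr. Qed.
HB.instance Definition _ :=
  GRing.isZmodule.Build (bop V) bop_addA bop_addC bop_add0 bop_addN.

Fact bop_scaleA a b T : bop_scale a (bop_scale b T) = bop_scale (a * b) T.
Proof. by apply: bopP => x /=; rewrite !addr0 scalerA. Qed.
Fact bop_scale1 : left_id 1 bop_scale.
Proof. by move=> f; apply: bopP => x /=; rewrite addr0 scale1r. Qed.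
Fact bop_scaleDr : right_distributive bop_scale +%R.
Proof. by move=> z f g; apply: bopP => x /=; rewrite !addr0 !scale1r scalerDr. Qed.
Fact bop_scaleDl T : {morph bop_scale ^~ T : a b / a + b}.
Proof. by move=> z w; apply: bopP => x /=; rewrite !addr0 scale1r scalerDl. Qed.
HB.instance Definition _ :=
  GRing.Zmodule_isLmodule.Build R[i] (bop V) bop_scaleA bop_scale1 bop_scaleDr bop_scaleDl.

Fact bop_compA : associative bop_comp. Proof. by move=> f g h; apply: bopP. Qed.
Fact bop_comp1l : left_id bop1 bop_comp. Proof. by move=> f; apply: bopP. Qed.
Fact bop_comp1r : right_id bop1 bop_comp. Proof. by move=> f; apply: bopP. Qed.
Fact bop_compDl : left_distributive bop_comp +%R.
Proof. by move=> f g h; apply: bopP. Qed.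
Fact bop_compDr : right_distributive bop_comp +%R.
Proof. by move=> f g h; apply: bopP => x /=; rewrite bop_linear. Qed.
HB.instance Definition _ := GRing.Zmodule_isPzRing.Build (bop V)
  bop_compA bop_comp1l bop_comp1r bop_compDl bop_compDr.

Implicit Types (S T : bop V) (x y : V) (a : R[i]).

Lemma bop_addE S T x : (S + T) x = S x + T x.
Proof. by rewrite [LHS]/= scale1r. Qed.
Lemma bop_oppE T x : (- T) x = - T x.
Proof. by rewrite [LHS]/= addr0 scaleN1r. Qed.
Lemma bop_subE S T x : (S - T) x = S x - T x.
Proof. by rewrite bop_addE bop_oppE. Qed.
Lemma bop_scaleE a T x : (a *: T) x = a *: T x.
Proof. by rewrite [LHS]/= addr0. Qed.
Lemma bop_mulE S T x : (S * T) x = S (T x). Proof. by []. Qed.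
Lemma bop_oneE x : (1 : bop V) x = x. Proof. by []. Qed.
Lemma bop_zeroE x : (0 : bop V) x = 0. Proof. by []. Qed.
Lemma bop_sumE (I : Type) (s : seq I) (P : pred I) (F : I -> bop V) x :
  (\sum_(i <- s | P i) F i) x = \sum_(i <- s | P i) F i x.
Proof. by elim/big_rec2: _ => // i y S _ <-; rewrite bop_addE. Qed.

Fact bop_scalerAl a S T : a *: (S * T) = (a *: S) * T.
Proof. by apply: bopP => x; rewrite !(bop_scaleE, bop_mulE). Qed.

Lemma bopD T x y : T (x + y) = T x + T y.
Proof. by have := bop_linear T 1 x y; rewrite !scale1r. Qed.
Lemma bop_app0 T : T 0 = 0.
Proof. by have := bop_linear T (-1) 0 0; rewrite scaler0 addr0 scaleN1r addNr. Qed.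
Lemma bopZ T a x : T (a *: x) = a *: T x.
Proof. by have := bop_linear T a x 0; rewrite !addr0 bop_app0 addr0. Qed.
Lemma bopN T x : T (- x) = - T x. Proof. by rewrite -scaleN1r bopZ scaleN1r. Qed.
Lemma bopB T x y : T (x - y) = T x - T y. Proof. by rewrite bopD bopN. Qed.
Lemma bop_app_sum T (I : Type) (s : seq I) (P : pred I) (F : I -> V) :
  T (\sum_(i <- s | P i) F i) = \sum_(i <- s | P i) T (F i).
Proof. by elim/big_rec2: _ => [|i y z _ <-]; rewrite ?bop_app0 // bopD. Qed.

Lemma bop_scalerAr a S T : a *: (S * T) = S * (a *: T).
Proof. by apply: bopP => x; rewrite !(bop_scaleE, bop_mulE) bopZ. Qed.

(** ** Operator bounds and rank *)

Definition opb T (C : R) := 0 <= C /\ forall x, nm (T x) <= C * nm x.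

Lemma opb_exists T : exists C, opb T C.
Proof.
have [M TM] := bop_bounded T; exists `|M|; split=> // x.
by apply: le_trans (TM x) _; rewrite ler_wpM2r ?nm_ge0 ?ler_norm.
Qed.

Lemma opb_le T C D : opb T C -> C <= D -> opb T D.
Proof.
move=> [C0 TC] CD; split; first exact: le_trans CD.
by move=> x; apply: le_trans (TC x) _; rewrite ler_wpM2r ?nm_ge0.
Qed.

Lemma opbD S T C D : opb S C -> opb T D -> opb (S + T) (C + D).
Proof.
move=> [C0 SC] [D0 TD]; split; first exact: addr_ge0.
by move=> x; rewrite bop_addE mulrDl; apply: le_trans (nmD _ _) _; apply: lerD.
Qed.

Lemma opbZ a T C : opb T C -> opb (a *: T) (cm a * C).
Proof.
move=> [C0 TC]; split; first by rewrite mulr_ge0 ?cm_ge0.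
by move=> x; rewrite bop_scaleE nmZ -mulrA ler_wpM2l ?cm_ge0.
Qed.

Lemma opbN T C : opb T C -> opb (- T) C.
Proof. by move=> [C0 TC]; split=> // x; rewrite bop_oppE nmN. Qed.

Lemma opbB S T C D : opb S C -> opb T D -> opb (S - T) (C + D).
Proof. by move=> hS hT; apply: opbD => //; apply: opbN. Qed.

Lemma opbM S T C D : opb S C -> opb T D -> opb (S * T) (C * D).
Proof.
move=> [C0 SC] [D0 TD]; split; first exact: mulr_ge0.
by move=> x; rewrite bop_mulE -mulrA; apply: le_trans (SC _) _; rewrite ler_wpM2l.
Qed.

Lemma opb0 : opb 0 0.
Proof. by split=> // x; rewrite bop_zeroE nm0 mul0r. Qed.

(** The coordinates of [T x] are only required to exist; Gram-Schmidt makes them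
    linear in [x] when this is needed. *)
Definition rank_le (N : nat) T := exists g : nat -> V, forall x,
  exists c : nat -> R[i], T x = \sum_(i < N) c i *: g i.

Lemma rank_leD M N S T : rank_le M S -> rank_le N T -> rank_le (M + N) (S + T).
Proof.
move=> [g Sg] [h Th].
exists (fun k => if (k < M)%N then g k else h (k - M)%N) => x.
have [c Sc] := Sg x; have [d Td] := Th x.
exists (fun k => if (k < M)%N then c k else d (k - M)%N).
rewrite bop_addE Sc Td big_split_ord /=; congr (_ + _); apply: eq_bigr => i _.
  by rewrite ltn_ord.
by rewrite ltnNge leq_addr /= addKn.
Qed.

Lemma rank_leW M N T : rank_le M T -> (M <= N)%N -> rank_le N T.
Proof.
move=> [g Tg] MN; exists g => x; have [c Tc] := Tg x.
exists (fun k => if (k < M)%N then c k else 0).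
rewrite Tc (big_ord_widen _ (fun k => c k *: g k) MN) big_mkcond /=.
by apply: eq_bigr => i _; case: ifP; rewrite ?scale0r.
Qed.

Lemma rank_leMl N S T : rank_le N T -> rank_le N (S * T).
Proof.
move=> [g Tg]; exists (S \o g) => x; have [c Tc] := Tg x; exists c.
by rewrite bop_mulE Tc bop_app_sum; apply: eq_bigr => i _; rewrite bopZ.
Qed.

Lemma rank_leMr N S T : rank_le N T -> rank_le N (T * S).
Proof. by move=> [g Tg]; exists g => x; have [c Tc] := Tg (S x); exists c. Qed.

Lemma rank_leZ N a T : rank_le N T -> rank_le N (a *: T).
Proof.
by move=> hT; rewrite -[T]mul1r bop_scalerAl; apply: rank_leMl.
Qed.

Lemma rank_leN N T : rank_le N T -> rank_le N (- T).
Proof. by move=> hT; rewrite -scaleN1r; apply: rank_leZ. Qed.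

Lemma rank_le0 N : rank_le N 0.
Proof.
by exists (fun=> 0) => x; exists (fun=> 0); rewrite bop_zeroE big1 // => i _; rewrite scaler0.
Qed.

Fact rank1_linear (u v : V) : linear (fun x => ip x v *: u).
Proof. by move=> a x y; rewrite ipPl scalerDl scalerA. Qed.

Fact rank1_bounded (u v : V) : exists M : R, forall x, nm (ip x v *: u) <= M * nm x.
Proof.
exists (nm v * nm u) => x; rewrite nmZ mulrAC ler_wpM2r ?nm_ge0 //.
by rewrite (mulrC (nm v)) Cauchy_Schwarz.
Qed.

Definition rank1 u v := Bop (rank1_linear u v) (rank1_bounded u v).

End BopAlgebra.

Section SingularValueApproximation.
Context {R : realType} {V : hilbert R}.
Implicit Types (T : bop V) (x y : V).

Lemma compact_cluster T (u : nat -> V) : compact_op T -> (forall k, nm (u k) <= 1) ->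
  exists z, forall (d : R) N, 0 < d -> exists2 k, (N <= k)%N & nm (T (u k) - z) < d.
Proof.
move=> cT u1.
have [|z [_ clz]] := cT ((T \o u) @ \oo) _.
  exists 0 => // k _; apply: subset_closure; exists (u k) => //=.
  by rewrite nmE -(rmorph1 (real_complex R)) lecR.
exists z => d N d0.
have [||y [[k Nk <-] yd]] := clz [set T (u k) | k in [set k | (N <= k)%N]] (ball z d%:C).
- by exists N => // k Nk; exists k.
- by apply: nbhsx_ballx; rewrite ltcR.
exists k => //; move: yd; rewrite -ball_normE /= nmE ltcR.
by rewrite nmBC.
Qed.

(** The sesquilinear form of [L - T^* T]. *)
Definition defect T (L : R) x y : R[i] := L%:C * ip x y - ip (T x) (T y).

Lemma defectxx T L x : defect T L x x = (L * nm x ^+ 2 - nm (T x) ^+ 2)%:C.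
Proof. by rewrite /defect !ipxx -rcM -rcB. Qed.

Lemma defectPl T L a x y z : defect T L (a *: x + y) z = a * defect T L x z + defect T L y z.
Proof. rewrite /defect bop_linear !ipPl; ring. Qed.

Lemma defectC T L x y : defect T L y x = (defect T L x y)^*.
Proof. by rewrite /defect conjcD conjcN conjcM conjc_real -!ip_conj. Qed.

Lemma defectPr T L a x y z :
  defect T L z (a *: x + y) = a^* * defect T L z x + defect T L z y.
Proof. by rewrite !(defectC _ _ _ z) defectPl conjcD conjcM. Qed.

(** The defect form is positive on [W], hence obeys Cauchy-Schwarz there: a vector
    of zero defect is an eigenvector of [T^* T] relative to [W]. *)
Lemma defect_zero T L (W : V -> Prop) x y :
  (forall a x y, W x -> W y -> W (a *: x + y)) ->
  (forall x, W x -> nm (T x) ^+ 2 <= L * nm x ^+ 2) ->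
  W x -> W y -> nm (T x) ^+ 2 = L * nm x ^+ 2 -> defect T L x y = 0.
Proof.
move=> Wlin WL Wx Wy xL.
apply: cm_eq0; apply/eqP; rewrite -sqrf_eq0 eq_le sqr_ge0 andbT.
have := @discriminant_le R 0 (cm (defect T L x y) ^+ 2) (L * nm y ^+ 2 - nm (T y) ^+ 2).
rewrite mul0r; apply; rewrite ?sqr_ge0 ?subr_ge0 ?WL // => s.
set b := defect T L x y.
have Wz := Wlin (- (s%:C * b^*)^*) y x Wy Wx.
rewrite -ler0c; have : 0 <= defect T L (- (s%:C * b^*)^* *: y + x) (- (s%:C * b^*)^* *: y + x).
  by rewrite defectxx ler0c subr_ge0 WL.
rewrite defectPl !defectPr (defectC _ _ x y) -/b !defectxx xL subrr.
have := cm_sqr b; move: (L * _ - _) (cm b ^+ 2) => m2 b2 hb.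
rewrite conjcN conjcK conjcM conjcK conjc_real.
congr (_ <= _).
rewrite rcD sub0r rcN (rcM _ m2) !(rcM _ b2) -hb (rcM 2) rc_nat rcX; ring.
Qed.

(** A maximizing sequence for the norm of [T] on [W] has small defect; along a
    subsequence on which [T] converges, the defect form controls the distances,
    so the sequence itself converges. *)
Lemma norm_attained T (W : V -> Prop) (s : R) : compact_op T ->
  (forall a x y, W x -> W y -> W (a *: x + y)) ->
  (forall x, (forall d : R, 0 < d -> exists2 y, W y & nm (y - x) < d) -> W x) ->
  0 <= s -> (exists2 x, W x & s * nm x < nm (T x)) ->
  exists L x, [/\ s ^+ 2 < L, W x, x <> 0 & forall y, W y -> defect T L x y = 0].
Proof.
move=> cT Wlin Wcl s0 [x0 Wx0 hx0].
have WZ a x : W x -> W (a *: x).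
  move=> Wx; have W0 := Wlin (-1) x x Wx Wx.
  by rewrite scaleN1r addNr in W0; have := Wlin a x 0 Wx W0; rewrite addr0.
have WB x y : W x -> W y -> W (x - y).
  by move=> Wx Wy; have := Wlin (-1) y x Wy Wx; rewrite scaleN1r addrC.
have [C [C0 TC]] := opb_exists T.
pose A := [set r : R | exists x, [/\ W x, nm x <= 1 & r = nm (T x) ^+ 2]].
have A0 : A (nm (T (0 *: x0)) ^+ 2) by exists (0 *: x0); split; rewrite ?scale0r ?nm0 // -(scale0r x0); exact: WZ.
have Aub : has_ubound A.
  exists (C ^+ 2) => _ [x [Wx x1 ->]]; rewrite ler_sqr ?nnegrE ?nm_ge0 //.
  by apply: le_trans (TC x) _; rewrite ler_piMr.
have supA : has_sup A by split => //; exists (nm (T (0 *: x0)) ^+ 2).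
set L := sup A.
have AL r : A r -> r <= L by move=> Ar; exact: ub_le_sup.
have x0p : 0 < nm x0.
  rewrite lt_def nm_ge0 andbT; apply/eqP => /nm_eq0 x00.
  by move: hx0; rewrite x00 bop_app0 nm0 mulr0 ltxx.
have WL x : W x -> nm (T x) ^+ 2 <= L * nm x ^+ 2.
  move=> Wx; have [/nm_eq0->|x_0] := eqVneq (nm x) 0.
    by rewrite bop_app0 nm0 expr0n mulr0.
  have xp : 0 < nm x by rewrite lt_def x_0 nm_ge0.
  have := AL (nm (T ((nm x)^-1%:C *: x)) ^+ 2).
  rewrite bopZ !nmZ cm_real ger0_norm ?invr_ge0 ?nm_ge0 // exprMn exprVn.
  rewrite mulrC ler_pdivrMr ?exprn_gt0 //; apply.
  exists ((nm x)^-1%:C *: x); split; first exact: WZ.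
    by rewrite nmZ cm_real ger0_norm ?invr_ge0 ?nm_ge0 // mulVf.
  by rewrite bopZ nmZ cm_real ger0_norm ?invr_ge0 ?nm_ge0 // exprMn exprVn mulrC.
have sL : s ^+ 2 < L.
  have : (s * nm x0) ^+ 2 < nm (T x0) ^+ 2.
    by rewrite ltr_sqr ?nnegrE ?nm_ge0 // mulr_ge0 ?nm_ge0.
  move=> /lt_le_trans /(_ (WL _ Wx0)); rewrite exprMn ltr_pM2r //.
  by rewrite exprn_gt0.
have L0 : 0 < L by apply: le_lt_trans sL; rewrite sqr_ge0.
pose ie (m : nat) : R := (m.+1%:R)^-1.
have ie0 m : 0 < ie m by rewrite invr_gt0 ltr0n.
have [u hu] : exists u : nat -> V, forall k,
    [/\ W (u k), nm (u k) <= 1 & L - nm (T (u k)) ^+ 2 < ie k].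
  suff /boolp.choice[u hu] : forall k, exists v,
    [/\ W v, nm v <= 1 & L - nm (T v) ^+ 2 < ie k] by exists u.
  move=> k.
  have [_ [v [Wv v1 ->]] hv] := sup_adherent (ie0 k) supA.
  by exists v; split => //; rewrite -/L in hv; lra.
have [z hz] := compact_cluster cT (fun k => let: And3 _ h _ := hu k in h).
have [w hw] : exists w : nat -> V, forall m,
    [/\ W (w m), nm (w m) <= 1, L - nm (T (w m)) ^+ 2 < ie m & nm (T (w m) - z) < ie m].
  suff /boolp.choice[w hw] : forall m, exists v,
    [/\ W v, nm v <= 1, L - nm (T v) ^+ 2 < ie m & nm (T v - z) < ie m] by exists w.
  move=> m.
  have [k mk hk] := hz _ m (ie0 m); exists (u k).
  have [h1 h2 h3] := hu k; split => //; apply: lt_le_trans h3 _.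
  by rewrite lef_pV2 ?posrE ?ltr0n // ler_nat.
have ie_le m n : (m <= n)%N -> ie n <= ie m.
  by move=> mn; rewrite lef_pV2 ?posrE ?ltr0n // ler_nat.
have ie_small (d : R) : 0 < d -> exists N, ie N < d.
  move=> d0; exists (Num.truncn d^-1); rewrite /ie invf_plt ?posrE ?ltr0n //.
  exact: Num.Theory.truncnS_gt.
(* The parallelogram law for the quadratic form [D] bounds the defect of a
   difference of two almost maximizing vectors. *)
pose D x := L * nm x ^+ 2 - nm (T x) ^+ 2.
have Dpar x y : D (x - y) + D (x + y) = 2 * D x + 2 * D y.
  have ReN (c : R[i]) : complex.Re (- c) = - complex.Re c by case: c.
  rewrite /D bopB (bopD T x y) !nm_sqrD !nmN !ipNr !ReN; ring.
have WD x y : W x -> W y -> W (x + y).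
  by move=> Wx Wy; have := Wlin 1 x y Wx Wy; rewrite scale1r.
have D_ge0 x : W x -> 0 <= D x by move=> Wx; rewrite subr_ge0 WL.
have Dw m : D (w m) < ie m.
  have [_ w1 h _] := hw m; apply: le_lt_trans h; rewrite lerB // ler_piMr ?(ltW L0) //.
  by rewrite expr_le1 ?nm_ge0.
have [x wx] : exists x, forall d : R, 0 < d -> exists N, forall n, (N <= n)%N -> nm (w n - x) < d.
  apply: nm_complete => d d0.
  have d1 : 0 < Num.min 1 (L * d ^+ 2 / 8) by rewrite lt_min ltr01 divr_gt0 // mulr_gt0 // exprn_gt0.
  have [N] := ie_small _ d1; rewrite lt_min => /andP[N1 N8].
  exists N => m n Nm Nn.
  have [[Wm _ _ hm] [Wn _ _ hn]] := (hw m, hw n).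
  have Dd : D (w m - w n) <= 4 * ie N.
    have := Dpar (w m) (w n); have := D_ge0 _ (WD _ _ Wm Wn).
    have := Dw m; have := Dw n; have := ie_le _ _ Nm; have := ie_le _ _ Nn; lra.
  have Td : nm (T (w m - w n)) <= 2 * ie N.
    have -> : T (w m - w n) = (T (w m) - z) - (T (w n) - z).
      by rewrite bopB opprB addrA subrK.
    apply: le_trans (nmB _ _) _.
    have := ie_le _ _ Nm; have := ie_le _ _ Nn; lra.
  rewrite -ltr_sqr ?nnegrE ?nm_ge0 ?ltW // -(ltr_pM2l L0).
  have -> : L * nm (w m - w n) ^+ 2 = D (w m - w n) + nm (T (w m - w n)) ^+ 2.
    by rewrite /D subrK.
  have : nm (T (w m - w n)) ^+ 2 <= (2 * ie N) ^+ 2.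
    by rewrite ler_sqr ?nnegrE ?nm_ge0 // mulr_ge0 // ltW.
  have : ie N * ie N <= ie N by rewrite ler_piMr ?ltW.
  rewrite ltr_pdivlMr // in N8; rewrite exprMn expr2; nra.
have Wx : W x.
  apply: Wcl => d d0; have [N hN] := wx _ d0.
  by exists (w N); [case: (hw N)|exact: hN].
have near_x (d : R) : 0 < d -> exists m, ie m < d /\ nm (w m - x) < d.
  move=> d0; have [N hN] := wx _ d0; have [M hM] := ie_small _ d0.
  exists (maxn M N); split; last by rewrite hN // leq_maxr.
  by apply: le_lt_trans hM; rewrite ie_le // leq_maxl.
have Dx : D x <= 0.
  apply/ler_addgt0Pr => d d0; rewrite add0r.
  have K0 : 0 < 4 + 4 * L by lra.
  have e0 : 0 < Num.min 1 (d / (4 + 4 * L)) by rewrite lt_min ltr01 divr_gt0.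
  have [m []] := near_x _ e0; rewrite !lt_min !ltr_pdivlMr // => /andP[_ hm] /andP[t1 ht].
  have [Wm _ _ _] := hw m; have Wb := WB _ _ Wx Wm.
  have := Dpar (w m) (x - w m); rewrite (_ : w m + (x - w m) = x); last by rewrite addrC subrK.
  have := D_ge0 _ (WB _ _ Wm Wb); have := Dw m.
  have : D (x - w m) <= L * nm (w m - x) ^+ 2 by rewrite nmBC /D gerBl sqr_ge0.
  move: (D (x - w m)) (D (w m)) (D (w m - _)) => D1 D2 D3.
  have : nm (w m - x) ^+ 2 <= nm (w m - x) by rewrite expr2 ler_piMl ?nm_ge0 // ltW.
  have := mulr_ge0 (ltW (ie0 m)) (ltW L0); have := nm_ge0 (w m - x).
  move=> ? ? /(ler_wpM2l (ltW L0)); lra.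
have Tx : nm (T x) ^+ 2 = L * nm x ^+ 2 by apply/eqP; rewrite eq_le WL //= -subr_le0.
exists L, x; split => //; last by move=> y Wy; apply: (@defect_zero T L W).
move=> x0'; have e0 : 0 < Num.min 2^-1 (L / 2) by rewrite lt_min invr_gt0 ltr0n divr_gt0.
have [m []] := near_x _ e0; rewrite !lt_min x0' subr0 => /andP[_ hm] /andP[t2 _].
have [Wm _ hL _] := hw m; have := WL _ Wm.
have : nm (w m) ^+ 2 <= 2^-1 * 2^-1.
  by rewrite expr2; apply: ler_pM; rewrite ?nm_ge0 // ltW.
move=> /(ler_wpM2l (ltW L0)); lra.
Qed.

(** The truncated singular value expansion: the operator restricted to the
    orthogonal complement of the first [n] singular vectors has norm at most
    [s n], as an attained larger norm would be a further singular value. *)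
Lemma singular_values_approx T (s : nat -> R) : compact_op T -> singular_values T s ->
  forall n, exists G, rank_le n G /\ opb (T - G) (s n).
Proof.
move=> cT [s0 s_mono [e [eo es emax]]] n.
pose f k := if 0 < s k then e k else 0.
have fo : orthonormal_seq f.
  split=> [k l kl|k]; rewrite /f.
    case: ifP => sk; last by rewrite ip0l.
    by case: ifP => sl; rewrite ?ip0r // eo // (negbTE kl).
  by case: ifP => sk; [right; rewrite eo ?eqxx|left].
pose P : bop V := \sum_(k < n) rank1 (f k) (f k).
have PE x : P x = proj f n x by rewrite /P bop_sumE.
exists (T * P); split.
  apply: rank_leMl; exists f => x; exists (fun k => ip x (f k)).
  by rewrite PE.
split=> // x; rewrite bop_subE bop_mulE PE -bopB.
set y := x - proj f n x.
(* The complement of the first [n] singular vectors. *)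
pose W v := forall k, (k < n)%N -> ip v (f k) = 0.
have Wy : W y by move=> k kn; exact: proj_residue.
suff hW v : W v -> nm (T v) <= s n * nm v.
  apply: le_trans (hW _ Wy) _; apply: ler_wpM2l => //.
  exact: residue_le.
move=> Wv; rewrite leNgt; apply/negP => hv.
have [||L [z [sL Wz z0 zL]]] := @norm_attained T W (s n) cT _ _ (s0 n) (ex_intro2 _ _ v Wv hv).
- by move=> a x1 x2 W1 W2 k kn; rewrite ipPl W1 // W2 // mulr0 addr0.
- move=> w hw k kn; apply: cm_eq0; apply/eqP; rewrite eq_le cm_ge0 andbT.
  apply/ler_addgt0Pr => d d0; rewrite add0r.
  have [w' Ww' hw'] := hw d d0.
  have -> : ip w (f k) = - ip (w' - w) (f k) by rewrite ipBl Ww' // sub0r opprK.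
  rewrite cmN; apply: le_trans (Cauchy_Schwarz _ _) _.
  have fk : nm (f k) <= 1.
    case: (fo.2 k) => [->|]; first by rewrite nm0.
    rewrite ipxx => /complexI h; have := nm_ge0 (f k); nra.
  by apply: le_trans (ler_wpM2l (nm_ge0 _) fk) _; rewrite mulr1 ltW.
have L0 : 0 < L by apply: le_lt_trans sL; rewrite sqr_ge0.
have Tef w k : 0 < s k -> ip (T w) (T (e k)) = (s k ^+ 2)%:C * ip w (e k).
  by move=> sk; rewrite ip_conj es // conjcM conjc_real -ip_conj.
have zeig : abs_eigen T (Num.sqrt L) z.
  move=> w; rewrite sqr_sqrtr ?ltW //.
  have Ww : W (w - proj f n w) by move=> k kn; exact: proj_residue.
  have := zL _ Ww.
  rewrite /defect bopB !ipBr /proj !ip_sumr bop_app_sum ip_sumr.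
  rewrite big1 => [|k _]; last by rewrite ipZr Wz ?mulr0.
  rewrite big1 => [|k _].
    by rewrite !subr0 => /eqP; rewrite subr_eq0 => /eqP.
  rewrite bopZ ipZr /f; case: ifP => sk; last by rewrite bop_app0 !ip0r mulr0.
  by rewrite Tef // -[e k]/(if true then e k else 0) -sk -/(f k) Wz ?mulr0.
apply: z0; apply: (emax (Num.sqrt L)); rewrite ?sqrtr_gt0 // => k sk.
have [kn|nk] := ltnP k n; first by have := Wz k kn; rewrite /f sk.
have := zeig (e k); rewrite Tef // sqr_sqrtr ?ltW // => /eqP.
rewrite -subr_eq0 -mulrBl mulf_eq0 -rcB => /orP[|/eqP //].
move=> /eqP /complexI /eqP; rewrite subr_eq0 => /eqP skL.
move: sL; rewrite -skL ltNge; case/negP.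
by rewrite ler_sqr ?nnegrE // s_mono.
Qed.

End SingularValueApproximation.

(** * Nuclear operators and the trace *)

Section Limits.
Context {R : realType}.

Definition clim (s : nat -> R[i]) (z : R[i]) :=
  forall d : R, 0 < d -> exists N, forall n, (N <= n)%N -> cm (s n - z) < d.

Lemma summable_tail (a : nat -> R) (A : R) : (forall k, 0 <= a k) ->
  (forall n, \sum_(k < n) a k <= A) ->
  forall d, 0 < d -> exists N, forall n, \sum_(N <= k < n) a k < d.
Proof.
move=> a0 aA d d0; pose s n := \sum_(k < n) a k.
have /cvg_ex [/= l sl] : cvgn s.
  apply: nondecreasing_is_cvgn => [m n mn|].
    rewrite /s -!(big_mkord xpredT a) (big_cat_nat (leq0n m) mn) /= lerDl.
    by apply: sumr_ge0 => k _.
  by exists A => _ [n _ <-]; exact: aA.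
have d2 : 0 < d / 2 by rewrite divr_gt0.
have /cvgrPdist_lt /(_ _ d2) [N _ hN] := sl.
exists N => n; have [nN|Nn] := leqP n N; first by rewrite big_geq.
have /= h1 := hN N (leqnn N); have /= h2 := hN n (ltnW Nn).
have -> : \sum_(N <= k < n) a k = s n - s N.
  by rewrite /s -!(big_mkord xpredT a) (big_cat_nat (leq0n N) (ltnW Nn)) /= addrAC subrr add0r.
have -> : s n - s N = (l - s N) - (l - s n) by ring.
apply: le_lt_trans (ler_norm _) _; apply: le_lt_trans (ler_normB _ _) _; lra.
Qed.

Lemma real_cauchy_lim (s : nat -> R) :
  (forall d, 0 < d -> exists N, forall m n, (N <= m)%N -> (N <= n)%N -> `|s m - s n| < d) ->
  exists l, forall d, 0 < d -> exists N, forall n, (N <= n)%N -> `|s n - l| < d.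
Proof.
move=> cs; have : cauchy (s @ \oo).
  apply: cauchy_exP => e e0; have [N hN] := cs e e0; exists (s N); exists N => // n /= Nn.
  by rewrite -ball_normE /=; apply: hN.
move/cauchy_cvg/cvg_ex => [l ul]; exists l => e e0.
have /cvgrPdist_lt /(_ _ e0) [N _ hN] := ul.
by exists N => n Nn; rewrite distrC; apply: hN.
Qed.

Lemma clim_exists (s : nat -> R[i]) (a : nat -> R) (A : R) : (forall k, 0 <= a k) ->
  (forall n, \sum_(k < n) a k <= A) ->
  (forall m n, (m <= n)%N -> cm (s n - s m) <= \sum_(m <= k < n) a k) ->
  exists z, clim s z.
Proof.
move=> a0 aA sa.
have cs d : 0 < d -> exists N, forall m n, (N <= m)%N -> (N <= n)%N -> cm (s m - s n) < d.
  move=> d0; have [N hN] := summable_tail a0 aA d0; exists N => m n Nm Nn.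
  wlog mn : m n Nm Nn / (m <= n)%N.
    move=> H; have [mn|nm_] := leqP m n; first exact: H.
    by rewrite cmBC; apply: H => //; exact: ltnW.
  rewrite cmBC; apply: le_lt_trans (sa _ _ mn) _; apply: le_lt_trans (hN n).
  by rewrite [leRHS](big_cat_nat Nm mn) /= lerDr; apply: sumr_ge0.
have [x hx] : exists x, forall d, 0 < d -> exists N, forall n, (N <= n)%N -> `|complex.Re (s n) - x| < d.
  apply: real_cauchy_lim => d d0; have [N hN] := cs d d0; exists N => m n Nm Nn.
  apply: le_lt_trans (hN m n Nm Nn); apply: le_trans (Re_le_cm _).
  by case: (s m) (s n) => [? ?] [? ?].
have [y hy] : exists x, forall d, 0 < d -> exists N, forall n, (N <= n)%N -> `|complex.Im (s n) - x| < d.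
  apply: real_cauchy_lim => d d0; have [N hN] := cs d d0; exists N => m n Nm Nn.
  apply: le_lt_trans (hN m n Nm Nn); apply: le_trans (Im_le_cm _).
  by case: (s m) (s n) => [? ?] [? ?].
exists (Complex x y) => d d0; have d2 : 0 < d / 2 by rewrite divr_gt0.
have [N hN] := hx _ d2; have [M hM] := hy _ d2; exists (maxn N M) => n.
rewrite geq_max => /andP[/hN h1 /hM h2]; apply: le_lt_trans (cm_le_ReIm _) _.
move: h1 h2; case: (s n) => [u v] /=; lra.
Qed.

Lemma clim_unique s z w : clim s z -> clim s w -> z = w.
Proof.
move=> hz hw; apply/eqP; rewrite -subr_eq0; apply/eqP/cm_eq0/eqP.
rewrite eq_le cm_ge0 andbT; apply/ler_addgt0Pr => d d0; rewrite add0r.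
have d2 : 0 < d / 2 by rewrite divr_gt0.
have [N hN] := hz _ d2; have [M hM] := hw _ d2.
have h1 := hN (maxn N M) (leq_maxl _ _); have h2 := hM (maxn N M) (leq_maxr _ _).
have -> : z - w = (s (maxn N M) - w) - (s (maxn N M) - z) by ring.
apply: le_trans (cmB _ _) _; lra.
Qed.

Lemma climD s t z w : clim s z -> clim t w -> clim (fun n => s n + t n) (z + w).
Proof.
move=> hz hw d d0; have d2 : 0 < d / 2 by rewrite divr_gt0.
have [N hN] := hz _ d2; have [M hM] := hw _ d2; exists (maxn N M) => n.
rewrite geq_max => /andP[/hN h1 /hM h2]; rewrite opprD addrACA.
apply: le_lt_trans (cmD _ _) _; lra.
Qed.

Lemma climZ a s z : clim s z -> clim (fun n => a * s n) (a * z).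
Proof.
move=> hz d d0; have a0 : 0 < cm a + 1 by rewrite ltr_wpDl ?cm_ge0.
have [N hN] := hz _ (divr_gt0 d0 a0); exists N => n /hN.
rewrite -mulrBr cmM ltr_pdivlMr //; apply: le_lt_trans.
by rewrite mulrC ler_wpM2l ?cm_ge0 // lerDl.
Qed.

Lemma clim_le s z C : clim s z -> (forall n, cm (s n) <= C) -> cm z <= C.
Proof.
move=> hz hs; apply/ler_addgt0Pr => d d0; have [N hN] := hz d d0.
have -> : z = s N - (s N - z) by ring.
apply: le_trans (cmB _ _) _; have := hs N; have := hN N (leqnn N); lra.
Qed.

Lemma climP (s : nat -> R[i]) z : (s : nat -> R[i]^o) @ \oo --> (z : R[i]^o) <-> clim s z.
Proof.
split=> [sz d d0|sz].
  have d0' : 0 < d%:C :> R[i] by rewrite ltcR.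
  have /cvgrPdist_lt /(_ _ d0') [N _ hN] := sz.
  by exists N => n Nn; have := hN n Nn; rewrite /= cmE ltcR cmBC.
apply/cvgrPdist_lt => e e0.
have eE : e = (complex.Re e)%:C by rewrite RRe_real // gtr0_real.
have [|N hN] := sz (complex.Re e); first by rewrite -ltcR -eE.
by exists N => // n /= Nn; rewrite cmE eE ltcR cmBC; apply: hN.
Qed.

End Limits.

Section Trace.
Context {R : realType} {V : hilbert R}.
Implicit Types (S T B : bop V) (x y : V).

Lemma is_traceP T z : is_trace T z <->
  forall e, orthonormal_basis e -> clim (fun N => \sum_(n < N) ip (T (e n)) (e n)) z.
Proof.
have sE (e : nat -> V) : series (fun n => ip (T (e n)) (e n) : R[i]^o) =
    (fun N => \sum_(n < N) ip (T (e n)) (e n)).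
  by apply/funext => N; rewrite /series /= big_mkord.
split=> h e /h; first by rewrite sE => /climP.
by move=> /climP; rewrite sE.
Qed.

Lemma traceE T z : is_trace T z -> trace T = z.
Proof.
move=> hz; rewrite /trace; case: xgetP => [w _ hw|/(_ z)]; last by case.
have [e eb] := @orthonormal_basis_exists R V.
move: hz hw => /is_traceP /(_ e eb) hz /is_traceP /(_ e eb) hw.
exact: clim_unique hw hz.
Qed.

Lemma is_traceD S T z w : is_trace S z -> is_trace T w -> is_trace (S + T) (z + w).
Proof.
move=> /is_traceP hS /is_traceP hT; apply/is_traceP => e eb.
have := climD (hS e eb) (hT e eb); congr (clim _ _); apply/funext => N.
by rewrite -big_split; apply: eq_bigr => n _; rewrite bop_addE ipDl.
Qed.

Lemma is_traceZ a T z : is_trace T z -> is_trace (a *: T) (a * z).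
Proof.
move=> /is_traceP hT; apply/is_traceP => e eb.
have := climZ a (hT e eb); congr (clim _ _); apply/funext => N.
by rewrite mulr_sumr; apply: eq_bigr => n _; rewrite bop_scaleE ipZl.
Qed.

(** A nuclear expansion of [T], grouped in finite blocks because it arises from
    a dyadic sequence of finite-rank approximations. *)
Definition nuclear_expansion T (N : nat -> nat) (phi : nat -> nat -> V -> R[i])
    (f : nat -> nat -> V) (a : nat -> R) (A b : R) :=
  [/\ forall j i c x y, phi j i (c *: x + y) = c * phi j i x + phi j i y,
      forall j, 0 <= a j,
      forall j i x, cm (phi j i x) <= a j * nm x,
      0 <= b /\ forall j i, nm (f j i) <= b
    & (forall n, \sum_(j < n) (N j)%:R * a j <= A) /\
      forall x (d : R), 0 < d -> exists J0, forall J, (J0 <= J)%N ->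
        nm (T x - \sum_(j < J) \sum_(i < N j) phi j i x *: f j i) < d].

Definition expansion_trace (N : nat -> nat) (phi : nat -> nat -> V -> R[i])
    (f : nat -> nat -> V) (J : nat) := \sum_(j < J) \sum_(i < N j) phi j i (f j i).

Lemma expansion_trace_lim T N phi f a A b : nuclear_expansion T N phi f a A b ->
  exists z, clim (expansion_trace N phi f) z /\ cm z <= A * b.
Proof.
case=> philin a0 phia [b0 fb] [aA Tx].
have blk j : cm (\sum_(i < N j) phi j i (f j i)) <= (N j)%:R * a j * b.
  apply: le_trans (cm_sum _ _ _) _.
  apply: le_trans (ler_sum _ (G := fun _ => a j * b) _) _ => [i _|].
    by apply: le_trans (phia _ _ _) _; rewrite ler_wpM2l.
  by rewrite sumr_const card_ord -mulrA mulr_natl.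
have [z hz] : exists z, clim (expansion_trace N phi f) z.
  apply: (@clim_exists _ _ (fun j => (N j)%:R * a j * b) (A * b)).
  - by move=> k; rewrite !mulr_ge0.
  - by move=> n; rewrite -mulr_suml ler_wpM2r.
  - move=> m n mn; rewrite /expansion_trace.
    rewrite -!(big_mkord xpredT (fun j => \sum_(i < N j) phi j i (f j i))).
    rewrite (big_cat_nat (leq0n m) mn) /= addrAC subrr add0r.
    by apply: le_trans (cm_sum _ _ _) _; apply: ler_sum => j _; exact: blk.
exists z; split=> //; apply: clim_le hz _ => n.
apply: le_trans (cm_sum _ _ _) _.
apply: le_trans (ler_sum _ (G := fun j : 'I_n => (N j)%:R * a j * b) (fun j _ => blk j)) _.
rewrite -mulr_suml; apply: ler_wpM2r => //; exact: aA.
Qed.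

Lemma near_all (P : nat -> nat -> Prop) : (forall k, exists N, forall n, (N <= n)%N -> P k n) ->
  forall K, exists N, forall n, (N <= n)%N -> forall k, (k < K)%N -> P k n.
Proof.
move=> h; elim=> [|K [N hN]]; first by exists 0%N.
have [M hM] := h K; exists (maxn N M) => n; rewrite geq_max => /andP[Nn Mn] k.
by rewrite ltnS leq_eqVlt => /predU1P[->|]; [exact: hM|exact: hN].
Qed.

(** The diagonal sum over the first [M] basis vectors replaces each [f j i] by
    its projection, and dominated convergence lets [M] grow under the sum. *)
Lemma expansion_is_trace T N phi f a A b z : nuclear_expansion T N phi f a A b ->
  clim (expansion_trace N phi f) z -> is_trace T z.
Proof.
case=> philin a0 phia [b0 fb] [aA Tx] hz; apply/is_traceP => e eb d d0.
have eo := basis_orthonormal eb.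
have phi0 j i : phi j i 0 = 0.
  by have := philin j i (-1) 0 0; rewrite scaler0 addr0 mulN1r addNr.
have phiB j i x y : phi j i (x - y) = phi j i x - phi j i y.
  by have := philin j i (-1) y x; rewrite scaleN1r mulN1r addrC => ->; rewrite addrC.
have phi_sum j i (m : nat) (c : nat -> R[i]) (g : nat -> V) :
    phi j i (\sum_(n < m) c n *: g n) = \sum_(n < m) c n * phi j i (g n).
  elim: m => [|m IHm]; first by rewrite !big_ord0 phi0.
  by rewrite !big_ord_recr /= addrC philin IHm addrC.
have Na0 j : 0 <= (N j)%:R * a j by rewrite mulr_ge0.
have A0 : 0 <= A by have := aA 0%N; rewrite big_ord0.
(* Two parts are spent on limits, two on the head and the tail of the sum. *)
have d5 : 0 < d / 5 by rewrite divr_gt0.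
have b1 : 0 < b + 1 by rewrite ltr_wpDl.
have A1 : 0 < A + 1 by rewrite ltr_wpDl.
have [J0 hJ0] := summable_tail Na0 aA (divr_gt0 d5 b1).
have [M0 hM0] : exists M0, forall M, (M0 <= M)%N -> forall j, (j < J0)%N ->
    forall i, (i < N j)%N -> nm (proj e M (f j i) - f j i) < d / 5 / (A + 1).
  apply: near_all => j; apply: near_all => i; apply: proj_cvg => //.
  exact: divr_gt0.
exists M0 => M /hM0 {}hM0.
pose S J := \sum_(j < J) \sum_(i < N j) phi j i (proj e M (f j i)).
have hS : clim S (\sum_(n < M) ip (T (e n)) (e n)).
  have SE J : S J = \sum_(n < M) ip (\sum_(j < J) \sum_(i < N j) phi j i (e n) *: f j i) (e n).
    rewrite /S (eq_bigr (fun j : 'I_J => \sum_(n < M) \sum_(i < N j) ip (f j i) (e n) * phi j i (e n))).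
      rewrite exchange_big /=; apply: eq_bigr => n _; rewrite ip_suml.
      apply: eq_bigr => j _; rewrite ip_suml; apply: eq_bigr => i _.
      by rewrite ipZl mulrC.
    move=> j _; rewrite exchange_big /=; apply: eq_bigr => i _.
    exact: (phi_sum j i M (fun n => ip (f j i) (e n)) e).
  rewrite (_ : S = (fun J => \sum_(n < M) ip (\sum_(j < J) \sum_(i < N j) phi j i (e n) *: f j i) (e n))); last exact/funext.
  move: (M) => m; elim: m => [|m IHm].
    by move=> c c0; exists 0%N => n _; rewrite !big_ord0 subrr cm0.
  rewrite big_ord_recr (_ : (fun J => _) = fun J =>
    \sum_(n < m) ip (\sum_(j < J) \sum_(i < N j) phi j i (e n) *: f j i) (e n) +
    ip (\sum_(j < J) \sum_(i < N j) phi j i (e m) *: f j i) (e m)); last first.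
    by apply/funext => J; rewrite big_ord_recr.
  apply: climD => // c c0.
  have [J1 hJ1] := Tx (e m) c c0; exists J1 => J /hJ1.
  rewrite -ipBl => h; apply: le_lt_trans (Cauchy_Schwarz _ _) _.
  have em : nm (e m) <= 1.
    case: (eo.2 m) => [->|]; first by rewrite nm0.
    rewrite ipxx => /complexI; have := nm_ge0 (e m); nra.
  by apply: le_lt_trans (ler_wpM2l (nm_ge0 _) em) _; rewrite mulr1 nmBC.
have [J1 hJ1] := hS _ d5; have [J2 hJ2] := hz _ d5.
set J := maxn J0 (maxn J1 J2).
have /hJ1 h1 : (J1 <= J)%N by rewrite /J leq_max leq_maxl orbT.
have /hJ2 h2 : (J2 <= J)%N by rewrite /J leq_max leq_maxr orbT.
have J0J : (J0 <= J)%N by rewrite leq_maxl.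
have h3 : cm (S J - expansion_trace N phi f J) <= d / 5 + d / 5.
  rewrite /S /expansion_trace -sumrB.
  pose F j := \sum_(i < N j) phi j i (proj e M (f j i)) - \sum_(i < N j) phi j i (f j i).
  rewrite -(big_mkord xpredT F) (big_cat_nat (leq0n J0) J0J) /=.
  have Fle j (c : R) : (forall i, (i < N j)%N -> nm (proj e M (f j i) - f j i) <= c) ->
      cm (F j) <= (N j)%:R * a j * c.
    move=> hc; rewrite /F -sumrB; apply: le_trans (cm_sum _ _ _) _.
    apply: le_trans (ler_sum _ (G := fun _ => a j * c) _) _ => [i _|].
      rewrite -phiB; apply: le_trans (phia _ _ _) _.
      by rewrite ler_wpM2l // hc.
    by rewrite sumr_const card_ord -mulrA mulr_natl.
  apply: le_trans (cmD _ _) _; apply: lerD; apply: le_trans (cm_sum _ _ _) _.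
    rewrite big_nat; apply: le_trans (ler_sum _ (G := fun j => (N j)%:R * a j * (d / 5 / (A + 1))) _) _.
      by move=> j /andP[_ jJ]; apply: Fle => i ij; rewrite ltW // hM0.
    rewrite -big_nat -mulr_suml big_mkord.
    rewrite mulrA ler_pdivrMr // mulrC ler_wpM2l ?(ltW d5) //.
    by apply: le_trans (aA _) _; rewrite lerDl.
  apply: le_trans (ler_sum _ (G := fun j => (N j)%:R * a j * b) _) _.
    move=> j _; apply: Fle => i _; rewrite nmBC.
    by apply: le_trans (residue_le _ _ eo) _.
  rewrite -mulr_suml; have := hJ0 J; rewrite ltr_pdivlMr // => /ltW.
  apply: le_trans; rewrite ler_wpM2l ?lerDl // sumr_ge0 //.
set X := \sum_(n < M) _ in h1 *.
have -> : X - z = - (S J - X) + (S J - expansion_trace N phi f J) + (expansion_trace N phi f J - z) by ring.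
apply: le_lt_trans (cmD _ _) _; apply: le_lt_trans (lerD (cmD _ _) (lexx _)) _.
rewrite cmN; lra.
Qed.

Definition nuclear T := exists N phi f a A b, nuclear_expansion T N phi f a A b.

Definition traceable T := exists z, is_trace T z.

Lemma nuclear_traceable T : nuclear T -> traceable T.
Proof.
move=> [N [phi [f [a [A [b h]]]]]]; have [z [hz _]] := expansion_trace_lim h.
by exists z; apply: expansion_is_trace h hz.
Qed.

Lemma traceableD S T : traceable S -> traceable T -> trace (S + T) = trace S + trace T.
Proof.
by move=> [z hz] [w hw]; rewrite (traceE hz) (traceE hw); apply/traceE/is_traceD.
Qed.

Lemma traceableZ c T : traceable T -> trace (c *: T) = c * trace T.
Proof. by move=> [z hz]; rewrite (traceE hz); apply/traceE/is_traceZ. Qed.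

(** Both products have a nuclear expansion with the same diagonal terms
    [phi j i (B (f j i))]. *)
Lemma nuclear_traceC T B : nuclear T -> trace (T * B) = trace (B * T).
Proof.
move=> [N [phi [f [a [A [b h]]]]]]; have [D [D0 BD]] := opb_exists B.
case: h => philin a0 phia [b0 fb] [aA Tx].
have h1 : nuclear_expansion (T * B) N (fun j i x => phi j i (B x)) f (fun j => a j * D) (A * D) b.
  split => //.
  - by move=> j i c x y; rewrite bop_linear philin.
  - by move=> j; rewrite mulr_ge0.
  - by move=> j i x; apply: le_trans (phia _ _ _) _; rewrite -mulrA ler_wpM2l.
  - split=> [n|x d d0]; last exact: Tx.
    by under eq_bigr do rewrite mulrA; rewrite -mulr_suml ler_wpM2r.
have h2 : nuclear_expansion (B * T) N phi (fun j i => B (f j i)) a A (D * b).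
  split => //.
  - split=> [|j i]; first exact: mulr_ge0.
    by apply: le_trans (BD _) _; rewrite ler_wpM2l.
  - split=> // x d d0; have D1 : 0 < D + 1 by rewrite ltr_wpDl.
    have [J0 hJ0] := Tx x _ (divr_gt0 d0 D1); exists J0 => J /hJ0.
    rewrite ltr_pdivlMr // => hJ.
    have -> : (B * T) x - \sum_(j < J) \sum_(i < N j) phi j i x *: B (f j i) =
        B (T x - \sum_(j < J) \sum_(i < N j) phi j i x *: f j i).
      rewrite bopB bop_app_sum; congr (_ - _); apply: eq_bigr => j _.
      by rewrite bop_app_sum; apply: eq_bigr => i _; rewrite bopZ.
    apply: le_lt_trans (BD _) _; apply: le_lt_trans hJ; rewrite mulrC.
    by rewrite ler_wpM2l ?nm_ge0 // lerDl.
have [z [hz _]] := expansion_trace_lim h1.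
by rewrite (traceE (expansion_is_trace h1 hz)) (traceE (expansion_is_trace h2 hz)).
Qed.

End Trace.

(** * Approximation numbers *)

Section Gauge.
Context {R : realType} {V : hilbert R} (r : nat -> R).
Hypothesis r_ge0 : forall n, 0 <= r n.
Hypothesis r_dec : forall m n, (m <= n)%N -> r n <= r m.
Implicit Types (S T G B : bop V).

(** The approximation numbers of [T] decay like the [k]-th power of the rate
    [r], up to the factor [C] and the rank dilation [M]. The rank is kept apart
    from the size because sums increase the rank only by a bounded factor. *)
Definition gauge (k M : nat) (C : R) T := 0 <= C /\
  forall n, exists G, rank_le (M * n) G /\ opb (T - G) (C * r n ^+ k).

Lemma gauge0 k M C : 0 <= C -> gauge k M C 0.
Proof.
move=> C0; split=> // n; exists 0; split; first exact: rank_le0.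
by rewrite subrr; apply: opb_le opb0 _; rewrite mulr_ge0 ?exprn_ge0.
Qed.

Lemma gaugeW k M N C D T : gauge k M C T -> (M <= N)%N -> C <= D -> gauge k N D T.
Proof.
move=> [C0 h] MN CD; split; first exact: le_trans CD.
move=> n; have [G [rG bG]] := h n; exists G; split.
  by apply: rank_leW rG _; rewrite leq_mul2r MN orbT.
by apply: opb_le bG _; rewrite ler_wpM2r ?exprn_ge0.
Qed.

Lemma gaugeD k M N C D S T : gauge k M C S -> gauge k N D T ->
  gauge k (M + N) (C + D) (S + T).
Proof.
move=> [C0 hS] [D0 hT]; split; first exact: addr_ge0.
move=> n; have [G [rG bG]] := hS n; have [H [rH bH]] := hT n.
exists (G + H); split; first by rewrite mulnDl; apply: rank_leD.
by rewrite opprD addrACA mulrDl; apply: opbD.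
Qed.

(** If [G] and [H] approximate [S] and [T], the finite-rank operator
    [G * T + (S - G) * H] has the error [(S - G) * (T - H)]. *)
Lemma gaugeM k l M N C D S T : gauge k M C S -> gauge l N D T ->
  gauge (k + l) (M + N) (C * D) (S * T).
Proof.
move=> [C0 hS] [D0 hT]; split; first exact: mulr_ge0.
move=> n; have [G [rG bG]] := hS n; have [H [rH bH]] := hT n.
exists (G * T + (S - G) * H); split.
  by rewrite mulnDl; apply: rank_leD; [apply: rank_leMr|apply: rank_leMl].
have -> : S * T - (G * T + (S - G) * H) = (S - G) * (T - H).
  by rewrite opprD addrA -mulrBl -mulrBr.
by rewrite exprD mulrACA; apply: opbM.
Qed.

Lemma gauge_opb C T : opb T C -> gauge 0 0 C T.
Proof.
move=> TC; split=> [|n]; first by case: TC.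
by exists 0; split; [exact: rank_le0|rewrite subr0 expr0 mulr1].
Qed.

Lemma gaugeZ k M C a T : gauge k M C T -> gauge k M (cm a * C) (a *: T).
Proof.
move=> [C0 h]; split; first by rewrite mulr_ge0 ?cm_ge0.
move=> n; have [G [rG bG]] := h n; exists (a *: G); split; first exact: rank_leZ.
by rewrite -scalerBr -mulrA; apply: opbZ.
Qed.

(** Orthonormalize vectors that span the range. *)
Lemma finite_rank_expansion N G : rank_le N G -> exists f : nat -> V,
  (forall i, nm (f i) <= 1) /\ forall x, G x = \sum_(i < N) ip (G x) (f i) *: f i.
Proof.
move=> [g Gg]; have [f [fo fg]] := Gram_Schmidt g; exists f; split=> [i|x].
  case: (fo.2 i) => [->|]; first by rewrite nm0.
  rewrite ipxx => /complexI; have := nm_ge0 (f i); nra.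
rewrite -/(proj f N (G x)); have [c ->] := Gg x; rewrite proj_sum.
by apply: eq_bigr => i _; rewrite projZ fg.
Qed.

(** Cauchy condensation. *)
Lemma dyadic_sum (q : nat -> R) (Q : R) : (forall n, 0 <= q n) ->
  (forall m n, (m <= n)%N -> q n <= q m) -> (forall n, \sum_(k < n) q k <= Q) ->
  forall J, \sum_(j < J) (2 ^ j)%:R * q (2 ^ j)%N <= 2 * Q.
Proof.
move=> q0 qdec qQ J.
have h : \sum_(j < J.+1) (2 ^ j)%:R * q (2 ^ j)%N <= 2 * \sum_(1 <= k < (2 ^ J).+1) q k.
  elim: J => [|J IHJ]; first by rewrite big_ord1 expn0 mul1r big_nat1; have := q0 1%N; lra.
  rewrite big_ord_recr /=.
  have lt2 : (2 ^ J < (2 ^ J.+1).+1)%N by rewrite ltnS leq_exp2l.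
  rewrite (big_cat_nat (n := (2 ^ J).+1)) //= mulrDr; apply: lerD => //.
  rewrite expnS natrM -mulrA ler_wpM2l //.
  apply: le_trans (_ : \sum_((2 ^ J).+1 <= k < (2 * 2 ^ J).+1) q (2 * 2 ^ J)%N <= _).
    rewrite sumr_const_nat subSS mul2n -addnn addnK mulr_natl //.
  apply: ler_sum_nat => k /andP[_ hk]; apply: qdec.
  by rewrite -ltnS.
apply: le_trans (_ : \sum_(j < J.+1) (2 ^ j)%:R * q (2 ^ j)%N <= _).
  by rewrite big_ord_recr /= lerDl mulr_ge0.
apply: le_trans h _; rewrite ler_wpM2l //.
apply: le_trans (qQ (2 ^ J).+1); rewrite -(big_mkord xpredT q) [leRHS]big_nat_recl //=.
by rewrite big_add1 /= lerDr.
Qed.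

(** Split [T] along a dyadic sequence of approximants; an operator of rank [N] has
    nuclear norm at most [N] times its operator norm. *)
Lemma gauge_nuclear k M C (Q : R) T : (forall n, \sum_(i < n) r i ^+ k <= Q) ->
  gauge k M C T -> nuclear T /\ cm (trace T) <= 14 * Q * M%:R * C.
Proof.
move=> hQ [C0 h].
pose q n := r n ^+ k.
have q0 n : 0 <= q n by rewrite exprn_ge0.
have qdec m n : (m <= n)%N -> q n <= q m.
  by move=> mn; rewrite /q lerXn2r ?nnegrE // r_dec.
have [G hG] : exists G : nat -> bop V, forall n, rank_le (M * n) (G n) /\ opb (T - G n) (C * q n).
  by have /boolp.choice[G hG] := h; exists G.
have G0 : opb T (C * q 0%N).
  have [[g hg] hT] := hG 0%N; suff G00 : G 0%N = 0 by rewrite G00 subr0 in hT.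
  by apply: bopP => x; have [c ->] := hg x; rewrite muln0 big_ord0.
pose D j := if j is i.+1 then G (2 ^ i.+1)%N - G (2 ^ i)%N else G 1%N.
pose N j := if j is i.+1 then (M * (3 * 2 ^ i))%N else M.
pose a j := if j is i.+1 then 2 * C * q (2 ^ i)%N else 2 * C * q 0%N.
have DN j : rank_le (N j) (D j).
  case: j => [|i] /=; first by have [+ _] := hG 1%N; rewrite muln1.
  rewrite [(3 * _)%N]mulSn mulnDr addnC -expnS.
  by apply: rank_leD; [case: (hG (2 ^ i.+1)%N)|apply: rank_leN; case: (hG (2 ^ i)%N)].
have Da j : opb (D j) (a j).
  case: j => [|i] /=.
    have -> : G 1%N = T - (T - G 1%N) by rewrite opprB addrC subrK.
    apply: opb_le (opbB G0 (hG 1%N).2) _; have := ler_wpM2l C0 (qdec _ _ (leq0n 1)); lra.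
  have -> : G (2 ^ i.+1)%N - G (2 ^ i)%N = (T - G (2 ^ i)%N) - (T - G (2 ^ i.+1)%N).
    by rewrite opprB [RHS]addrC addrA subrK.
  apply: opb_le (opbB (hG _).2 (hG _).2) _.
  have : (2 ^ i <= 2 ^ i.+1)%N by rewrite leq_exp2l.
  move=> /qdec /(ler_wpM2l C0); lra.
have [f hf] : exists f : nat -> nat -> V, forall j, (forall i, nm (f j i) <= 1) /\
    forall x, D j x = \sum_(i < N j) ip (D j x) (f j i) *: f j i.
  by have /boolp.choice[f hf] := fun j => finite_rank_expansion (DN j); exists f.
have a0 j : 0 <= a j by case: j => [|i] /=; rewrite !mulr_ge0.
have Dsum J : \sum_(j < J.+1) D j = G (2 ^ J)%N.
  elim: J => [|J IHJ]; first by rewrite big_ord1 expn0.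
  by rewrite big_ord_recr IHJ /= addrC subrK.
have expT : nuclear_expansion T N (fun j i x => ip (D j x) (f j i)) f a (14 * Q * M%:R * C) 1.
  split => //.
  - by move=> j i c x y; rewrite bop_linear ipPl.
  - move=> j i x; apply: le_trans (Cauchy_Schwarz _ _) _.
    apply: le_trans (ler_wpM2l (nm_ge0 _) ((hf j).1 i)) _.
    by rewrite mulr1; case: (Da j).
  - by split=> // j; case: (hf j).
  (* The constant is [2] for the first block and [2 * 3 * 2] for the others. *)
  split=> [n|x d d0].
    have Q0 : 0 <= Q by have := hQ 0%N; rewrite big_ord0.
    have : \sum_(j < n.+1) (N j)%:R * a j <= 14 * Q * M%:R * C.
      rewrite big_ord_recl /=.
      have -> : \sum_(i < n) (M * (3 * 2 ^ i))%:R * (2 * C * q (2 ^ i)%N) =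
          6 * M%:R * C * \sum_(i < n) (2 ^ i)%:R * q (2 ^ i)%N.
        rewrite mulr_sumr; apply: eq_bigr => i _; rewrite !natrM; ring.
      have hd := dyadic_sum q0 qdec hQ n.
      have h0 : q 0%N <= Q by have := hQ 1%N; rewrite big_ord1.
      have MC : 0 <= M%:R * C by rewrite mulr_ge0.
      have := ler_wpM2l MC hd; have := ler_wpM2l MC h0.
      set X := \sum_(i < n) _; move: (q 0%N) (M%:R : R) => q' m; nra.
    by apply: le_trans; rewrite big_ord_recr /= lerDl mulr_ge0.
  have K0 : 0 < C * nm x + 1 by rewrite ltr_wpDl // mulr_ge0 // nm_ge0.
  have [L hL] := summable_tail q0 hQ (divr_gt0 d0 K0).
  exists L.+1; case=> // J; rewrite ltnS => LJ.
  rewrite (eq_bigr (fun j : 'I_J.+1 => D j x)) => [|j _]; last by rewrite -(hf j).2.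
  rewrite -bop_sumE Dsum -bop_subE; apply: le_lt_trans ((hG _).2.2 x) _.
  have := hL L.+1; rewrite big_nat1 ltr_pdivlMr //; apply: le_lt_trans.
  have qL : q (2 ^ J)%N <= q L by rewrite qdec // (leq_trans LJ) // ltnW // ltn_expl.
  have := ler_wpM2l (mulr_ge0 C0 (nm_ge0 x)) qL; have := q0 L; lra.
split; first by do 6!eexists; exact: expT.
have [z [hz zle]] := expansion_trace_lim expT.
by rewrite (traceE (expansion_is_trace expT hz)) -[leRHS]mulr1.
Qed.

(** ** Families of operators of uniformly bounded gauge *)

(** The weight [w] is the distance [|t - s|] or its square in the estimates of
    increments and of Taylor remainders. *)
Definition gauge_family (k : nat) (I : Type) (D : I -> Prop) (w : I -> R) (F : I -> bop V) :=
  exists M C, 0 <= C /\ forall i, D i -> gauge k M (C * w i) (F i).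

Section Families.
Context (I : Type) (D : I -> Prop).
Implicit Types (w : I -> R) (F : I -> bop V).

Lemma gauge_family_eq k w w' F F' : (forall i, D i -> w i = w' i) ->
  (forall i, D i -> F i = F' i) -> gauge_family k D w F -> gauge_family k D w' F'.
Proof.
move=> hw hF [M [C [C0 h]]]; exists M, C; split=> // i Di.
by rewrite -hw // -hF //; apply: h.
Qed.

Lemma gauge_familyD k w F F' : (forall i, D i -> 0 <= w i) ->
  gauge_family k D w F -> gauge_family k D w F' -> gauge_family k D w (fun i => F i + F' i).
Proof.
move=> w0 [M [C [C0 h]]] [N [C' [C'0 h']]]; exists (M + N)%N, (C + C').
by split=> [|i Di]; [exact: addr_ge0|rewrite mulrDl; apply: gaugeD; auto].
Qed.

Lemma gauge_familyM k l w w' F F' : gauge_family k D w F -> gauge_family l D w' F' ->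
  gauge_family (k + l) D (fun i => w i * w' i) (fun i => F i * F' i).
Proof.
move=> [M [C [C0 h]]] [N [C' [C'0 h']]]; exists (M + N)%N, (C * C').
by split=> [|i Di]; [exact: mulr_ge0|rewrite mulrACA; apply: gaugeM; auto].
Qed.

Lemma gauge_familyZ k w (u : I -> R[i]) F : gauge_family k D w F ->
  gauge_family k D (fun i => cm (u i) * w i) (fun i => u i *: F i).
Proof.
move=> [M [C [C0 h]]]; exists M, C; split=> // i Di.
by rewrite mulrCA; apply: gaugeZ; auto.
Qed.

End Families.

End Gauge.

Section Neumann.
Context {R : realType} {V : hilbert R}.

(** The Neumann series is summed on each vector, so that completeness of [V]
    suffices; injectivity and the bound follow from [|x| <= 2 |x + T x|]. *)
Lemma Neumann_inverse (T : bop V) : opb T 2^-1 ->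
  exists S, [/\ S * (1 + T) = 1, (1 + T) * S = 1 & opb S 2].
Proof.
move=> [_ T2].
have inj x : nm x <= 2 * nm ((1 + T) x).
  rewrite bop_addE bop_oneE.
  have {1}-> : x = (x + T x) - T x by rewrite addrK.
  have := nmB (x + T x) (T x); have := T2 x; have := nm_ge0 x.
  have {3}-> : x = (x + T x) - T x by rewrite addrK.
  set u := nm (x + T x - T x); lra.
have inj0 x y : (1 + T) x = (1 + T) y -> x = y.
  move=> h; apply/eqP; rewrite -subr_eq0; apply/eqP/nm_eq0/eqP.
  rewrite eq_le nm_ge0 andbT; apply: le_trans (inj _) _.
  by rewrite bopB h subrr nm0 mulr0.
have surj y : exists x, (1 + T) x = y.
  pose p n x := ((- T) ^+ n) x.
  have pS n x : p n.+1 x = - T (p n x) by rewrite /p exprS bop_mulE bop_oppE.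
  have p_le n : nm (p n y) <= 2^-1 ^+ n * nm y.
    elim: n => [|n IHn]; first by rewrite /p !expr0 mul1r bop_oneE.
    rewrite pS nmN; apply: le_trans (T2 _) _; rewrite exprS -mulrA ler_wpM2l //.
  pose s n := \sum_(k < n) p k y.
  have s1T n : (1 + T) (s n) = y - p n y.
    elim: n => [|n IHn]; first by rewrite /s big_ord0 bop_app0 /p expr0 bop_oneE subrr.
    have -> : s n.+1 = s n + p n y by rewrite /s big_ord_recr.
    by rewrite (bopD (1 + T)) IHn bop_addE bop_oneE pS opprK addrA subrK.
  have small d : 0 < d -> exists N, forall n, (N <= n)%N -> nm (p n y) < d.
    move=> d0; have y1 : 0 < nm y + 1 by rewrite ltr_wpDl ?nm_ge0.
    have /= cv : (fun n => (2^-1 : R) ^+ n) @ \oo --> (0 : R).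
      by apply: cvg_expr; rewrite ger0_norm; lra.
    have /cvgrPdist_lt /(_ _ (divr_gt0 d0 y1)) [N _ hN] := cv.
    exists N => n /hN /=; rewrite sub0r normrN ger0_norm ?exprn_ge0 // ltr_pdivlMr //.
    by apply: le_lt_trans; apply: le_trans (p_le n) _; rewrite ler_wpM2l ?exprn_ge0 // lerDl.
  have [x hx] : exists x, forall d, 0 < d -> exists N, forall n, (N <= n)%N -> nm (s n - x) < d.
    apply: nm_complete => d d0; have d4 : 0 < d / 4 by rewrite divr_gt0.
    have [N hN] := small _ d4; exists N => m n Nm Nn.
    apply: le_lt_trans (inj _) _; rewrite bopB !s1T.
    have -> : y - p m y - (y - p n y) = p n y - p m y by rewrite opprB addrC addrA subrK.
    have := nmB (p n y) (p m y); have := hN m Nm; have := hN n Nn; lra.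
  exists x; apply/eqP; rewrite -subr_eq0; apply/eqP/nm_eq0/eqP.
  rewrite eq_le nm_ge0 andbT; apply/ler_addgt0Pr => d d0; rewrite add0r.
  have d4 : 0 < d / 4 by rewrite divr_gt0.
  have [N hN] := small _ d4; have [M hM] := hx _ d4; set n := maxn N M.
  have h1 := hN n (leq_maxl _ _); have h2 := hM n (leq_maxr _ _).
  have -> : (1 + T) x - y = - (1 + T) (s n - x) - p n y.
    by rewrite (bopB (1 + T)) s1T !opprB addrA addrAC addrK.
  have hT : nm ((1 + T) (s n - x)) <= 2 * nm (s n - x).
    rewrite bop_addE bop_oneE; apply: le_trans (nmD _ _) _.
    have := T2 (s n - x); have := nm_ge0 (s n - x); lra.
  apply: le_trans (nmB _ _) _; rewrite nmN; lra.
have /boolp.choice[g hg] := surj.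
have glin : linear g.
  by move=> c x y; apply: inj0; rewrite bop_linear !hg.
have gb x : nm (g x) <= 2 * nm x by apply: le_trans (inj _) _; rewrite hg.
exists (Bop glin (ex_intro _ 2 gb)); split.
- by apply: bopP => x; apply: inj0; exact: hg.
- by apply: bopP => x; exact: hg.
- by split.
Qed.

End Neumann.

(** * Linear identities in noncommutative rings *)

(** Identities in a noncommutative ring hold, once expanded, as identities in its
    additive group. Those are decided by comparing the integer coefficients of
    the monomials, which are treated as atoms. *)
Inductive zterm := ZVar of nat | ZAdd of zterm & zterm | ZOpp of zterm | ZZero.

Section ZTerms.
Variable G : zmodType.
Implicit Types (env : seq G) (t u : zterm).

Fixpoint zeval env t : G := match t with
  | ZVar n => nth 0 env n
  | ZAdd t u => zeval env t + zeval env u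
  | ZOpp t => - zeval env t
  | ZZero => 0
  end.

Fixpoint zcoef t (n : nat) : int := match t with
  | ZVar m => if m == n then 1 else 0
  | ZAdd t u => zcoef t n + zcoef u n
  | ZOpp t => - zcoef t n
  | ZZero => 0
  end.

Fixpoint zbounded (m : nat) t := match t with
  | ZVar n => (n < m)%N
  | ZAdd t u => zbounded m t && zbounded m u
  | ZOpp t => zbounded m t
  | ZZero => true
  end.

Lemma zevalE env t : zbounded (size env) t ->
  zeval env t = \sum_(i < size env) env`_i *~ zcoef t i.
Proof.
elim: t => [n|t IHt u IHu|t IHt|] /=.
- move=> hn; rewrite (bigD1 (Ordinal hn)) //= eqxx big1 ?addr0 ?mulr1z // => i.
  by rewrite -val_eqE /= eq_sym => /negbTE ->; rewrite mulr0z.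
- move=> /andP[/IHt -> /IHu ->]; rewrite -big_split /=.
  by apply: eq_bigr => i _; rewrite mulrzDr.
- by move=> /IHt ->; rewrite -sumrN; apply: eq_bigr => i _; rewrite mulrNz.
- by move=> _; rewrite big1 // => i _; rewrite mulr0z.
Qed.

Lemma zterm_eq env n t u : size env = n ->
  zbounded n t && zbounded n u && all (fun i => zcoef t i == zcoef u i) (iota 0 n) ->
  zeval env t = zeval env u.
Proof.
move=> <- /andP[/andP[ht hu] /allP h]; rewrite !zevalE //.
apply: eq_bigr => i _; congr (_ *~ _); apply/eqP/h.
by rewrite mem_iota /= add0n.
Qed.

End ZTerms.

(* Scalings and products are compared operand by operand up to conversion,
   because their algebraic structures may differ syntactically. *)
Ltac zmod_find env x :=
  lazymatch env with
  | [::] => constr:(@None nat)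
  | x :: _ => constr:(Some 0%N)
  | ?y :: ?env' =>
    let next _ := lazymatch zmod_find env' x with
                  | Some ?n => constr:(Some (S n))
                  | None => constr:(@None nat)
                  end in
    lazymatch constr:((x, y)) with
    | (@GRing.scale _ _ ?a ?u, @GRing.scale _ _ ?b ?w) =>
      match goal with
      | _ => let _ := match goal with _ => unify a b; unify u w end in
             constr:(Some 0%N)
      | _ => next tt
      end
    | (@GRing.mul _ ?a ?u, @GRing.mul _ ?b ?w) =>
      match goal with
      | _ => let _ := match goal with _ => unify a b; unify u w end in
             constr:(Some 0%N)
      | _ => next tt
      end
    | _ => next tt
    end
  end.

Ltac zmod_atoms T env t :=
  lazymatch t with
  | (?a + ?b)%R => let env' := zmod_atoms T env a in zmod_atoms T env' b
  | (- ?a)%R => zmod_atoms T env a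
  | 0%R => env
  | _ => lazymatch zmod_find env t with
         | Some _ => env
         | None => constr:(@cons T t env)
         end
  end.

Ltac zmod_quote env t :=
  lazymatch t with
  | (?a + ?b)%R => let a' := zmod_quote env a in let b' := zmod_quote env b in
                   constr:(ZAdd a' b')
  | (- ?a)%R => let a' := zmod_quote env a in constr:(ZOpp a')
  | 0%R => constr:(ZZero)
  | _ => lazymatch zmod_find env t with Some ?n => constr:(ZVar n) end
  end.

Ltac zmod :=
  lazymatch goal with |- ?a = ?b :> ?T =>
    let env0 := constr:(@nil T) in
    let env1 := zmod_atoms T env0 a in
    let env := zmod_atoms T env1 b in
    let t := zmod_quote env a in
    let u := zmod_quote env b in
    refine (@zterm_eq _ env _ t u erefl _); vm_compute; reflexivity
  end.

Ltac ncring := rewrite ?(mulrDl, mulrDr, mulrN, mulNr, mulrA, mulr1, mul1r, mulr0, mul0r); zmod.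

(** * The homotopy formula in a ring with an involution *)

Section Homotopy.
Variables (B : pzRingType) (F e : B).
Hypothesis FF : F * F = 1.
Hypothesis Fe : F * e = - (e * F).
Implicit Types (x y z : B) (s t : seq B).

(** Locked, so that conversion does not unfold iterated commutators. *)
Definition dF := locked (fun x => F * x - x * F).
Definition even x := x * e = e * x.

Lemma dFE x : dF x = F * x - x * F. Proof. by rewrite /dF -lock. Qed.

Lemma dFD x y : dF (x + y) = dF x + dF y.
Proof. rewrite !dFE; ncring. Qed.

Lemma dFM x y : dF (x * y) = dF x * y + x * dF y.
Proof. rewrite !dFE; ncring. Qed.

Lemma F_dF x : F * dF x = - (dF x * F).
Proof. by rewrite dFE mulrBr mulrBl mulrA FF mul1r -(mulrA x) FF mulr1 mulrA opprB. Qed.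

Lemma e_dF x : even x -> e * dF x = - (dF x * e).
Proof.
move=> xe; rewrite dFE mulrBr mulrBl !mulrA -xe -(mulrA F) xe mulrA Fe -(mulrA x) Fe.
by rewrite -xe; ncring.
Qed.

Lemma eF_dF x : even x -> e * F * dF x = dF x * (e * F).
Proof. by move=> xe; rewrite -mulrA F_dF mulrN mulrA e_dF // mulNr opprK mulrA. Qed.

Lemma commutator_eF x : even x -> x * (e * F) - e * F * x = - (e * dF x).
Proof. by move=> xe; rewrite dFE mulrA xe; ncring. Qed.

Lemma evenM x y : even x -> even y -> even (x * y).
Proof. by move=> xe ye; rewrite /even -mulrA ye mulrA xe mulrA. Qed.

(** The signs, as elements of [B]; locked, so that they are single atoms. *)
Definition sg := locked (fun n : nat => (-1) ^+ n : B).

Lemma sgE n : sg n = (-1) ^+ n. Proof. by rewrite /sg -lock. Qed.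
Lemma sg0 : sg 0 = 1. Proof. by rewrite sgE. Qed.
Lemma sgS n : sg n.+1 = - sg n. Proof. by rewrite !sgE exprS mulN1r. Qed.

Definition dprod s : B := \prod_(x <- s) dF x.

Lemma dprod_nil : dprod [::] = 1. Proof. exact: big_nil. Qed.
Lemma dprod_cons x s : dprod (x :: s) = dF x * dprod s. Proof. exact: big_cons. Qed.
Lemma dprod_rcons s x : dprod (rcons s x) = dprod s * dF x.
Proof. by rewrite /dprod -cats1 big_cat big_seq1. Qed.

Lemma F_dprod s : F * dprod s = dprod s * F * sg (size s).
Proof.
elim: s => [|x s IHs]; first by rewrite dprod_nil sg0; ncring.
by rewrite dprod_cons mulrA F_dF mulNr -mulrA IHs /= sgS; ncring.
Qed.

(** The inner face maps of the Hochschild complex, on lists of arguments. *)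
Fixpoint face (i : nat) s : seq B := match i, s with
  | 0%N, x0 :: x1 :: s' => x0 * x1 :: s'
  | i'.+1, x0 :: s' => x0 :: face i' s'
  | _, _ => s
  end.

Lemma face_in (P : B -> Prop) i s : (forall x y, P x -> P y -> P (x * y)) ->
  {in s, forall x, P x} -> {in face i s, forall x, P x}.
Proof.
move=> PM; elim: i s => [|i IHi] [|x0 s] //= hs.
  case: s hs => [|x1 s] //= hs x; rewrite in_cons => /predU1P[->|xs].
    by apply: PM; apply: hs; rewrite !in_cons eqxx ?orbT.
  by apply: hs; rewrite !in_cons xs !orbT.
move=> x; rewrite in_cons => /predU1P[->|]; first by apply: hs; rewrite mem_head.
by apply: IHi => z zs; apply: hs; rewrite in_cons zs orbT.
Qed.

(** The induction step of the alternating sums over faces: all faces but the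
    first leave the first entry alone. *)
Lemma face_sum (f g : seq B -> B) (h : B -> B) (x0 x1 : B) s n :
  (forall t, f (x0 :: t) = h (g t)) -> {morph h : a b / a + b} -> h 0 = 0 ->
  (forall a (b : nat), h (a * sg b) = h a * sg b) ->
  \sum_(i < n.+1) f (face i (x0 :: x1 :: s)) * sg i =
  f (x0 * x1 :: s) - h (\sum_(i < n) g (face i (x1 :: s)) * sg i).
Proof.
move=> fE hD h0 hs; rewrite big_ord_recl /= sg0 mulr1; congr (_ + _).
rewrite (big_morph h hD h0) -sumrN; apply: eq_bigr => i _.
by rewrite /bump /= add1n add0n fE hs sgS; ncring.
Qed.

(** By the Leibniz rule [d (x y) = dx y + x dy] each face is the sum of two terms,
    and consecutive faces share one of them. *)
Lemma dprod_faces x0 t z :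
  \sum_(i < (size t).+1) dprod (face i (x0 :: rcons t z)) * sg i =
  x0 * dprod (rcons t z) + dprod (x0 :: t) * z * sg (size t).
Proof.
elim: t x0 => [|x1 t IHt] x0.
  by rewrite big_ord1 /= !dprod_cons dprod_nil dFM sg0; ncring.
rewrite [rcons _ _]/= (@face_sum dprod dprod ( *%R (dF x0))).
- by rewrite IHt !dprod_cons dFM /= sgS; ncring.
- by move=> s; rewrite dprod_cons.
- by move=> a b; rewrite mulrDr.
- by rewrite mulr0.
- by move=> a b; rewrite mulrA.
Qed.

Section Insertion.
Variable y : B.

(** The alternating sum over the positions at which [dF y] can be inserted in
    [dprod s]. *)
Fixpoint insertions s : B := match s with
  | [::] => dF y
  | x :: s' => dF y * dprod s - dF x * insertions s'
  end.

Lemma F_insertions s : F * insertions s = insertions s * F * sg (size s).+1.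
Proof.
elim: s => [|x s IHs] /=; first by rewrite F_dF sgS sg0; ncring.
rewrite mulrBr !mulrA !F_dF !mulNr -(mulrA (dF y)) -(mulrA (dF x)) IHs F_dprod /= !sgS; ncring.
Qed.

Lemma insertions_rcons s x : insertions (rcons s x) =
  insertions s * dF x + dprod (rcons s x) * dF y * sg (size s).+1.
Proof.
elim: s => [|x0 s IHs] /=; first by rewrite !dprod_cons dprod_nil sgS sg0; ncring.
by rewrite IHs !dprod_cons dprod_rcons !sgS; ncring.
Qed.

(** The sum over the positions of [s] of [dprod s] with [dF x] replaced by the
    commutator of [x] with [dF y]. *)
Fixpoint commutators s : B := match s with
  | [::] => 0
  | x :: s' => (x * dF y - dF y * x) * dprod s' + dF x * commutators s'
  end.

(** As for [dprod_faces], except that the terms of two consecutive faces with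
    the inserted factor between them differ by a commutator. *)
Lemma insertions_faces x0 t z :
  \sum_(i < (size t).+1) insertions (face i (x0 :: rcons t z)) * sg i =
  x0 * insertions (rcons t z) + insertions (x0 :: t) * z * sg (size t)
  - commutators (x0 :: rcons t z).
Proof.
elim: t x0 => [|x1 t IHt] x0.
  by rewrite big_ord1 /= !dprod_cons dprod_nil dFM sg0; ncring.
have -> : \sum_(i < (size (x1 :: t)).+1)
    insertions (face i (x0 :: rcons (x1 :: t) z)) * sg i =
  insertions (x0 * x1 :: rcons t z)
  - dF y * dF x0 * (\sum_(i < (size t).+1) dprod (face i (x1 :: rcons t z)) * sg i)
  + dF x0 * (\sum_(i < (size t).+1) insertions (face i (x1 :: rcons t z)) * sg i).
  rewrite big_ord_recl sg0 mulr1 -[RHS]addrA; apply: (f_equal2 +%R) => //.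
  rewrite !mulr_sumr -sumrN -big_split; apply: eq_bigr => i _ /=.
  by rewrite /bump /= add1n add0n dprod_cons sgS; ncring.
rewrite dprod_faces IHt /= !dprod_cons dFM sgS; ncring.
Qed.

(** The derivative of [dprod s] when each entry [x] moves by its commutator
    with [y]. *)
Fixpoint dprod_inner s : B := match s with
  | [::] => 0
  | x :: s' => dF (x * y - y * x) * dprod s' + dF x * dprod_inner s'
  end.

Lemma dprod_innerE s : dprod_inner s = dprod s * y - y * dprod s + commutators s.
Proof.
elim: s => [|x s IHs] /=; first by rewrite dprod_nil; ncring.
have -> : dF (x * y - y * x) = dF x * y - y * dF x + (x * dF y - dF y * x).
  by rewrite !dFE; ncring.
by rewrite IHs dprod_cons; ncring.
Qed.

End Insertion.

Section TraceIdentities.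
(** An abstract filtration [decay], with a trace which is linear and cyclic from
    degree [p] on. *)
Variables (C : numFieldType) (p : nat) (decay : nat -> B -> Prop) (tr : B -> C).
Hypothesis decay_any : forall x, decay 0 x.
Hypothesis decayD : forall k x y, decay k x -> decay k y -> decay k (x + y).
Hypothesis decayN : forall k x, decay k x -> decay k (- x).
Hypothesis decayM : forall k l x y, decay k x -> decay l y -> decay (k + l) (x * y).
Hypothesis decayW : forall k l x, (l <= k)%N -> decay k x -> decay l x.
Hypothesis trD : forall x y, decay p x -> decay p y -> tr (x + y) = tr x + tr y.
Hypothesis trC : forall x y, decay p x -> tr (x * y) = tr (y * x).

Lemma decayMl k x y : decay k x -> decay k (x * y).
Proof. by move=> hx; rewrite -[k]addn0; apply: decayM. Qed.

Lemma decayMr k x y : decay k y -> decay k (x * y).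
Proof. by move=> hy; rewrite -[k]add0n; apply: decayM. Qed.

Lemma decayB k x y : decay k x -> decay k y -> decay k (x - y).
Proof. by move=> hx hy; apply: decayD => //; apply: decayN. Qed.

Hypothesis decay_0 : forall k, decay k 0.

Local Ltac by_decay := first [ assumption | solve [apply: decayN; by_decay]
  | solve [apply: decayD; by_decay] | solve [apply: decayMl; by_decay]
  | solve [apply: decayMr; by_decay] ].

Lemma trN x : decay p x -> tr (- x) = - tr x.
Proof.
move=> hx; have t0 : tr 0 = 0.
  by apply: (addIr (tr 0)); rewrite -trD ?addr0 ?add0r //; exact: decay_0.
by apply/eqP; rewrite -addr_eq0 -trD ?addNr ?t0 //; apply: decayN.
Qed.

Lemma trB x y : decay p x -> decay p y -> tr (x - y) = tr x - tr y.
Proof. by move=> hx hy; rewrite trD ?trN //; apply: decayN. Qed.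

Lemma tr_sg x n : decay p x -> tr (x * sg n) = (-1) ^+ n * tr x.
Proof.
move=> hx; elim: n => [|n IHn]; first by rewrite sg0 mulr1 expr0 mul1r.
by rewrite sgS mulrN trN ?IHn ?exprS ?mulN1r ?mulNr //; apply: decayMl.
Qed.

Lemma tr_sum (I : finType) (f : I -> B) : (forall i, decay p (f i)) ->
  decay p (\sum_i f i) /\ tr (\sum_i f i) = \sum_i tr (f i).
Proof.
move=> hf; apply: (big_rec2 (fun u v => decay p u /\ tr u = v)) => [|i v u _ [hu <-]].
  by split=> //; rewrite -(subrr 0) trB ?subrr.
by split; [apply: decayD|rewrite trD].
Qed.

(** Conjugation by [F] preserves the trace and changes the sign of [e * x]. *)
Lemma tr_e_vanish x : decay p x -> F * x = x * F -> tr (e * x) = 0.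
Proof.
move=> hx xF; have hex : decay p (e * x) by exact: decayMr.
have : tr (e * x) = - tr (e * x).
  rewrite -trN // -{1}(mulr1 (e * x)) -FF mulrA trC; last exact: decayMl.
  by rewrite !mulrA Fe !mulNr -(mulrA e F) xF -!mulrA FF mulr1.
move/eqP; rewrite -addr_eq0 -mulr2n mulrn_eq0 /= => /eqP //.
Qed.

(** For [z = x * dF y .. dF y'] with evenly many factors, [supertrace (dF z)] is
    the graded trace of [z], up to a factor. *)
Definition supertrace x := tr (e * F * x).

Lemma supertraceD x y : decay p x -> decay p y -> supertrace (x + y) = supertrace x + supertrace y.
Proof. by move=> hx hy; rewrite /supertrace mulrDr trD //; apply: decayMr. Qed.

Lemma supertraceB x y : decay p x -> decay p y -> supertrace (x - y) = supertrace x - supertrace y.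
Proof. by move=> hx hy; rewrite /supertrace mulrBr trB //; apply: decayMr. Qed.

Lemma supertrace_alternating_sum n (f : 'I_n -> B) : (forall i, decay p (f i)) ->
  \sum_(i < n) (-1) ^+ i * supertrace (f i) = supertrace (\sum_(i < n) f i * sg i).
Proof.
move=> hf; rewrite /supertrace mulr_sumr (tr_sum _).2; last by move=> i; apply/decayMr/decayMl.
by apply: eq_bigr => i _; rewrite mulrA tr_sg //; apply: decayMr.
Qed.

(** A commutator with [F] commutes with [e * F], so it can be moved around the
    trace freely. *)
Lemma supertrace_cyclic x z : even x -> decay p z -> supertrace (dF x * z) = supertrace (z * dF x).
Proof.
move=> xe hz; rewrite /supertrace mulrA eF_dF // -(mulrA (dF x)) -trC; first by rewrite mulrA.
exact: decayMr.
Qed.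

Lemma supertrace_cyclic_sub x z : even x -> decay p z -> supertrace (z * dF x - dF x * z) = 0.
Proof.
by move=> xe hz; rewrite supertraceB ?(supertrace_cyclic xe) ?subrr //; [apply: decayMl|apply: decayMr].
Qed.

(** A general even operator moves around the trace up to a term which vanishes
    on products of an odd number of commutators. *)
Lemma supertrace_commutator x z : even x -> decay p z -> F * z = - (z * F) ->
  supertrace (x * z) = supertrace (z * x).
Proof.
move=> xe hz zF; have hQz : decay p (e * F * z) by exact: decayMr.
have -> : supertrace (z * x) = tr (x * (e * F) * z) by rewrite /supertrace mulrA trC // mulrA.
have -> : x * (e * F) = e * F * x - e * dF x by rewrite -commutator_eF // addrC subrK.
have -> : (e * F * x - e * dF x) * z = e * F * (x * z) - e * (dF x * z) by ncring.
rewrite trB; first last.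
- by do ?[exact: hz | apply: decayMr].
- by do ?[exact: hz | apply: decayMr].
rewrite (tr_e_vanish (x := dF x * z)) ?subr0 //; first exact: decayMr.
by rewrite mulrA F_dF mulNr -!mulrA zF mulrN opprK.
Qed.

Definition regular x := even x /\ decay 1 (dF x).

Lemma regularM x y : regular x -> regular y -> regular (x * y).
Proof.
move=> [xe xJ] [ye yJ]; split; first exact: evenM.
by rewrite dFM; apply: decayD; [apply: decayMl|apply: decayMr].
Qed.


Lemma dprod_decay s : {in s, forall x, regular x} -> decay (size s) (dprod s).
Proof.
elim: s => [_|x s IHs hs]; first exact: decay_any.
rewrite dprod_cons -[size _]add1n; apply: decayM; first by case: (hs x (mem_head x s)).
by apply: IHs => z zs; apply: hs; rewrite in_cons zs orbT.
Qed.

Lemma insertions_decay y s : {in s, forall x, regular x} -> decay (size s) (insertions y s).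
Proof.
elim: s => [_|x s IHs hs]; first exact: decay_any.
have Js : {in s, forall z, regular z} by move=> z zs; apply: hs; rewrite in_cons zs orbT.
apply: decayB; first by apply: decayMr; apply: dprod_decay.
by rewrite -[size _]add1n; apply: decayM; [case: (hs x (mem_head x s))|exact: IHs].
Qed.

Lemma commutators_decay y s : {in s, forall x, regular x} -> decay (size s).-1 (commutators y s).
Proof.
elim: s => [_|x s IHs hs]; first exact: decay_any.
have Js : {in s, forall z, regular z} by move=> z zs; apply: hs; rewrite in_cons zs orbT.
have [_ xJ] := hs x (mem_head x s).
apply: decayD; first by apply: decayMr; apply: dprod_decay.
case: s IHs {hs} Js => [|z s] IHs Js; first exact: decay_any.
by rewrite -[(size _).-1]add1n; apply: decayM => //; apply: IHs.
Qed.

Lemma face_regular i s : {in s, forall x, regular x} -> {in face i s, forall x, regular x}.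
Proof. by apply: face_in => x y; exact: regularM. Qed.

Lemma size_face i s : (i < (size s).-1)%N -> size (face i s) = (size s).-1.
Proof. by elim: i s => [|i IHi] [|x0 [|x1 s]] //= h; rewrite IHi. Qed.

Lemma even_sg n : ~~ odd n -> sg n = 1.
Proof. by move=> h; rewrite sgE -signr_odd (negbTE h). Qed.

Lemma face_decay i x0 t z : (i < (size t).+1)%N -> {in x0 :: rcons t z, forall x, regular x} ->
  decay (size t).+1 (dprod (face i (x0 :: rcons t z))).
Proof.
move=> it hJ; rewrite -[X in decay X](_ : size (face i (x0 :: rcons t z)) = (size t).+1).
  by apply: dprod_decay; apply: face_regular.
by rewrite size_face /= size_rcons.
Qed.

Lemma face_insertions_decay y i x0 t z : (i < (size t).+1)%N ->
  {in x0 :: rcons t z, forall x, regular x} ->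
  decay (size t).+1 (insertions y (face i (x0 :: rcons t z))).
Proof.
move=> it hJ; rewrite -[X in decay X](_ : size (face i (x0 :: rcons t z)) = (size t).+1).
  by apply: insertions_decay; apply: face_regular.
by rewrite size_face /= size_rcons.
Qed.

(** The faces telescope to two commutators, each of which has zero supertrace. *)
Lemma supertrace_dprod_cocycle x0 t z : (p <= size t)%N -> ~~ odd (size t) ->
  {in x0 :: rcons t z, forall x, regular x} ->
  \sum_(i < (size t).+1) (-1) ^+ i * supertrace (dprod (face i (x0 :: rcons t z)))
  - supertrace (dprod (z * x0 :: t)) = 0.
Proof.
move=> pt ot hJ.
have [x0e _] : regular x0 by apply: hJ; rewrite mem_head.
have [ze _] : regular z by apply: hJ; rewrite in_cons mem_rcons mem_head orbT.
have Jt : {in t, forall x, regular x}.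
  by move=> x xt; apply: hJ; rewrite in_cons mem_rcons in_cons xt !orbT.
have Dt : decay p (dprod t) by apply: decayW pt _; apply: dprod_decay.
have FDt : F * dprod t = dprod t * F by rewrite F_dprod even_sg // mulr1.
rewrite supertrace_alternating_sum => [|i]; last by apply: decayW (face_decay _ _) => //; exact: leqW.
rewrite dprod_faces even_sg // !dprod_cons dprod_rcons dFM mulr1 mulrDl.
have c1 : decay p (x0 * dprod t) by exact: decayMr.
have c2 : decay p (dF x0 * dprod t) by exact: decayMr.
rewrite !supertraceD -?mulrA; do ?[exact: Dt | exact: decayMl | apply: decayMr].
have -> : supertrace (dF z * (x0 * dprod t)) = supertrace (x0 * (dprod t * dF z)) by rewrite supertrace_cyclic // mulrA.
have -> : supertrace (z * (dF x0 * dprod t)) = supertrace (dF x0 * (dprod t * z)).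
  by rewrite supertrace_commutator ?mulrA // F_dF mulNr -!mulrA FDt.
by rewrite subrr.
Qed.

(** Up to commutators of zero supertrace, the faces of the insertions leave
    [commutators], which is the derivative along [y] by [dprod_innerE]. Inserting
    [dF y] in the first or in the last position has the same supertrace, so only
    one of them is kept. *)
Lemma supertrace_insertions_coboundary y x0 t z : even y -> (p <= size t)%N -> odd (size t) ->
  {in x0 :: rcons t z, forall x, regular x} ->
  let sigma s := supertrace (insertions y s) - supertrace (dF y * dprod s) in
  \sum_(i < (size t).+1) (-1) ^+ i * sigma (face i (x0 :: rcons t z))
  + sigma (z * x0 :: t) = - supertrace (dprod_inner y (x0 :: rcons t z)).
Proof.
move=> ye pt ot hJ sigma.
have [x0e _] : regular x0 by apply: hJ; rewrite mem_head.
have [ze zJ] : regular z by apply: hJ; rewrite in_cons mem_rcons mem_head orbT.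
have Jt : {in t, forall x, regular x}.
  by move=> x xt; apply: hJ; rewrite in_cons mem_rcons in_cons xt !orbT.
have Dt : decay p (dprod t) by apply: decayW pt _; apply: dprod_decay.
have It : decay p (insertions y t) by apply: decayW pt _; apply: insertions_decay.
have sgt : sg (size t) = - 1 by rewrite sgE -signr_odd ot expr1.
have FIt : F * insertions y t = insertions y t * F.
  by rewrite F_insertions sgS sgt opprK mulr1.
have FDt : F * dprod t = - (dprod t * F) by rewrite F_dprod sgt mulrN1.
have cM : decay p (commutators y (x0 :: rcons t z)).
  by apply: decayW (commutators_decay _ hJ); rewrite /= size_rcons leqW.
have cW : decay p (insertions y (rcons t z)).
  by rewrite insertions_rcons dprod_rcons; apply: decayD; do 2?apply: decayMl => //; exact: decayMl.
have -> : \sum_(i < (size t).+1) (-1) ^+ i * sigma (face i (x0 :: rcons t z)) =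
    supertrace (\sum_(i < (size t).+1) insertions y (face i (x0 :: rcons t z)) * sg i) -
    supertrace (dF y * \sum_(i < (size t).+1) dprod (face i (x0 :: rcons t z)) * sg i).
  rewrite mulr_sumr.
  under [X in _ = _ - supertrace X]eq_bigr do rewrite mulrA.
  rewrite -!supertrace_alternating_sum => [|i|i].
  - by rewrite -sumrB; apply: eq_bigr => i _; rewrite -mulrBr.
  - by apply: decayMr; apply: decayW (face_decay _ _) => //; exact: leqW.
  - by apply: decayW (face_insertions_decay _ _ _) => //; exact: leqW.
rewrite insertions_faces dprod_faces sgt !mulrN1 /sigma dprod_innerE.
set M := commutators y _ in cM *.
have cD : decay p (dprod (x0 :: rcons t z)) by rewrite dprod_cons dprod_rcons; by_decay.
have sT1 : supertrace (dprod (x0 :: rcons t z) * y - y * dprod (x0 :: rcons t z)) = 0.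
  rewrite supertraceB; [|by_decay..].
  rewrite (supertrace_commutator ye) ?subrr //.
  by rewrite F_dprod /= size_rcons !sgS sgt opprK mulrN1.
rewrite [supertrace (_ + M)]supertraceD ?sT1 ?add0r //; last by by_decay.
have c_ins : decay p (insertions y (x0 :: t)) by rewrite /= dprod_cons; by_decay.
have c_zx : decay p (dprod (z * x0 :: t)) by rewrite dprod_cons; by_decay.
have c_Dr : decay p (dprod (rcons t z)) by rewrite dprod_rcons; by_decay.
have c_D0 : decay p (dprod (x0 :: t)) by rewrite dprod_cons; by_decay.
rewrite -supertraceB; [|by_decay..].
rewrite -supertraceB; [|by_decay..].
rewrite -supertraceD; [|by_decay..].
rewrite !insertions_rcons /= !dprod_cons !dprod_rcons sgS sgt opprK mulr1 dFM.
pose W := insertions y t; rewrite -/W in It FIt *.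
pose D := dprod t; rewrite -/D in Dt *.
have cxW : decay p (x0 * W) by by_decay.
have cxD : decay p (x0 * D * dF z) by by_decay.
have z1 := supertrace_cyclic_sub ze cxW.
have z2 := supertrace_cyclic_sub ye cxD.
have z3 : supertrace (dF x0 * W * z - z * (dF x0 * W)) = 0.
  rewrite supertraceB; [|by_decay..].
  rewrite (supertrace_commutator ze) ?subrr //; first by by_decay.
  by rewrite mulrA F_dF mulNr -!mulrA FIt.
set X := (X in supertrace X = _).
have -> : X = (x0 * W * dF z - dF z * (x0 * W)) +
    (x0 * D * dF z * dF y - dF y * (x0 * D * dF z)) +
    (dF x0 * W * z - z * (dF x0 * W)) - M by rewrite /X; ncring.
rewrite supertraceB; [|by_decay..].
rewrite supertraceD; [|by_decay..].
rewrite supertraceD; [|by_decay..].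
by rewrite z1 z2 z3 !addr0 sub0r.
Qed.

End TraceIdentities.
End Homotopy.

(** * Differentiable families of operators *)

Section Calculus.
Context {R : realType} {V : hilbert R} (r : nat -> R).
Hypothesis r_ge0 : forall n, 0 <= r n.
Hypothesis r_dec : forall m n, (m <= n)%N -> r n <= r m.
Implicit Types (S T : bop V) (s t : R) (f g : R -> bop V) (k l : nat).

(** The filtration by the decay of the approximation numbers. *)
Definition decay k T := exists M C, gauge r k M C T.

Lemma gauge_lower k l M C T : (l <= k)%N -> gauge r k M C T ->
  gauge r l M (C * r 0%N ^+ (k - l)) T.
Proof.
move=> lk [C0 h]; split; first by rewrite mulr_ge0 ?exprn_ge0.
move=> n; have [G [rG bG]] := h n; exists G; split=> //.
apply: opb_le bG _; rewrite -mulrA ler_wpM2l // -{1}(subnK lk) exprD.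
by rewrite ler_wpM2r ?exprn_ge0 // lerXn2r ?nnegrE // r_dec.
Qed.

Lemma decay_any T : decay 0 T.
Proof. by have [C hC] := opb_exists T; exists 0%N, C; apply: gauge_opb. Qed.

Lemma decay_0 k : decay k 0.
Proof. by exists 0%N, 0; apply: gauge0. Qed.

Lemma decayD k S T : decay k S -> decay k T -> decay k (S + T).
Proof. by move=> [M [C hS]] [N [D hT]]; exists (M + N)%N, (C + D); apply: gaugeD. Qed.

Lemma decayM k l S T : decay k S -> decay l T -> decay (k + l) (S * T).
Proof. by move=> [M [C hS]] [N [D hT]]; exists (M + N)%N, (C * D); apply: gaugeM. Qed.

Lemma decayZ k a T : decay k T -> decay k (a *: T).
Proof. by move=> [M [C hT]]; exists M, (cm a * C); apply: gaugeZ. Qed.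

Lemma decayN k T : decay k T -> decay k (- T).
Proof. by move=> hT; rewrite -scaleN1r; apply: decayZ. Qed.

Lemma decayW k l T : (l <= k)%N -> decay k T -> decay l T.
Proof. by move=> lk [M [C hT]]; exists M; eexists; apply: gauge_lower hT. Qed.

Section TraceClass.
Variables (p : nat) (Q : R).
Hypothesis rQ : forall n, \sum_(i < n) r i ^+ p <= Q.

Lemma decay_nuclear T : decay p T -> nuclear T.
Proof. by move=> [M [C hT]]; case: (gauge_nuclear r_ge0 r_dec rQ hT). Qed.

Lemma decay_traceD S T : decay p S -> decay p T -> trace (S + T) = trace S + trace T.
Proof. by move=> hS hT; apply: traceableD; apply/nuclear_traceable/decay_nuclear. Qed.

Lemma decay_traceZ a T : decay p T -> trace (a *: T) = a * trace T.
Proof. by move=> hT; apply/traceableZ/nuclear_traceable/decay_nuclear. Qed.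

Lemma decay_traceC S T : decay p S -> trace (S * T) = trace (T * S).
Proof. by move=> hS; apply/nuclear_traceC/decay_nuclear. Qed.

(** The trace bound of [gauge_nuclear] is uniform over a family. *)
Lemma family_trace_le k I (D : I -> Prop) (w : I -> R) (F : I -> bop V) : (p <= k)%N ->
  (forall i, D i -> 0 <= w i) -> gauge_family r k D w F ->
  exists K, 0 <= K /\ forall i, D i -> decay p (F i) /\ cm (trace (F i)) <= K * w i.
Proof.
move=> pk w0 [M [C [C0 h]]]; exists (14 * Q * M%:R * (C * r 0%N ^+ (k - p))).
have Q0 : 0 <= Q by have := rQ 0; rewrite big_ord0.
split=> [|i Di]; first by rewrite !mulr_ge0 ?exprn_ge0.
have hF := gauge_lower pk (h i Di); split; first by exists M; eexists; exact: hF.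
have [_] := gauge_nuclear r_ge0 r_dec rQ hF.
by rewrite -!mulrA (mulrC (w i)) !mulrA.
Qed.

End TraceClass.

Definition unit_itv s := 0 <= s <= 1.
Definition unit_itv2 (st : R * R) := unit_itv st.1 /\ unit_itv st.2.

Definition lip k f := gauge_family r k unit_itv (fun=> 1) f /\
  gauge_family r k unit_itv2 (fun st => `|st.2 - st.1|) (fun st => f st.2 - f st.1).

(** Families with a Lipschitz derivative; the first-order Taylor remainder is
    quadratic in the gauge, so no limit has to be taken in the class itself. *)
Definition diff k f g := [/\ lip k f, lip k g &
  gauge_family r k unit_itv2 (fun st => (st.2 - st.1) ^+ 2)
    (fun st => f st.2 - f st.1 - (st.2 - st.1)%:C *: g st.1)].

Lemma family_reindex k I J (D : I -> Prop) (E : J -> Prop) (h : J -> I) w F :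
  (forall j, E j -> D (h j)) -> gauge_family r k D w F ->
  gauge_family r k E (w \o h) (F \o h : J -> bop V).
Proof. by move=> hE [M [C [C0 hF]]]; exists M, C; split=> // j /hE; exact: hF. Qed.

Lemma family_const k I (D : I -> Prop) T : decay k T ->
  gauge_family r k D (fun=> 1) (fun=> T).
Proof. by move=> [M [C hT]]; exists M, C; split=> [|i _]; [case: hT|rewrite mulr1]. Qed.

Lemma family0 k I (D : I -> Prop) (w : I -> R) : (forall i, D i -> 0 <= w i) ->
  gauge_family r k D w (fun=> 0 : bop V).
Proof.
move=> w0; exists 0%N, 0; split=> // i Di; rewrite mul0r; exact: gauge0.
Qed.

Lemma itv2_1 (st : R * R) : unit_itv2 st -> unit_itv st.1. Proof. by case. Qed.
Lemma itv2_2 (st : R * R) : unit_itv2 st -> unit_itv st.2. Proof. by case. Qed.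

Lemma lip_const k T : decay k T -> lip k (fun=> T).
Proof.
move=> hT; split; first exact: family_const.
by apply: (gauge_family_eq (w := fun st => `|st.2 - st.1|) (F := fun=> 0)) => //;
  [move=> i _; rewrite subrr|exact: family0].
Qed.

Lemma lipD k f g : lip k f -> lip k g -> lip k (fun s => f s + g s).
Proof.
move=> [hf hf2] [hg hg2]; split; first by apply: gauge_familyD.
apply: (gauge_family_eq (w := fun st => `|st.2 - st.1|)
  (F := fun st => (f st.2 - f st.1) + (g st.2 - g st.1))) => //.
  by move=> i _; rewrite opprD addrACA.
by apply: gauge_familyD.
Qed.

Lemma lipM k l f g : lip k f -> lip l g -> lip (k + l) (fun s => f s * g s).
Proof.
move=> [hf hf2] [hg hg2]; split.
  by apply: gauge_family_eq (gauge_familyM hf hg) => // i _; exact: mulr1.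
apply: (gauge_family_eq (w := fun st => `|st.2 - st.1|)
  (F := fun st => (f st.2 - f st.1) * g st.2 + f st.1 * (g st.2 - g st.1))) => //.
  by move=> i _; rewrite mulrBl mulrBr addrA subrK.
have g2 := family_reindex (h := snd) itv2_2 hg.
have f1 := family_reindex (h := fst) itv2_1 hf.
apply: gauge_familyD => //.
  apply: gauge_family_eq (gauge_familyM hf2 g2) => // i _ /=; exact: mulr1.
apply: gauge_family_eq (gauge_familyM f1 hg2) => // i _ /=; exact: mul1r.
Qed.

Lemma lip_eq k f g : (forall s, unit_itv s -> f s = g s) -> lip k f -> lip k g.
Proof.
move=> fg [h1 h2]; split; first exact: gauge_family_eq h1.
by apply: gauge_family_eq h2 => // st [h h']; rewrite !fg.
Qed.

Lemma lip_id : lip 0 (fun s => s%:C *: (1 : bop V)).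
Proof.
have h1 : decay 0 1 by exact: decay_any.
split.
  have [M [C hC]] := h1; exists M, C; split=> [|s /andP[s0 s1]]; first by case: hC.
  apply: gaugeW (gaugeZ s%:C hC) _ _ => //; rewrite cm_real ger0_norm // mulrC.
  by case: hC => C0 _; rewrite ler_wpM2l.
apply: (gauge_family_eq (w := fun st : R * R => cm (st.2 - st.1)%:C * 1)
  (F := fun st => (st.2 - st.1)%:C *: (1 : bop V))).
- by move=> i _; rewrite cm_real mulr1.
- by move=> i _; rewrite rcB scalerBl.
- by apply: gauge_familyZ; apply: family_const.
Qed.

Lemma diff_const k T : decay k T -> diff k (fun=> T) (fun=> 0).
Proof.
move=> hT; split; [exact: lip_const|by apply/lip_const/decay_0|].
apply: (gauge_family_eq (w := fun st => (st.2 - st.1) ^+ 2) (F := fun=> 0)) => //.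
  by move=> i _; rewrite subrr scaler0 subr0.
by apply: family0 => i _; rewrite sqr_ge0.
Qed.

Lemma diffD k f f' g g' : diff k f f' -> diff k g g' ->
  diff k (fun s => f s + g s) (fun s => f' s + g' s).
Proof.
move=> [lf lf' df] [lg lg' dg]; split; [exact: lipD|exact: lipD|].
apply: (gauge_family_eq (w := fun st => (st.2 - st.1) ^+ 2)
  (F := fun st => (f st.2 - f st.1 - (st.2 - st.1)%:C *: f' st.1) +
                  (g st.2 - g st.1 - (st.2 - st.1)%:C *: g' st.1))) => //.
  move=> [s t] _ /=; rewrite scalerDr; zmod.
by apply: gauge_familyD => // i _; rewrite sqr_ge0.
Qed.

Lemma diffM k l f f' g g' : diff k f f' -> diff l g g' ->
  diff (k + l) (fun s => f s * g s) (fun s => f' s * g s + f s * g' s).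
Proof.
move=> [lf lf' df] [lg lg' dg]; split; [exact: lipM|by apply: lipD; apply: lipM|].
pose h (st : R * R) := st.2 - st.1.
apply: (gauge_family_eq (w := fun st => h st ^+ 2)
  (F := fun st => (f st.2 - f st.1 - (h st)%:C *: f' st.1) * g st.2 +
     ((h st)%:C *: (f' st.1 * (g st.2 - g st.1)) +
     f st.1 * (g st.2 - g st.1 - (h st)%:C *: g' st.1)))) => //.
  move=> [s t] _; rewrite /h /=; move: (t - s) => c; rewrite scalerDr !mulrBr !mulrBl scalerBr.
  rewrite -!bop_scalerAl -!bop_scalerAr; zmod.
have g2 := family_reindex (h := snd) itv2_2 lg.1.
have f1 := family_reindex (h := fst) itv2_1 lf.1.
have f'1 := family_reindex (h := fst) itv2_1 lf'.1.
have h0 i : unit_itv2 i -> 0 <= h i ^+ 2 by rewrite sqr_ge0.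
apply: gauge_familyD => //.
  by apply: gauge_family_eq (gauge_familyM df g2) => // i _ /=; exact: mulr1.
apply: gauge_familyD => //.
  apply: gauge_family_eq (gauge_familyZ (fun i => (h i)%:C) (gauge_familyM f'1 lg.2)) => // i _ /=.
  by rewrite mul1r cm_real -expr2 real_normK ?num_real.
by apply: gauge_family_eq (gauge_familyM f1 dg) => // i _ /=; exact: mul1r.
Qed.

Lemma diff_eq k f f' g g' : (forall s, unit_itv s -> f s = g s) ->
  (forall s, unit_itv s -> f' s = g' s) -> diff k f f' -> diff k g g'.
Proof.
move=> fg fg' [h1 h2 h3]; split; [exact: lip_eq h1|exact: lip_eq h2|].
by apply: gauge_family_eq h3 => // st [h h']; rewrite !fg // fg'.
Qed.

Lemma diff_id : diff 0 (fun s => s%:C *: (1 : bop V)) (fun=> 1).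
Proof.
split; [exact: lip_id|by apply/lip_const/decay_any|].
apply: (gauge_family_eq (w := fun st => (st.2 - st.1) ^+ 2) (F := fun=> 0)) => //.
  by move=> i _; rewrite rcB scalerBl subrr.
by apply: family0 => i _; rewrite sqr_ge0.
Qed.

Section Inverse.
Variables (v : bop V) (w : R -> bop V).
Hypothesis wl : forall s, unit_itv s -> w s * (1 + s%:C *: v) = 1.
Hypothesis wr : forall s, unit_itv s -> (1 + s%:C *: v) * w s = 1.
Hypothesis w2 : forall s, unit_itv s -> opb (w s) 2.

Lemma inverse_sub s t : unit_itv s -> unit_itv t ->
  w t - w s = (s - t)%:C *: (w t * v * w s).
Proof.
move=> hs ht; have -> : w t - w s = w t * ((1 + s%:C *: v) - (1 + t%:C *: v)) * w s.
  by rewrite mulrBr wl // mulrBl mul1r -mulrA wr // mulr1.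
have -> : 1 + s%:C *: v - (1 + t%:C *: v) = (s - t)%:C *: v.
  by rewrite rcB scalerBl; zmod.
by rewrite -bop_scalerAr -bop_scalerAl.
Qed.

(** The resolvent identity, used twice. *)
Lemma inverse_diff : diff 0 w (fun s => - (w s * v * w s)).
Proof.
have [C Cv] := opb_exists v; have C0 : 0 <= C by case: Cv.
have lw : lip 0 w.
  split; first by exists 0%N, 2; split=> // s hs; rewrite mulr1; apply/gauge_opb/w2.
  exists 0%N, (2 * C * 2); split=> [|[s t] [hs ht]]; first by rewrite !mulr_ge0.
  rewrite /= inverse_sub //; apply: gauge_opb; rewrite distrC mulrC -cm_real.
  by apply/opbZ/opbM; [apply: opbM => //|]; exact: w2.
have lv : lip 0 (fun=> v) by apply/lip_const/decay_any.
have lwvw : lip 0 (fun s => w s * v * w s) by apply: (@lipM 0 0) => //; apply: (@lipM 0 0).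
split=> //.
  apply: (lip_eq (f := fun s => - 1 * (w s * v * w s))) => [s _|]; first by rewrite mulN1r.
  by apply: (@lipM 0 0) => //; apply/lip_const/decay_any.
exists 0%N, (2 * C * 2 * C * 2); split=> [|[s t] [hs ht]]; first by rewrite !mulr_ge0.
have -> : w t - w s - (t - s)%:C *: - (w s * v * w s) = ((t - s) ^+ 2)%:C *: (w s * v * w t * v * w s).
  rewrite inverse_sub // -(opprB t s) rcN scaleNr scalerN opprK addrC -scalerBr.
  rewrite -!mulrBl -opprB inverse_sub // -(opprB t s) rcN scaleNr opprK.
  by rewrite -!bop_scalerAl rcN scaleNr opprK scalerA -rcM -expr2.
have hw : opb (w s * v * w t * v * w s) (2 * C * 2 * C * 2).
  by do 2!(apply: opbM; last exact: w2; apply: opbM => //); exact: w2.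
have := opbZ ((t - s) ^+ 2)%:C hw; rewrite cm_real ger0_norm ?sqr_ge0 // mulrC.
exact: gauge_opb.
Qed.

End Inverse.

Section ConjugationPath.
Variables (F e v : bop V) (w : R -> bop V).
Hypothesis FF : F * F = 1.
Hypothesis Fe : F * e = - (e * F).
Hypothesis ve : even e v.
Hypothesis wl : forall s, unit_itv s -> w s * (1 + s%:C *: v) = 1.
Hypothesis wr : forall s, unit_itv s -> (1 + s%:C *: v) * w s = 1.
Hypothesis w2 : forall s, unit_itv s -> opb (w s) 2.
Implicit Types (a : bop V) (xs : seq (bop V)).

Let u s : bop V := 1 + s%:C *: v.
(** The derivative of [path_conj s a] is its commutator with [path_gen s]. *)
Definition path_gen s : bop V := v * w s.
Definition path_conj s a : bop V := w s * a * u s.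

Lemma ue s : even e (u s).
Proof. by rewrite /even /u mulrDl mulrDr mulr1 mul1r -bop_scalerAl -bop_scalerAr ve. Qed.

Lemma we s : unit_itv s -> even e (w s).
Proof.
move=> hs; rewrite /even -[LHS]mulr1 -(wr hs) !mulrA -(mulrA (w s) e) -(ue s) !mulrA wl //.
by rewrite mul1r.
Qed.

Lemma path_gen_even s : unit_itv s -> even e (path_gen s).
Proof. by move=> hs; apply: evenM => //; apply: we. Qed.

Lemma path_conj_even s a : unit_itv s -> even e a -> even e (path_conj s a).
Proof. by move=> hs ae; apply: evenM; [apply: evenM => //; exact: we|exact: ue]. Qed.

(** The conjugate differs from [a] by a multiple of the commutator of [a] with
    [v], which is in the filtration. *)
Lemma path_conjE s a : unit_itv s ->
  path_conj s a = a + s%:C *: (w s * (a * v - v * a)).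
Proof.
move=> hs; have -> : a = w s * u s * a by rewrite wl // mul1r.
rewrite -[a in RHS]mul1r -(wl hs) -/(u s).
have -> : path_conj s (w s * u s * a) = w s * a * u s by rewrite wl // mul1r.
have -> : w s * u s * (w s * u s * a) = w s * u s * a by rewrite wl // !mul1r.
have -> : w s * u s * a * v - v * (w s * u s * a) = a * v - v * a by rewrite wl // !mul1r.
rewrite bop_scalerAr -!mulrA -mulrDr; congr (_ * _).
rewrite /u !mulrDr !mulrDl mulr1 mul1r scalerBr -!bop_scalerAl -!bop_scalerAr; zmod.
Qed.

Lemma path_conj_inner s a : unit_itv s ->
  path_conj s a * path_gen s - path_gen s * path_conj s a =
  w s * w s * (a * v - v * a).
Proof.
move=> hs; set k := a * v - v * a.
have av : a * v = v * a + k by rewrite /k addrC subrK.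
have wv : w s * v = v * w s.
  rewrite -[LHS]mulr1 -(wr hs) -/(u s) !mulrA -(mulrA (w s) v).
  have -> : v * u s = u s * v.
    by rewrite /u mulrDl mulrDr mulr1 mul1r -bop_scalerAl -bop_scalerAr.
  by rewrite !mulrA wl // mul1r.
have h1 : path_conj s a * path_gen s = w s * v * a + w s * k.
  rewrite /path_conj /path_gen -wv -!mulrA (mulrA (u s)) wr // mul1r av mulrDr.
  by rewrite !mulrA.
have h2 : path_gen s * path_conj s a = w s * v * a + s%:C *: (w s * v * w s * k).
  by rewrite path_conjE // /path_gen -wv mulrDr -bop_scalerAr !mulrA.
have h3 : w s = w s * w s + s%:C *: (w s * v * w s).
  rewrite -[LHS]mulr1 -(wr hs) mulrDl mul1r mulrDr -bop_scalerAl -bop_scalerAr.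
  by rewrite mulrA.
rewrite h1 h2 {2}h3 mulrDl -bop_scalerAl; zmod.
Qed.

Lemma path_gen_lip : lip 0 path_gen.
Proof.
have [lw _ _] := inverse_diff wl wr w2.
by apply: (@lipM 0 0) => //; apply/lip_const/decay_any.
Qed.

Lemma dF_lip k f : lip k f -> lip k (fun s => dF F (f s)).
Proof.
move=> lf; have lF : lip 0 (fun=> F) by apply/lip_const/decay_any.
have lN : lip 0 (fun=> - F) by apply/lip_const/decay_any.
apply: (lip_eq (f := fun s => F * f s + f s * - F)) => [s _|]; first by rewrite dFE mulrN.
apply: lipD; first exact: (@lipM 0 k).
by rewrite -[k]addn0; exact: lipM.
Qed.

Lemma dF_diff k f f' : diff k f f' -> diff k (fun s => dF F (f s)) (fun s => dF F (f' s)).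
Proof.
move=> df; have lF : diff 0 (fun=> F) (fun=> 0) by apply/diff_const/decay_any.
have lN : diff 0 (fun=> - F) (fun=> 0) by apply/diff_const/decay_any.
have d1 := diffM lF df; have d2 := diffM df lN; rewrite addn0 in d2.
by apply: diff_eq (diffD d1 d2) => s _; rewrite dFE ?mul0r ?mulr0 ?add0r ?addr0 mulrN.
Qed.

Definition path_adapted a := decay 1 (dF F a) /\ decay 1 (a * v - v * a).

Lemma path_conj_diff a : path_adapted a ->
  diff 1 (fun s => dF F (path_conj s a))
         (fun s => dF F (path_conj s a * path_gen s - path_gen s * path_conj s a)).
Proof.
move=> [Fa va]; set k := a * v - v * a in va.
have dw := inverse_diff wl wr w2.
have d1 : diff 0 (fun s => s%:C *: w s) (fun s => w s * w s).
  apply: diff_eq (diffM diff_id dw) => s hs.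
    by rewrite -bop_scalerAl mul1r.
  rewrite mul1r -bop_scalerAl mul1r scalerN.
  rewrite {1}(_ : w s = w s * w s + s%:C *: (w s * v * w s)) ?addrK //.
  rewrite -[LHS]mulr1 -(wr hs) mulrDl mul1r mulrDr -bop_scalerAl -bop_scalerAr.
  by rewrite mulrA.
have d2 : diff 1 (fun s => s%:C *: w s * k) (fun s => w s * w s * k).
  apply: diff_eq (diffM d1 (diff_const va)) => s hs //.
  by rewrite mulr0 addr0.
apply: diff_eq (diffD (diff_const Fa) (dF_diff d2)) => s hs.
  by rewrite path_conjE // dFD -/k bop_scalerAl.
by rewrite path_conj_inner // add0r.
Qed.

Lemma path_conj_decay s a : unit_itv s -> path_adapted a -> decay 1 (dF F (path_conj s a)).
Proof.
move=> hs [Fa va]; rewrite path_conjE //.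
have -> : dF F (a + s%:C *: (w s * (a * v - v * a))) =
    dF F a + s%:C *: (F * w s * (a * v - v * a) - w s * (a * v - v * a) * F).
  rewrite !dFE mulrDl mulrDr scalerBr -!bop_scalerAl -!bop_scalerAr mulrA; zmod.
apply: decayD => //; apply: decayZ; apply: decayD.
  by apply: (@decayM 0 1) => //; exact: decay_any.
apply: decayN; apply: (@decayM 1 0); last exact: decay_any.
by apply: (@decayM 0 1) => //; exact: decay_any.
Qed.

(** The Leibniz rule inside the filtration: each factor contributes one degree,
    also in the Taylor remainder. *)
Lemma dprod_diff xs : {in xs, forall a, path_adapted a} ->
  diff (size xs) (fun s => dprod F (map (path_conj s) xs))
                (fun s => dprod_inner F (path_gen s) (map (path_conj s) xs)).
Proof.
elim: xs => [_|a xs IHxs hl] /=.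
  apply: (diff_eq (f := fun=> 1) (f' := fun=> 0)) => [s _|//|]; first by rewrite dprod_nil.
  exact/diff_const/decay_any.
have da := path_conj_diff (hl a (mem_head a xs)).
have hl' : {in xs, forall a, path_adapted a} by move=> b bx; apply: hl; rewrite in_cons bx orbT.
apply: diff_eq (diffM da (IHxs hl')) => s _; first by rewrite dprod_cons.
by [].
Qed.

Lemma insertions_lip xs : {in xs, forall a, path_adapted a} ->
  lip (size xs) (fun s => insertions F (path_gen s) (map (path_conj s) xs)).
Proof.
elim: xs => [_|a xs IHxs hl]; first exact/dF_lip/path_gen_lip.
have [la _ _] := path_conj_diff (hl a (mem_head a xs)).
have hl' : {in xs, forall a, path_adapted a} by move=> b bx; apply: hl; rewrite in_cons bx orbT.
have [ld _ _] := dprod_diff hl.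
have lN : lip 0 (fun=> - 1 : bop V) by apply/lip_const/decay_any.
have l1 := lipM (dF_lip path_gen_lip) ld.
have l2 := lipM lN (lipM la (IHxs hl')).
by apply: lip_eq (lipD l1 l2) => s _ /=; rewrite mulN1r.
Qed.

Lemma dprod_gen_lip xs : {in xs, forall a, path_adapted a} ->
  lip (size xs) (fun s => dF F (path_gen s) * dprod F (map (path_conj s) xs)).
Proof.
by move=> hl; have [ld _ _] := dprod_diff hl; apply: (@lipM 0) => //; exact/dF_lip/path_gen_lip.
Qed.

End ConjugationPath.

Section TraceOfFamilies.
Variables (p : nat) (Q : R) (S : bop V).
Hypothesis rQ : forall n, \sum_(i < n) r i ^+ p <= Q.

Lemma lip_mull k f : lip k f -> lip k (fun s => S * f s).
Proof. by move=> lf; apply: (@lipM 0 k) => //; apply/lip_const/decay_any. Qed.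

Lemma lip_decay k f s : lip k f -> unit_itv s -> decay k (f s).
Proof. by move=> [[M [C [C0 h]]] _] hs; exists M; eexists; exact: h. Qed.

Lemma lip_trace k f : (p <= k)%N -> lip k f -> exists K : R,
  forall s t, unit_itv s -> unit_itv t -> cm (trace (f t) - trace (f s)) <= K * `|t - s|.
Proof.
move=> pk lf; have [K [K0 h]] := family_trace_le rQ pk (fun _ _ => normr_ge0 _) lf.2.
exists K => s t hs ht.
have [_] : decay p (f t - f s) /\ cm (trace (f t - f s)) <= K * `|t - s| := h (s, t) (conj hs ht).
have [c1 c2] : decay p (f s) /\ decay p (f t) by split; apply: decayW pk _; apply: lip_decay lf _.
rewrite (decay_traceD rQ) //; last exact: decayN.
by rewrite -[- f s]scaleN1r (decay_traceZ rQ) // mulN1r.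
Qed.

Lemma diff_trace k f f' : (p <= k)%N -> diff k f f' -> exists K : R,
  forall s t, unit_itv s -> unit_itv t ->
    cm (trace (f t) - trace (f s) - (t - s)%:C * trace (f' s)) <= K * (t - s) ^+ 2.
Proof.
move=> pk [lf lf' df]; have [K [K0 h]] := family_trace_le rQ pk (fun _ _ => sqr_ge0 _) df.
exists K => s t hs ht; pose T := f t - f s - (t - s)%:C *: f' s.
have [_] : decay p T /\ cm (trace T) <= K * (t - s) ^+ 2 := h (s, t) (conj hs ht).
have c1 : decay p (f s) by apply: decayW pk _; apply: lip_decay lf _.
have c2 : decay p (f t) by apply: decayW pk _; apply: lip_decay lf _.
have c3 : decay p (f' s) by apply: decayW pk _; apply: lip_decay lf' _.
rewrite /T (decay_traceD rQ); [|by apply: decayD => //; exact: decayN|by apply/decayN/decayZ].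
rewrite (decay_traceD rQ) //; last exact: decayN.
rewrite -[- f s]scaleN1r (decay_traceZ rQ) // mulN1r.
by rewrite -scaleNr (decay_traceZ rQ) // mulNr.
Qed.

End TraceOfFamilies.

End Calculus.

(** * Real analysis on the unit interval *)

Section RealAnalysis.
Context {R : realType}.
Implicit Types (f g : R -> R) (a b s t x y d : R).

Lemma is_derive_eps f x df :
  (forall e : R, 0 < e -> exists2 d, 0 < d & forall y, `|y - x| < d ->
     `|f y - f x - (y - x) * df| <= e * `|y - x|) ->
  is_derive x 1 f df.
Proof.
move=> h.
have lim : (fun h => h^-1 *: ((f \o shift x) (h *: 1) - f x)) @ 0^' --> df.
  apply/cvgrPdist_lt => e e0; have e2 : 0 < e / 2 by rewrite divr_gt0.
  have [d d0 hd] := h _ e2.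
  rewrite near_withinE; apply/nbhs_ballP; exists d => //= y.
  rewrite /ball /= sub0r normrN => yd y0.
  have := hd (y + x); rewrite addrK => /(_ yd).
  rewrite /= scaler1 => hy.
  have yn : 0 < `|y| by rewrite normr_gt0.
  have -> : df - y^-1 *: (f (y + x) - f x) = - (f (y + x) - f x - y * df) / y.
    by rewrite /GRing.scale /=; field.
  rewrite normrM normrN normfV ltr_pdivrMr //; apply: le_lt_trans hy _.
  by rewrite ltr_pM2r // ltr_pdivrMr // ltr_pMr // ltr1n.
by split; [apply/cvg_ex; exists df|apply/cvg_lim].
Qed.

Lemma within_continuous_eps f a b :
  (forall x, a <= x <= b -> forall e : R, 0 < e -> exists2 d, 0 < d &
     forall y, a <= y <= b -> `|y - x| < d -> `|f y - f x| < e) ->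
  {within `[a, b], continuous f}.
Proof.
move=> h; apply/subspace_continuousP => x /=; rewrite in_itv /= => xab.
apply/cvgrPdist_lt => e e0; have [d d0 hd] := h x xab e e0.
rewrite near_withinE; apply/nbhs_ballP; exists d => //= y.
by rewrite /ball /= distrC => yd; rewrite in_itv /= => yab; rewrite distrC; apply: hd.
Qed.

Definition lipschitz01 f := exists K, forall s t, unit_itv s -> unit_itv t ->
  `|f t - f s| <= K * `|t - s|.

Lemma lipschitz01_continuous f : lipschitz01 f -> {within `[0, 1], continuous f}.
Proof.
move=> [K hK]; apply: within_continuous_eps => x x01 e e0.
have K1 : 0 < `|K| + 1 by rewrite ltr_wpDl.
exists (e / (`|K| + 1)); first exact: divr_gt0.
move=> y y01; rewrite ltr_pdivlMr // => hy.
apply: le_lt_trans (hK _ _ x01 y01) _; apply: le_lt_trans hy.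
rewrite mulrC ler_wpM2l // (le_trans (ler_norm K)) // lerDl //.
Qed.

Definition integral01 f : R := Rintegral lebesgue_measure `[0, 1]%classic f.

Lemma lipschitz01_integrable f : lipschitz01 f ->
  (@lebesgue_measure R).-integrable `[0, 1] (EFin \o f).
Proof.
move=> /lipschitz01_continuous cf; apply: continuous_compact_integrable => //.
exact: segment_compact.
Qed.

Lemma integral01D f g : lipschitz01 f -> lipschitz01 g ->
  integral01 (fun t => f t + g t) = integral01 f + integral01 g.
Proof. by move=> lf lg; apply: RintegralD => //; exact: lipschitz01_integrable. Qed.

Lemma integral01Z c f : lipschitz01 f -> integral01 (fun t => c * f t) = c * integral01 f.
Proof. by move=> lf; apply: RintegralZl => //; exact: lipschitz01_integrable. Qed.

(** A quadratic Taylor remainder makes [g] the derivative of [f]. *)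
Lemma integral01_FTC f g : lipschitz01 g ->
  (exists K, forall s t, unit_itv s -> unit_itv t ->
    `|f t - f s - (t - s) * g s| <= K * (t - s) ^+ 2) ->
  integral01 g = f 1 - f 0.
Proof.
move=> lg [K hK].
have K1 : 0 < `|K| + 1 by rewrite ltr_wpDl.
have hK' s t : unit_itv s -> unit_itv t ->
    `|f t - f s - (t - s) * g s| <= (`|K| + 1) * `|t - s| * `|t - s|.
  move=> hs ht; apply: le_trans (hK _ _ hs ht) _; rewrite -mulrA -expr2 real_normK ?num_real //.
  by rewrite ler_wpM2r ?sqr_ge0 // (le_trans (ler_norm K)) // lerDl.
have df x : 0 < x < 1 -> is_derive x 1 f (g x).
  move=> /andP[x0 x1]; apply: is_derive_eps => e e0.
  exists (Num.min (Num.min x (1 - x)) (e / (`|K| + 1))).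
    by rewrite !lt_min x0 subr_gt0 x1 divr_gt0.
  move=> y; rewrite !lt_min => /andP[/andP[h1 h2] h3].
  have x01 : unit_itv x by rewrite /unit_itv !ltW.
  have y01 : unit_itv y.
    move: h1 h2; rewrite !ltr_norml => /andP[a1 a2] /andP[b1 b2]; rewrite /unit_itv; lra.
  apply: le_trans (hK' _ _ x01 y01) _; rewrite ler_wpM2r //.
  by rewrite ltr_pdivlMr // mulrC in h3; exact: ltW.
have lf : lipschitz01 f.
  have [K' hK2] := lg.
  exists (`|K| + 1 + (`|g 0| + `|K'|)) => s t hs ht.
  have ts1 : `|t - s| <= 1.
    by move: hs ht; rewrite /unit_itv ler_norml => /andP[? ?] /andP[? ?]; lra.
  have gs : `|g s| <= `|g 0| + `|K'|.
    have h0 : unit_itv (0 : R) by rewrite /unit_itv lexx ler01.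
    have -> : g s = g 0 + (g s - g 0) by rewrite addrC subrK.
    apply: le_trans (ler_normD _ _) _; rewrite lerD2l.
    apply: le_trans (hK2 _ _ h0 hs) _; rewrite subr0.
    have s1 : `|s| <= 1 by move: hs; rewrite /unit_itv ler_norml => /andP[? ?]; lra.
    apply: le_trans (ler_wpM2r (normr_ge0 _) (ler_norm K')) _.
    by rewrite ler_piMr.
  have -> : f t - f s = (f t - f s - (t - s) * g s) + (t - s) * g s by rewrite subrK.
  apply: le_trans (ler_normD _ _) _; rewrite [leRHS]mulrDl; apply: lerD.
    by apply: le_trans (hK' _ _ hs ht) _; rewrite ler_piMr // mulr_ge0 // ltW.
  by rewrite normrM mulrC ler_wpM2r.
have cf := lipschitz01_continuous lf.
have [_ cf0 cf1] := (continuous_within_itvP f (@ltr01 R)).1 cf.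
have := @continuous_FTC2 R g f 0 1 ltr01 (lipschitz01_continuous lg) _ _.
rewrite /integral01 /Rintegral => -> //.
- by split => // x; rewrite in_itv /= => /df [].
- by move=> x; rewrite in_itv /= => /df hx; rewrite derive1E; case: hx.
Qed.

End RealAnalysis.

Section ComplexIntegral.
Context {R : realType}.
Implicit Types (f g : R -> R[i]).

Definition clipschitz01 f := exists K : R, forall s t, unit_itv s -> unit_itv t ->
  cm (f t - f s) <= K * `|t - s|.

Definition cintegral01 f : R[i] :=
  Complex (integral01 (fun t => complex.Re (f t))) (integral01 (fun t => complex.Im (f t))).

Lemma ReD (z w : R[i]) : complex.Re (z + w) = complex.Re z + complex.Re w.
Proof. by case: z w => [? ?] [? ?]. Qed.
Lemma ImD (z w : R[i]) : complex.Im (z + w) = complex.Im z + complex.Im w.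
Proof. by case: z w => [? ?] [? ?]. Qed.
Lemma ReN (z : R[i]) : complex.Re (- z) = - complex.Re z. Proof. by case: z. Qed.
Lemma ImN (z : R[i]) : complex.Im (- z) = - complex.Im z. Proof. by case: z. Qed.
Lemma ReM (z w : R[i]) : complex.Re (z * w) =
  complex.Re z * complex.Re w - complex.Im z * complex.Im w.
Proof. by case: z w => [? ?] [? ?]. Qed.
Lemma ImM (z w : R[i]) : complex.Im (z * w) =
  complex.Re z * complex.Im w + complex.Im z * complex.Re w.
Proof. by case: z w => [? ?] [? ?]. Qed.

Lemma clipschitz01_Re f : clipschitz01 f -> lipschitz01 (fun t => complex.Re (f t)).
Proof.
move=> [K hK]; exists K => s t hs ht; apply: le_trans (hK _ _ hs ht).
by rewrite -ReN -ReD; exact: Re_le_cm.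
Qed.

Lemma clipschitz01_Im f : clipschitz01 f -> lipschitz01 (fun t => complex.Im (f t)).
Proof.
move=> [K hK]; exists K => s t hs ht; apply: le_trans (hK _ _ hs ht).
by rewrite -ImN -ImD; exact: Im_le_cm.
Qed.

Lemma clipschitz01D f g : clipschitz01 f -> clipschitz01 g -> clipschitz01 (fun t => f t + g t).
Proof.
move=> [K hK] [L hL]; exists (K + L) => s t hs ht; rewrite opprD addrACA mulrDl.
by apply: le_trans (cmD _ _) _; apply: lerD; auto.
Qed.

Lemma clipschitz01Z c f : clipschitz01 f -> clipschitz01 (fun t => c * f t).
Proof.
move=> [K hK]; exists (cm c * K) => s t hs ht; rewrite -mulrBr cmM -mulrA.
by rewrite ler_wpM2l ?cm_ge0 //; auto.
Qed.

Lemma lipschitz01Z (c : R) (h : R -> R) : lipschitz01 h -> lipschitz01 (fun t => c * h t).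
Proof.
move=> [K hK]; exists (`|c| * K) => s t hs ht; rewrite -mulrBr normrM -mulrA.
by rewrite ler_wpM2l //; auto.
Qed.

Lemma cintegral01D f g : clipschitz01 f -> clipschitz01 g ->
  cintegral01 (fun t => f t + g t) = cintegral01 f + cintegral01 g.
Proof.
move=> lf lg; apply/eqP; rewrite eq_complex /=; apply/andP; split; apply/eqP.
  rewrite -integral01D; [|exact: clipschitz01_Re|exact: clipschitz01_Re].
  by congr integral01; apply/funext => t; rewrite ReD.
rewrite -integral01D; [|exact: clipschitz01_Im|exact: clipschitz01_Im].
by congr integral01; apply/funext => t; rewrite ImD.
Qed.

Lemma cintegral01Z c f : clipschitz01 f ->
  cintegral01 (fun t => c * f t) = c * cintegral01 f.
Proof.
move=> lf; have lR := clipschitz01_Re lf; have lI := clipschitz01_Im lf.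
apply/eqP; rewrite eq_complex ReM ImM /=; apply/andP; split; apply/eqP.
  rewrite -mulNr -!integral01Z // -integral01D; [|exact: lipschitz01Z|exact: lipschitz01Z].
  by congr integral01; apply/funext => t; rewrite ReM mulNr.
rewrite -!integral01Z // -integral01D; [|exact: lipschitz01Z|exact: lipschitz01Z].
by congr integral01; apply/funext => t; rewrite ImM.
Qed.

Lemma cintegral01_FTC f g : clipschitz01 g ->
  (exists K : R, forall s t, unit_itv s -> unit_itv t ->
    cm (f t - f s - (t - s)%:C * g s) <= K * (t - s) ^+ 2) ->
  cintegral01 g = f 1 - f 0.
Proof.
move=> lg [K hK]; rewrite /cintegral01.
rewrite (@integral01_FTC _ (fun t => complex.Re (f t)) _ (clipschitz01_Re lg)); last first.
  exists K => s t hs ht; apply: le_trans (hK _ _ hs ht); apply: le_trans (Re_le_cm _).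
  by rewrite !ReD !ReN ReM /= mul0r subr0.
rewrite (@integral01_FTC _ (fun t => complex.Im (f t)) _ (clipschitz01_Im lg)); last first.
  exists K => s t hs ht; apply: le_trans (hK _ _ hs ht); apply: le_trans (Im_le_cm _).
  by rewrite !ImD !ImN ImM /= mul0r addr0.
by case: (f 1) (f 0) => [? ?] [? ?].
Qed.

End ComplexIntegral.

(** * Strong differentiability gives norm continuity *)

Section UniformBoundedness.
Context {R : realType} {V : hilbert R}.

(** Take [z] of norm [rho] with a large image. The images of [x + z] and [x - z]
    differ by twice that of [z], so one of them is as large. *)
Lemma bump_vector (T : bop V) (N rho : R) x : 0 <= rho -> ~ opb T N -> 0 <= N ->
  exists2 x', nm (x' - x) <= rho & N * rho <= nm (T x').
Proof.
move=> rho0 hT N0.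
have [y hy] : exists y, N * nm y < nm (T y).
  apply: contrapT => h; apply: hT; split=> // y; rewrite leNgt; apply/negP => hy.
  by apply: h; exists y.
have y0 : nm y != 0.
  by apply/eqP => /nm_eq0 y0; move: hy; rewrite y0 bop_app0 nm0 mulr0 ltxx.
have yp : 0 < nm y by rewrite lt_def y0 nm_ge0.
pose c := (rho / nm y)%:C; pose z := c *: y.
have cmc : cm c = rho / nm y by rewrite cm_real ger0_norm // divr_ge0 ?nm_ge0.
have nz : nm z = rho by rewrite nmZ cmc mulfVK.
have Tz : N * rho <= nm (T z).
  by rewrite bopZ nmZ cmc mulrAC ler_pdivlMr // mulrAC [leRHS]mulrC ler_wpM2r // ltW.
have h2 : 2 * nm (T z) <= nm (T (x + z)) + nm (T (x - z)).
  have -> : 2 * nm (T z) = nm (T (x + z) - T (x - z)).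
    rewrite -bopB; have -> : x + z - (x - z) = 2%:R *: z.
      by rewrite scaler_nat mulr2n; zmod.
    by rewrite bopZ nmZ -rc_nat cm_real ger0_norm.
  exact: nmB.
have [h|h] := leP (nm (T z)) (nm (T (x + z))).
  by exists (x + z); [rewrite addrC addKr nz|exact: le_trans h].
exists (x - z); first by rewrite addrC addKr nmN nz.
apply: le_trans Tz _; lra.
Qed.

(** If the norms were unbounded, balls of decreasing radii could be nested in such
    a way that their common point defeats every pointwise bound. *)
Lemma uniform_boundedness (I : Type) (T : I -> bop V) :
  (forall x, exists C : R, forall i, nm (T i x) <= C) -> exists C, forall i, opb (T i) C.
Proof.
move=> hpt; apply: contrapT => hun.
have step (k : nat) (b : V * R) : exists b' : V * R, 0 < b.2 ->
    [/\ 0 < b'.2, b'.2 <= b.2 / 2, nm (b'.1 - b.1) <= b.2 / 2 &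
      exists i, forall y, nm (y - b'.1) <= b'.2 -> k%:R <= nm (T i y)].
  have [b0|nb] := pselect (0 < b.2); last by exists b.
  have d0 : 0 < b.2 / 2 by rewrite divr_gt0.
  have N0 : 0 <= k.+1%:R / (b.2 / 2) by rewrite divr_ge0 // ltW.
  have [i hi] : exists i, ~ opb (T i) (k.+1%:R / (b.2 / 2)).
    by apply: contrapT => h; apply: hun; eexists => i; apply: contrapT => h'; apply: h; exists i; exact: h'.
  have [x' hx] := bump_vector b.1 (ltW d0) hi N0; rewrite mulfVK ?gt_eqF // => big.
  have [C [C0 hC]] := opb_exists (T i); have C1 : 0 < C + 1 by rewrite ltr_wpDl.
  exists (x', Num.min (b.2 / 2) (C + 1)^-1) => _; split=> //=.
  - by rewrite lt_min d0 invr_gt0.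
  - by rewrite ge_min lexx.
  exists i => y; rewrite le_min => /andP[_ hy].
  have : nm (T i (y - x')) <= 1.
    apply: le_trans (hC _) _; apply: le_trans (ler_wpM2l C0 hy) _.
    by rewrite ler_pdivrMr // mul1r lerDl.
  rewrite bopB; have := nmB (T i y) (T i y - T i x'); rewrite subKr => h1 h2.
  by move: big; rewrite -natr1; lra.
have [g hg] : exists g : nat -> V * R -> V * R, forall k b, 0 < b.2 ->
    [/\ 0 < (g k b).2, (g k b).2 <= b.2 / 2, nm ((g k b).1 - b.1) <= b.2 / 2 &
      exists i, forall y, nm (y - (g k b).1) <= (g k b).2 -> k%:R <= nm (T i y)].
  suff /boolp.choice[g hg] : forall k, exists h : V * R -> V * R, forall b, 0 < b.2 ->
      [/\ 0 < (h b).2, (h b).2 <= b.2 / 2, nm ((h b).1 - b.1) <= b.2 / 2 &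
        exists i, forall y, nm (y - (h b).1) <= (h b).2 -> k%:R <= nm (T i y)] by exists g.
  by move=> k; have /boolp.choice[h hh] := step k; exists h.
pose b := fix b n := if n is k.+1 then g k (b k) else (0 : V, 1 : R).
pose x n := (b n).1; pose r n := (b n).2.
have r0 n : 0 < r n by elim: n => [|n IHn]; [exact: ltr01|have [] := hg n _ IHn].
have r_half n : r n.+1 <= r n / 2 by have [] := hg n _ (r0 n).
have x_step n : nm (x n.+1 - x n) <= r n / 2 by have [] := hg n _ (r0 n).
have r_small n : r n <= 2^-1 ^+ n.
  elim: n => [|n IHn]; first by rewrite expr0.
  by apply: le_trans (r_half n) _; rewrite exprSr ler_wpM2r.
have x_near n k : nm (x (n + k)%N - x n) <= r n - r (n + k)%N.
  elim: k => [|k IHk]; first by rewrite addn0 !subrr nm0.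
  have -> : x (n + k.+1)%N - x n = (x (n + k).+1 - x (n + k)%N) + (x (n + k)%N - x n).
    by rewrite addrA subrK addnS.
  apply: le_trans (nmD _ _) _; rewrite addnS.
  have := x_step (n + k)%N; have := r_half (n + k)%N; lra.
have x_ball n k : nm (x (n + k)%N - x n) <= r n.
  by apply: le_trans (x_near n k) _; rewrite gerBl ltW.
have [l hl] : exists l, forall d : R, 0 < d -> exists M, forall n, (M <= n)%N -> nm (x n - l) < d.
  apply: nm_complete => d d0; have d2 : 0 < d / 2 by rewrite divr_gt0.
  have : (fun k => (2^-1 : R) ^+ k) @ \oo --> (0 : R) by apply: cvg_expr; rewrite ger0_norm; lra.
  move=> /cvgrPdist_lt /(_ _ d2) [M _ hM]; have := hM M (leqnn M).
  rewrite /= sub0r normrN ger0_norm ?exprn_ge0 // => hd; exists M => m n Mm Mn.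
  have -> : x m - x n = (x m - x M) - (x n - x M) by rewrite opprB addrA subrK.
  apply: le_lt_trans (nmB _ _) _; have := r_small M.
  have := x_ball M (m - M)%N; have := x_ball M (n - M)%N; rewrite !subnKC //; lra.
have l_ball n : nm (l - x n) <= r n.
  apply/ler_addgt0Pr => d d0; have [M hM] := hl d d0.
  have h1 := hM (n + M)%N (leq_addl _ _).
  have -> : l - x n = (x (n + M)%N - x n) - (x (n + M)%N - l) by zmod.
  apply: le_trans (nmB _ _) _; have := x_ball n M; lra.
have [C hC] := hpt l; pose k := Num.bound `|C|.
have [_ _ _ [i hi]] := hg k _ (r0 k).
have := le_trans (hi l (l_ball k.+1)) (hC i).
by rewrite leNgt (le_lt_trans (ler_norm C)) // archi_boundP.
Qed.

End UniformBoundedness.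

Section StrongDerivative.
Context {R : realType} {V : hilbert R}.
Implicit Types (f g : R -> V).

Lemma nm_continuous_within g : {within `[0, 1], continuous g} ->
  {within `[0, 1], continuous (fun t => nm (g t))}.
Proof.
move=> /subspace_continuousP cg; apply: within_continuous_eps => x x01 e e0.
have xin : `[0, 1]%classic x by rewrite /= in_itv.
have e0' : 0 < e%:C :> R[i] by rewrite ltcR.
have /cvgrPdist_lt /(_ _ e0') := cg x xin.
rewrite near_withinE => /nbhs_ballP [d /= d0 hd]; exists d => // y y01 yx.
have := hd y; rewrite /ball /= distrC => /(_ yx).
rewrite in_itv /= => /(_ y01); rewrite nmE ltcR => hy.
apply: le_lt_trans hy; rewrite ler_norml.
have h1 := nmB (g x) (g x - g y); have h2 := nmD (g y) (g x - g y).
rewrite subKr in h1; rewrite addrC subrK in h2; apply/andP; split; lra.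
Qed.

Lemma strong_derivative_eps f g t : unit_itv t ->
  (((s - t)^-1)%:C *: (f s - f t) @[s --> within `[0, 1]%classic t^'] --> g t) ->
  forall e : R, 0 < e -> exists2 d, 0 < d & forall s, unit_itv s -> `|s - t| < d ->
    nm (f s - f t - (s - t)%:C *: g t) <= e * `|s - t|.
Proof.
move=> t01 fg e e0; have e0' : 0 < e%:C :> R[i] by rewrite ltcR.
have /cvgrPdist_lt /(_ _ e0') := fg.
rewrite near_withinE near_withinE => /nbhs_ballP [d /= d0 hd]; exists d => // s s01 sd.
have [->|st] := eqVneq s t; first by rewrite !subrr scale0r subr0 nm0 normr0 mulr0.
have := hd s; rewrite /ball /= distrC => /(_ sd st).
rewrite in_itv /= => /(_ s01); rewrite nmE ltcR => /ltW hs.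
have st0 : s - t != 0 by rewrite subr_eq0.
have -> : f s - f t - (s - t)%:C *: g t =
    - ((s - t)%:C *: (g t - (s - t)^-1%:C *: (f s - f t))).
  by rewrite scalerBr scalerA -rcM mulfV // scale1r opprB.
by rewrite nmN nmZ cm_real mulrC ler_wpM2r.
Qed.

(** The mean value theorem, applied to the component along the increment. *)
Lemma strong_C1_lipschitz f g : {within `[0, 1], continuous g} ->
  (forall t : R, 0 <= t <= 1 ->
     ((s - t)^-1)%:C *: (f s - f t) @[s --> within `[0, 1]%classic t^'] --> g t) ->
  exists C : R, forall s t, unit_itv s -> unit_itv t -> nm (f t - f s) <= C * `|t - s|.
Proof.
move=> cg dfg.
have [c _ gc] := @EVT_max R (fun t => nm (g t)) 0 1 ler01 (nm_continuous_within cg).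
exists (nm (g c)) => s t.
wlog st : s t / s <= t.
  move=> H hs ht; have [st|/ltW ts] := leP s t; first exact: H.
  by rewrite nmBC distrC; apply: H.
move=> hs ht; have [<-|s_t] := eqVneq s t; first by rewrite !subrr nm0 normr0 mulr0.
set z := f t - f s.
pose phi u := complex.Re (ip (f u) z).
have st01 u : s <= u <= t -> unit_itv u.
  by move: hs ht; rewrite /unit_itv => /andP[? ?] /andP[? ?] /andP[? ?]; lra.
have phi_eps u : unit_itv u -> forall e : R, 0 < e -> exists2 d, 0 < d & forall v, unit_itv v ->
    `|v - u| < d -> `|phi v - phi u - (v - u) * complex.Re (ip (g u) z)| <= e * `|v - u|.
  move=> u01 e e0; have z1 : 0 < nm z + 1 by rewrite ltr_wpDl ?nm_ge0.
  have [d d0 hd] := strong_derivative_eps u01 (dfg u u01) (divr_gt0 e0 z1).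
  exists d => // v v01 /(hd v v01) hv.
  have -> : phi v - phi u - (v - u) * complex.Re (ip (g u) z) =
      complex.Re (ip (f v - f u - (v - u)%:C *: g u) z).
    by rewrite /phi !ipBl ipZl !ReD !ReN ReM /= mul0r subr0.
  apply: le_trans (Re_le_cm _) _; apply: le_trans (Cauchy_Schwarz _ _) _.
  apply: le_trans (ler_wpM2r (nm_ge0 _) hv) _.
  rewrite mulrAC ler_wpM2r // mulrAC ler_pdivrMr // ler_wpM2l ?(ltW e0) //.
  by rewrite lerDl.
have slt : s < t by rewrite lt_neqAle s_t.
have dphi u : u \in `]s, t[ -> is_derive u 1 phi (complex.Re (ip (g u) z)).
  rewrite in_itv /= => /andP[su ut]; apply: is_derive_eps => e e0.
  have u01 : unit_itv u by apply: st01; rewrite !ltW.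
  have [d d0 hd] := phi_eps u u01 e e0.
  exists (Num.min (Num.min (u - s) (t - u)) d); first by rewrite !lt_min !subr_gt0 su ut.
  move=> v; rewrite !lt_min => /andP[/andP[h1 h2] h3]; apply: hd => //; apply: st01.
  by move: h1 h2; rewrite !ltr_norml => /andP[? ?] /andP[? ?]; lra.
have cphi : {within `[s, t], continuous phi}.
  apply: within_continuous_eps => u /st01 u01 e e0.
  have [d d0 hd] := phi_eps u u01 1 ltr01.
  set L := complex.Re (ip (g u) z) in hd.
  have L1 : 0 < 1 + `|L| by rewrite ltr_pwDl.
  exists (Num.min d (e / (1 + `|L|))); first by rewrite lt_min d0 divr_gt0.
  move=> v /st01 v01; rewrite lt_min ltr_pdivlMr // => /andP[/(hd v v01) h1 h2].
  have -> : phi v - phi u = (phi v - phi u - (v - u) * L) + (v - u) * L by rewrite subrK.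
  apply: le_lt_trans (ler_normD _ _) _; rewrite normrM; lra.
have [c' c'st] := MVT slt dphi cphi.
have -> : phi t - phi s = nm z ^+ 2.
  by rewrite /phi -ReN -ReD -ipBl -/z ipxx.
have c'01 : nm (g c') <= nm (g c).
  apply: gc; move: c'st; rewrite !in_itv /= => /andP[? ?]; apply: st01.
  by rewrite !ltW.
move=> hz; have [->|z0] := eqVneq (nm z) 0; first by rewrite mulr_ge0 // nm_ge0.
have zp : 0 < nm z by rewrite lt_def z0 nm_ge0.
rewrite -(ler_pM2r zp) -expr2 hz ger0_norm ?subr_ge0 // mulrAC ler_wpM2r ?subr_ge0 //.
apply: le_trans (ler_norm _) _; apply: le_trans (Re_le_cm _) _.
by apply: le_trans (Cauchy_Schwarz _ _) _; rewrite ler_wpM2r ?nm_ge0.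
Qed.

(** The difference quotients are pointwise bounded, hence uniformly bounded. *)
Lemma norm_lipschitz (T : R -> bop V) :
  (forall x, exists C : R, forall s t, unit_itv s -> unit_itv t ->
     nm (T t x - T s x) <= C * `|t - s|) ->
  exists C : R, forall s t, unit_itv s -> unit_itv t -> opb (T t - T s) (C * `|t - s|).
Proof.
move=> hT.
pose I := {st : R * R | unit_itv st.1 /\ unit_itv st.2}.
pose q (i : I) : bop V := ((sval i).2 - (sval i).1)^-1%:C *: (T (sval i).2 - T (sval i).1).
have [|C hC] := @uniform_boundedness R V I q.
  move=> x; have [C hC] := hT x; exists `|C| => -[[s t] [hs ht]].
  rewrite /q bop_scaleE bop_subE nmZ cm_real normfV /=.
  have [->|st] := eqVneq t s; first by rewrite subrr normr0 invr0 mul0r.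
  have ts0 : 0 < `|t - s| by rewrite normr_gt0 subr_eq0.
  rewrite mulrC ler_pdivrMr //; apply: le_trans (hC _ _ hs ht) _.
  by rewrite ler_wpM2r // ler_norm.
exists C => s t hs ht; have [->|st] := eqVneq t s.
  by rewrite !subrr normr0 mulr0; exact: opb0.
have ts0 : t - s != 0 by rewrite subr_eq0.
have -> : T t - T s = (t - s)%:C *: q (exist _ (s, t) (conj hs ht)).
  by rewrite /q /= scalerA -rcM mulfV // scale1r.
by rewrite mulrC -cm_real; apply/opbZ/hC.
Qed.

End StrongDerivative.

(** * Cochains as functions of lists *)

Section Lists.
Variable B : pzRingType.
Implicit Types (s t : seq B).

Lemma nth_face i s j : (i < (size s).-1)%N -> (j < (size s).-1)%N ->
  nth 0 (face i s) j = if (j < i)%N then nth 0 s j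
                       else if j == i then nth 0 s j * nth 0 s j.+1 else nth 0 s j.+1.
Proof.
elim: i s j => [|i IHi] [|x0 [|x1 s]] //= j hi hj; first by case: j hj.
by case: j hj => [|j] //= hj; rewrite IHi.
Qed.

Lemma map_face (f : B -> B) i s : {morph f : x y / x * y} ->
  map f (face i s) = face i (map f s).
Proof.
move=> fM; elim: i s => [|i IHi] [|x0 s] //=; last by rewrite IHi.
by case: s => [|x1 s] //=; rewrite fM.
Qed.

Section Values.
Variables (R : realType) (A : calgebra R) (rho : A -> B).
Hypothesis rhoM : forall a b, rho (amul a b) = rho a * rho b.

(** The arguments of a cochain are indexed by ordinals, whereas products of
    commutators are computed by recursion on lists. *)
Definition values m (x : 'I_m.+1 -> A) : seq B := mkseq (fun k => rho (x (inord k))) m.+1.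

Lemma size_values m (x : 'I_m.+1 -> A) : size (values x) = m.+1.
Proof. exact: size_mkseq. Qed.

Lemma values_inner_face n (x : 'I_n.+2 -> A) i : (i < n.+1)%N ->
  values (inner_face x i) = face i (values x).
Proof.
move=> hi; apply: (@eq_from_nth _ 0); first by rewrite size_face !size_values.
move=> j; rewrite size_values => hj.
rewrite nth_face ?size_values // /values.
have hj' : (j < n.+2)%N by exact: leqW.
rewrite !nth_mkseq // /inner_face inordK //.
by case: ltngtP => // _; rewrite rhoM.
Qed.

Lemma values_cons n (x : 'I_n.+1 -> A) :
  values x = rho (x ord0) :: mkseq (fun k => rho (x (inord k.+1))) n.
Proof.
rewrite /values /mkseq /= (iotaDl 1 0) -map_comp; congr (rho (x _) :: _).
by apply: val_inj; rewrite /= inordK.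
Qed.

Lemma values_ends n (x : 'I_n.+2 -> A) : exists2 t, size t = n &
  values x = rho (x ord0) :: rcons t (rho (x ord_max)) /\
  values (last_face x) = rho (x ord_max) * rho (x ord0) :: t.
Proof.
exists (mkseq (fun k => rho (x (inord k.+1))) n); first by rewrite size_mkseq.
split.
  rewrite values_cons mkseqS; congr (_ :: rcons _ (rho (x _))).
  by apply: val_inj; rewrite /= inordK.
rewrite values_cons /last_face eqxx rhoM; congr (_ :: _).
apply/eq_in_map => k; rewrite mem_iota add0n => /= kn.
rewrite -val_eqE /= !inordK ?ltnS //=; congr (rho (x _)); apply: val_inj => /=.
Qed.

Lemma values_shift n (x : 'I_n.+1 -> A) :
  values (fun i => x (ordS i)) = rot 1 (values x).
Proof.
apply: (@eq_from_nth _ 0); first by rewrite size_rot !size_values.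
move=> j; rewrite size_values => hj.
rewrite [in RHS]values_cons rot1_cons nth_rcons size_mkseq /values nth_mkseq //.
case: ltnP => [jn|nj].
  rewrite nth_mkseq //; congr (rho (x _)); apply: val_inj => /=.
  by rewrite !inordK // modn_small.
have -> : j = n by apply/eqP; rewrite eqn_leq -ltnS hj nj.
rewrite eqxx; congr (rho (x _)); apply: val_inj => /=.
by rewrite inordK // modnn.
Qed.

Lemma values_subst n (x : 'I_n.+1 -> A) (i : 'I_n.+1) u :
  values (subst_at x i u) = take i (values x) ++ rho u :: drop i.+1 (values x).
Proof.
apply: (@eq_from_nth _ 0).
  rewrite size_cat size_take !size_values ltn_ord -cat1s size_cat size_drop size_values /=.
  by have := ltn_ord i; lia.
move=> j; rewrite size_values => hj.
rewrite nth_cat size_take size_values ltn_ord {1}/values nth_mkseq // /subst_at.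
have -> : (inord j == i) = (j == i :> nat) by rewrite -val_eqE /= inordK.
case: (ltngtP j i) => [ji|ij|->].
- by rewrite nth_take // /values nth_mkseq.
- have -> : (j - i = (j - i.+1).+1)%N by lia.
  have hk : (i.+1 + (j - i.+1) = j)%N by lia.
  have nthS (l : seq B) b k : nth 0 (b :: l) k.+1 = nth 0 l k by [].
  by rewrite nthS nth_drop hk /values nth_mkseq.
- by rewrite subnn.
Qed.

Lemma values_in n (x : 'I_n.+1 -> A) (P : B -> Prop) :
  (forall i, P (rho (x i))) -> {in values x, forall b, P b}.
Proof. by move=> h b /mapP[k _ ->]. Qed.

Lemma hochschild_values n (f : seq B -> R[i]) (x : 'I_n.+2 -> A) :
  exists2 t, size t = n &
  values x = rho (x ord0) :: rcons t (rho (x ord_max)) /\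
  hochschild (fun x => f (values x)) x =
    \sum_(i < n.+1) (-1) ^+ i * f (face i (values x))
    + (-1) ^+ n.+1 * f (rho (x ord_max) * rho (x ord0) :: t).
Proof.
have [t st [hx hl]] := values_ends x; exists t => //; split=> //.
rewrite /hochschild hl; congr (_ + _); apply: eq_bigr => i _.
by rewrite values_inner_face.
Qed.

End Values.
End Lists.

Section Rates.
Context {R : realType} {V : hilbert R}.

(** Decreasing sequences in [l^p], as comparison sequences for the approximation
    numbers. *)
Definition rate (p : nat) (r : nat -> R) :=
  [/\ forall n, 0 <= r n, forall m n, (m <= n)%N -> r n <= r m
    & exists Q, forall n, \sum_(i < n) r i ^+ p <= Q].

Definition summable_approx p (T : bop V) := exists2 s, rate p s &
  forall n, exists G, rank_le n G /\ opb (T - G) (s n).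

(** [(x + y) ^ p <= 2 ^ p (x ^ p + y ^ p)]. *)
Lemma rateD p (r s : nat -> R) : rate p r -> rate p s -> rate p (fun n => r n + s n).
Proof.
move=> [r0 rd [Q hQ]] [s0 sd [Q' hQ']]; split.
- by move=> n; rewrite addr_ge0.
- by move=> m n mn; rewrite lerD ?rd ?sd.
exists (2 ^+ p * (Q + Q')) => n.
apply: le_trans (_ : \sum_(i < n) 2 ^+ p * (r i ^+ p + s i ^+ p) <= _); last first.
  rewrite -mulr_sumr big_split /=; apply: ler_wpM2l; first by rewrite exprn_ge0.
  by apply: lerD; [exact: hQ|exact: hQ'].
apply: ler_sum => i _.
have [rs|sr] := leP (r i) (s i).
  apply: le_trans (_ : (2 * s i) ^+ p <= _).
    by rewrite lerXn2r ?nnegrE ?addr_ge0 ?mulr_ge0 //; lra.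
  by rewrite exprMn ler_wpM2l ?exprn_ge0 // lerDr exprn_ge0.
apply: le_trans (_ : (2 * r i) ^+ p <= _).
  by rewrite lerXn2r ?nnegrE ?addr_ge0 ?mulr_ge0 //; lra.
by rewrite exprMn ler_wpM2l ?exprn_ge0 // lerDl exprn_ge0.
Qed.

Lemma decay1_rate (r s : nat -> R) (T : bop V) : (forall n, r n <= s n) -> decay r 1 T -> decay s 1 T.
Proof.
move=> rs [M [C [C0 h]]]; exists M, C; split=> // n; have [G [rG bG]] := h n.
by exists G; split=> //; apply: opb_le bG _; rewrite !expr1 ler_wpM2l.
Qed.

(** Finitely many operators share a rate: add up their individual rates. *)
Lemma common_rate p (Ts : seq (bop V)) : (0 < p)%N ->
  {in Ts, forall T, summable_approx p T} ->
  exists2 r, rate p r & {in Ts, forall T, decay r 1 T}.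
Proof.
move=> p0; elim: Ts => [_|T Ts IH hTs].
  exists (fun=> 0) => //; split=> //; exists 0 => n.
  by rewrite big1 // => i _; rewrite expr0n eqn0Ngt p0.
have [|r hr hrT] := IH.
  by move=> S ST; apply: hTs; rewrite in_cons ST orbT.
have [s hs hsT] := hTs T (mem_head T Ts).
exists (fun n => r n + s n); first exact: rateD.
have [r0 _ _] := hr; have [s0 _ _] := hs.
move=> S; rewrite in_cons => /predU1P[->|/hrT]; last first.
  by apply: decay1_rate => n; rewrite lerDl.
apply: (decay1_rate (r := s)) => [n|]; first by rewrite lerDr.
exists 1%N, 1; split=> // n; have [G [rG bG]] := hsT n.
by exists G; rewrite mul1n mul1r expr1.
Qed.

End Rates.

(** * The trace cochain *)

Section CochainCriterion.
Context {R : realType} {V : hilbert R} {A : calgebra R} (rho : A -> bop V).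
Hypothesis rho_lin : linear rho.
Variable P : bop V -> Prop.
Hypothesis rhoP : forall a, P (rho a).

Lemma in_subst (Q : bop V -> Prop) l1 l2 a b a' : a' \in [:: a; b] ->
  {in l1 ++ a :: b :: l2, forall x, Q x} -> {in l1 ++ a' :: l2, forall x, Q x}.
Proof.
move=> ha h x hx; apply: h; move: hx; rewrite !mem_cat !in_cons.
case/or3P=> [->|/eqP->|->]; rewrite ?orbT //.
by move: ha; rewrite !in_cons in_nil orbF => /orP[]->; rewrite ?orbT.
Qed.

(** On the list of values, a substitution is a splicing and the cyclic shift is a
    rotation. *)
Lemma values_cyclic_cochain n (f : seq (bop V) -> R[i]) :
  (forall l1 l2 c a b, (size l1 + size l2)%N = n ->
     {in l1 ++ a :: b :: l2, forall x, P x} ->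
     f (l1 ++ (c *: a + b) :: l2) = c * f (l1 ++ a :: l2) + f (l1 ++ b :: l2)) ->
  (forall x s, size s = n -> {in x :: s, forall x, P x} ->
     f (x :: s) = (-1) ^+ n * f (rcons s x)) ->
  cyclic_cochain (fun x : 'I_n.+1 -> A => f (values rho x)).
Proof.
move=> f_lin f_cyc; split=> [x i c a b|x].
  rewrite !values_subst rho_lin; apply: f_lin.
    by rewrite size_take size_drop size_values ltn_ord; have := ltn_ord i; lia.
  move=> y; rewrite mem_cat !in_cons => /orP[/mem_take|/or3P[/eqP->|/eqP->|/mem_drop]] //.
    exact: values_in.
  exact: values_in.
rewrite values_shift values_cons rot1_cons; apply: f_cyc; first by rewrite size_mkseq.
by have := values_in (P := P) (x := x) (fun i => rhoP (x i)); rewrite values_cons.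
Qed.

End CochainCriterion.

Section TraceCochain.
Context {R : realType} {V : hilbert R}.
Variables (p : nat) (F e : bop V).
Hypothesis p0 : (0 < p)%N.
Hypothesis FF : F * F = 1.
Hypothesis Fe : F * e = - (e * F).
Implicit Types (a b x S T : bop V) (s t : seq (bop V)).

Definition admissible x := even e x /\ summable_approx p (dF F x).

(** The character, up to a constant: the leading factor is [dF] of the first
    argument, so that all arguments enter in the same way. *)
Definition tau s : R[i] := supertrace F e (fun T : bop V => trace T) (dprod F s).

Lemma dF_linear c a b : dF F (c *: a + b) = c *: dF F a + dF F b.
Proof. by rewrite dFD !dFE scalerBr -bop_scalerAl -bop_scalerAr. Qed.

Lemma dprod_cat s t : dprod F (s ++ t) = dprod F s * dprod F t.
Proof. by rewrite /dprod big_cat. Qed.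

Lemma dprod_linear l1 l2 c a b :
  dprod F (l1 ++ (c *: a + b) :: l2) =
  c *: dprod F (l1 ++ a :: l2) + dprod F (l1 ++ b :: l2).
Proof.
rewrite !dprod_cat !dprod_cons dF_linear mulrDl mulrDr.
by rewrite -bop_scalerAl -bop_scalerAr.
Qed.

Lemma admissible_rate s : {in s, forall x, admissible x} ->
  exists2 r, rate p r & {in s, forall x, regular F e (decay r) x}.
Proof.
move=> hs; have [|r hr h] := @common_rate _ _ p (map (dF F) s) p0.
  by move=> _ /mapP[x /hs[_ h] ->].
exists r => // x xs; split; first by case: (hs x xs).
by apply: h; exact: map_f.
Qed.

Section Rate.
Variable r : nat -> R.
Hypothesis hr : rate p r.

Let r_ge0 : forall n, 0 <= r n. Proof. by case: hr. Qed.
Let r_dec : forall m n, (m <= n)%N -> r n <= r m. Proof. by case: hr. Qed.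

Lemma rate_traceD S T : decay r p S -> decay r p T -> trace (S + T) = trace S + trace T.
Proof. by case: hr => _ _ [Q hQ]; exact: decay_traceD. Qed.

Lemma rate_traceZ c T : decay r p T -> trace (c *: T) = c * trace T.
Proof. by case: hr => _ _ [Q hQ]; exact: decay_traceZ. Qed.

Lemma rate_traceC S T : decay r p S -> trace (S * T) = trace (T * S).
Proof. by case: hr => _ _ [Q hQ]; exact: decay_traceC. Qed.

Lemma decay_wl k S T : decay r k T -> decay r k (S * T).
Proof. by move=> hT; apply: (@decayM _ _ _ 0 k) => //; exact: decay_any. Qed.

Lemma decay_wr k S T : decay r k S -> decay r k (S * T).
Proof. by move=> hS; rewrite -[k]addn0; apply: decayM => //; exact: decay_any. Qed.

Lemma rate_supertrace_linear c S T0 : decay r p S -> decay r p T0 ->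
  supertrace F e (fun T : bop V => trace T) (c *: S + T0) =
  c * supertrace F e (fun T : bop V => trace T) S + supertrace F e (fun T : bop V => trace T) T0.
Proof.
move=> hS hT; rewrite /supertrace mulrDr -bop_scalerAr rate_traceD ?rate_traceZ //; last exact: decay_wl.
- exact: decay_wl.
- by apply: decayZ; exact: decay_wl.
Qed.

Lemma rate_supertraceD S T0 : decay r p S -> decay r p T0 ->
  supertrace F e (fun T : bop V => trace T) (S + T0) =
  supertrace F e (fun T : bop V => trace T) S + supertrace F e (fun T : bop V => trace T) T0.
Proof. by move=> hS hT; rewrite -[S in S + _]scale1r rate_supertrace_linear // mul1r. Qed.

Lemma rate_supertraceB S T0 : decay r p S -> decay r p T0 ->
  supertrace F e (fun T : bop V => trace T) (S - T0) =
  supertrace F e (fun T : bop V => trace T) S - supertrace F e (fun T : bop V => trace T) T0.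
Proof. by move=> hS hT; rewrite addrC -scaleN1r rate_supertrace_linear // mulN1r addrC. Qed.

Lemma dprod_regular k s : (k <= size s)%N -> {in s, forall x, regular F e (decay r) x} ->
  decay r k (dprod F s).
Proof.
move=> ks hs; apply: decayW ks _ => //; apply: dprod_decay hs; first exact: decay_any.
by move=> *; exact: decayM.
Qed.

Lemma insertions_regular k y s : (k <= size s)%N -> {in s, forall x, regular F e (decay r) x} ->
  decay r k (insertions F y s).
Proof.
move=> ks hs; apply: decayW ks _ => //; apply: insertions_decay hs; first exact: decay_any.
- by move=> *; exact: decayD.
- by move=> *; exact: decayN.
- by move=> *; exact: decayM.
Qed.

End Rate.

Lemma tau_linear l1 l2 c a b : (p <= size l1 + size l2)%N ->
  {in l1 ++ a :: b :: l2, forall x, admissible x} ->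
  tau (l1 ++ (c *: a + b) :: l2) = c * tau (l1 ++ a :: l2) + tau (l1 ++ b :: l2).
Proof.
move=> pl /admissible_rate[r hr hJ].
have h a' : {in l1 ++ a :: b :: l2, forall x, regular F e (decay r) x} -> a' \in [:: a; b] ->
    decay r p (dprod F (l1 ++ a' :: l2)).
  move=> h ha; apply: (dprod_regular hr); first by rewrite size_cat /= addnS leqW.
  exact: in_subst ha h.
rewrite /tau -(rate_supertrace_linear hr); [|apply: h => //; rewrite !in_cons eqxx ?orbT //..].
by rewrite -dprod_linear.
Qed.

Lemma tau_cyclic x s : (p <= size s)%N -> {in x :: s, forall x, admissible x} ->
  tau (x :: s) = tau (rcons s x).
Proof.
move=> ps /admissible_rate[r hr hJ]; have [r0 rd _] := hr.
have [xe _] := hJ x (mem_head x s).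
rewrite /tau dprod_cons dprod_rcons (@supertrace_cyclic _ _ _ FF Fe _ p (decay r)) //.
- exact: decay_any.
- by move=> *; exact: decayM.
- by move=> *; exact: (rate_traceC hr).
- by apply: (dprod_regular hr) => // y ys; apply: hJ; rewrite in_cons ys orbT.
Qed.

Section Cocycle.
Context {A : calgebra R} (rho : A -> bop V).
Hypothesis rho_lin : linear rho.
Hypothesis rhoM : forall a b : A, rho (amul a b) = rho a * rho b.
Hypothesis rho_adm : forall a : A, admissible (rho a).

Lemma tau_cyclic_cocycle n : (p <= n)%N -> ~~ odd n ->
  cyclic_cocycle (fun x : 'I_n.+1 -> A => tau (values rho x)).
Proof.
move=> pn on; have sgn1 : (-1) ^+ n = 1 :> R[i] by rewrite -signr_odd (negbTE on).
split.
  apply: (values_cyclic_cochain rho_lin rho_adm) => [l1 l2 c a b st hl|x s st hs].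
    by apply: tau_linear; rewrite ?st.
  by rewrite sgn1 mul1r; apply: tau_cyclic; rewrite ?st.
move=> x; have [t st [hx ->]] := hochschild_values rhoM tau x.
have : {in values rho x, forall b, admissible b} by exact: values_in.
rewrite hx => /admissible_rate[r hr hJ]; have [r0 rd _] := hr.
rewrite exprS sgn1 mulr1 mulN1r {sgn1}; subst n.
apply: (@supertrace_dprod_cocycle _ _ _ FF Fe _ p (decay r)) => //.
- exact: decay_any.
- by move=> *; exact: decayD.
- by move=> *; exact: decayN.
- by move=> *; exact: decayM.
- by move=> k l y lk; exact: (decayW r0 rd lk).
- by move=> *; exact: (rate_traceD hr).
- by move=> *; exact: (rate_traceC hr).
- by move=> *; exact: decay_0.
Qed.

End Cocycle.
End TraceCochain.

(** * Comparing two close Fredholm operators *)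

Section ComplexIntegralSums.
Context {R : realType}.
Implicit Types f g : R -> R[i].

Lemma cintegral01_eq f g : (forall s, unit_itv s -> f s = g s) -> cintegral01 f = cintegral01 g.
Proof.
move=> fg; apply/eqP; rewrite eq_complex /= /integral01; apply/andP; split; apply/eqP;
  by apply: eq_Rintegral => s; rewrite inE /= in_itv /= => /fg ->.
Qed.

Lemma clipschitz01_sum n (c : 'I_n -> R[i]) (f : 'I_n -> R -> R[i]) :
  (forall i, clipschitz01 (f i)) -> clipschitz01 (fun s => \sum_i c i * f i s).
Proof.
elim: n c f => [|n IHn] c f hf.
  by exists 0 => s t _ _; rewrite !big_ord0 subrr cm0 mul0r.
under eq_fun do rewrite big_ord_recr /=.
apply: clipschitz01D; last exact: clipschitz01Z.
by apply: (IHn _ (fun i s => f (widen_ord (leqnSn n) i) s)).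
Qed.

Lemma cintegral01_sum n (c : 'I_n -> R[i]) (f : 'I_n -> R -> R[i]) :
  (forall i, clipschitz01 (f i)) ->
  cintegral01 (fun s => \sum_i c i * f i s) = \sum_i c i * cintegral01 (f i).
Proof.
elim: n c f => [|n IHn] c f hf.
  rewrite big_ord0 -[RHS](mul0r (cintegral01 (fun=> 0))) -cintegral01Z.
    by apply: cintegral01_eq => s _; rewrite big_ord0 mul0r.
  by exists 0 => s t _ _; rewrite subrr cm0 mul0r.
under eq_fun do rewrite big_ord_recr /=.
rewrite cintegral01D; [|exact: clipschitz01_sum|exact: clipschitz01Z].
by rewrite big_ord_recr /= cintegral01Z // (IHn _ (fun i s => f (widen_ord (leqnSn n) i) s)).
Qed.

End ComplexIntegralSums.

Section ClosePair.
Context {R : realType} {V : hilbert R}.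
Variables (p : nat) (e F0 F1 : bop V).
Hypothesis p0 : (0 < p)%N.
Hypothesis p_even : ~~ odd p.
Hypothesis FF0 : F0 * F0 = 1.
Hypothesis Fe0 : F0 * e = - (e * F0).
Hypothesis FF1 : F1 * F1 = 1.
Hypothesis Fe1 : F1 * e = - (e * F1).
Hypothesis F01 : opb ((F1 - F0) * F0) 1.
Implicit Types (a b x y S T : bop V) (l : seq (bop V)) (s t : R).

Let v : bop V := 2^-1 *: (F1 * F0 - 1).

(** The bound that makes [1 + s v] invertible. *)
Lemma half_opb s : unit_itv s -> opb (s%:C *: v) 2^-1.
Proof.
move=> /andP[s0 s1]; have -> : v = 2^-1 *: ((F1 - F0) * F0) by rewrite mulrBl FF0.
rewrite scalerA; apply: opb_le (opbZ _ F01) _.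
rewrite mulr1 (_ : 2^-1 = (2^-1 : R)%:C :> R[i]); last by rewrite fmorphV rmorph_nat.
by rewrite cmM !cm_real !ger0_norm // ler_piMl.
Qed.

Lemma path_inverse : exists w : R -> bop V, [/\
  forall s, unit_itv s -> w s * (1 + s%:C *: v) = 1,
  forall s, unit_itv s -> (1 + s%:C *: v) * w s = 1
  & forall s, unit_itv s -> opb (w s) 2].
Proof.
have /boolp.choice[w hw] : forall s, exists w, unit_itv s ->
    [/\ w * (1 + s%:C *: v) = 1, (1 + s%:C *: v) * w = 1 & opb w 2].
  move=> s; have [hs|ns] := pselect (unit_itv s); last by exists 0.
  by have [w hw] := Neumann_inverse (half_opb hs); exists w.
by exists w; split=> s /hw[].
Qed.

Lemma gen_even : even e v.
Proof.
have h : F1 * F0 * e = e * (F1 * F0) by rewrite -mulrA Fe0 mulrN (mulrA F1) Fe1 mulNr opprK -mulrA.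
by rewrite /even /v -bop_scalerAl -bop_scalerAr mulrBl mulrBr mul1r mulr1 h.
Qed.

(** The operator [1 + v] is the average of [1] and [F1 * F0]; multiplying it by
    [F1] on the left or by [F0] on the right exchanges the two terms. *)
Lemma gen_intertwines : F1 * (1 + v) = (1 + v) * F0.
Proof.
have -> : 1 + v = 2^-1 *: (1 + F1 * F0).
  pose o : bop V := 1; have e1 : o = 2^-1 *: o + 2^-1 *: o.
    by rewrite -scalerDl -[2^-1]div1r -splitr scale1r.
  by rewrite -/o {1}e1 /v -/o -addrA -scalerDr [X in _ + _ *: X]addrC subrK -scalerDr.
rewrite -bop_scalerAl -bop_scalerAr mulrDl mulrDr mulr1 mul1r mulrA FF1 mul1r.
by rewrite -mulrA FF0 mulr1 addrC.
Qed.

(** The reason why [v] almost commutes with the representation. *)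
Lemma commutator_gen a : a * v - v * a = - (2^-1 *: (dF F1 a * F0 + F1 * dF F0 a)).
Proof.
rewrite /v -bop_scalerAl -bop_scalerAr -scalerBr -scalerN; congr (_ *: _).
rewrite !dFE; ncring.
Qed.

Definition path_entry r x :=
  [/\ even e x, path_adapted r F0 v x & decay r 1 (dF F1 x)].

Definition biadmissible x := admissible p F0 e x /\ admissible p F1 e x.

Lemma biadmissible_rate l : {in l, forall x, biadmissible x} ->
  exists2 r, rate p r &
  {in l, forall x, path_entry r x}.
Proof.
move=> hl; have [|r hr h] := @common_rate _ _ p (map (dF F0) l ++ map (dF F1) l) p0.
  by move=> T; rewrite mem_cat => /orP[]/mapP[x /hl[[_ h] [_ h']]] ->.
have [r0 rd _] := hr.
exists r => // x xl; have [[xe _] _] := hl x xl.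
have c0 : decay r 1 (dF F0 x) by apply: h; rewrite mem_cat map_f.
have c1 : decay r 1 (dF F1 x) by apply: h; rewrite mem_cat map_f ?orbT.
split=> //; split=> //; rewrite commutator_gen; apply/decayN/decayZ/decayD.
  exact: decay_wr.
exact: decay_wl.
Qed.

Lemma path_entryM r a b : path_entry r a -> path_entry r b -> path_entry r (a * b).
Proof.
move=> [ae [a0 av] a1] [be [b0 bv] b1]; split; first exact: evenM.
  split; first by rewrite dFM; apply: decayD; [exact: decay_wr|exact: decay_wl].
  have -> : a * b * v - v * (a * b) = a * (b * v - v * b) + (a * v - v * a) * b by ncring.
  by apply: decayD; [exact: decay_wl|exact: decay_wr].
by rewrite dFM; apply: decayD; [exact: decay_wr|exact: decay_wl].
Qed.

Variable w : R -> bop V.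
Hypothesis wl : forall s, unit_itv s -> w s * (1 + s%:C *: v) = 1.
Hypothesis wr : forall s, unit_itv s -> (1 + s%:C *: v) * w s = 1.
Hypothesis w2 : forall s, unit_itv s -> opb (w s) 2.

Let tr (T : bop V) : R[i] := trace T.
Let pc := path_conj v w.
Let pg := path_gen v w.

Lemma path_conjM s a b : unit_itv s -> pc s (a * b) = pc s a * pc s b.
Proof.
move=> hs; rewrite /pc /path_conj -[RHS]mulrA.
rewrite -(mulrA (w s) b) (mulrA (1 + s%:C *: v) (w s)) wr // mul1r !mulrA.
by [].
Qed.

Lemma path_conj_linear s c a b : pc s (c *: a + b) = c *: pc s a + pc s b.
Proof. by rewrite /pc /path_conj (mulrDr (w s)) mulrDl -bop_scalerAr -bop_scalerAl. Qed.

Lemma map_path_face s i l : unit_itv s -> map (pc s) (face i l) = face i (map (pc s) l).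
Proof. by move=> hs; apply: map_face => a b; exact: path_conjM. Qed.

Lemma itv0 : unit_itv (0 : R). Proof. by rewrite /unit_itv lexx ler01. Qed.
Lemma itv1 : unit_itv (1 : R). Proof. by rewrite /unit_itv lexx ler01. Qed.

Lemma path_conj0 l : map (pc 0) l = l.
Proof.
rewrite -[RHS]map_id; apply: eq_map => a; rewrite /pc (path_conjE wl _ itv0).
by rewrite scale0r addr0.
Qed.

Lemma dF_path_conj1 a : dF F1 a = (1 + v) * dF F0 (pc 1 a) * w 1.
Proof.
have u1 : 1 + v = 1 + 1%:C *: v by rewrite scale1r.
have wl1 : w 1 * (1 + v) = 1 by rewrite u1 wl // itv1.
have wr1 : (1 + v) * w 1 = 1 by rewrite u1 wr // itv1.
have wF : w 1 * F1 = F0 * w 1.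
  rewrite -[LHS]mulr1 -wr1 mulrA -(mulrA (w 1)) gen_intertwines.
  by rewrite !mulrA wl1 mul1r.
have aE : a = (1 + v) * pc 1 a * w 1.
  by rewrite /pc /path_conj -u1 !mulrA wr1 mul1r -mulrA wr1 mulr1.
rewrite {1}aE !dFE; move: (pc 1 a) => b.
rewrite mulrBr mulrBl !mulrA gen_intertwines; congr (_ - _).
by rewrite -!mulrA wF.
Qed.

Lemma dprod_path_conj1 l :
  dprod F1 l = (1 + v) * dprod F0 (map (pc 1) l) * w 1.
Proof.
have u1 : 1 + v = 1 + 1%:C *: v by rewrite scale1r.
have wl1 : w 1 * (1 + v) = 1 by rewrite u1 wl // itv1.
have wr1 : (1 + v) * w 1 = 1 by rewrite u1 wr // itv1.
elim: l => [|a l IHl]; first by rewrite !dprod_nil mulr1 wr1.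
rewrite map_cons !dprod_cons IHl dF_path_conj1 !mulrA; congr (_ * _ * _).
by rewrite -(mulrA _ (w 1)) wl1 mulr1.
Qed.

Section AtRate.
Variable r : nat -> R.
Hypothesis hr : rate p r.
Variable l : seq (bop V).
Hypothesis hl : {in l, forall x, path_entry r x}.

Let r_ge0 : forall n, 0 <= r n. Proof. by case: hr. Qed.
Let r_dec : forall m n, (m <= n)%N -> r n <= r m. Proof. by case: hr. Qed.

Lemma path_regular s : unit_itv s -> {in map (pc s) l, forall x, regular F0 e (decay r) x}.
Proof.
move=> hs _ /mapP[x /hl[xe xa _] ->]; split.
  exact: (path_conj_even gen_even wl wr).
exact: (path_conj_decay wl).
Qed.

Let l_adapted : {in l, forall x, path_adapted r F0 v x}.
Proof. by move=> x /hl[]. Qed.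

(** [F1] is the conjugate of [F0] by [1 + v], the grading commutes with [1 + v],
    and the trace is invariant under conjugation. *)
Lemma tau_path1 : (p <= size l)%N -> tau F1 e l = tau F0 e (map (pc 1) l).
Proof.
move=> pl; have u1 : 1 + v = 1 + 1%:C *: v by rewrite scale1r.
have wl1 : w 1 * (1 + v) = 1 by rewrite u1 wl // itv1.
have ue : (1 + v) * e = e * (1 + v).
  by rewrite mulrDl mulrDr mul1r mulr1 gen_even.
set D := dprod F0 (map (pc 1) l).
have cD : decay r p D.
  by apply: (dprod_regular hr (e := e)); [rewrite size_map|apply: path_regular; exact: itv1].
have E : e * F1 * dprod F1 l = (1 + v) * (e * F0 * D) * w 1.
  rewrite dprod_path_conj1 -/D !mulrA -(mulrA e) gen_intertwines mulrA -ue.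
  by [].
rewrite /tau /supertrace E (rate_traceC hr); last by do 2!apply: decay_wl.
by rewrite mulrA wl1 mul1r.
Qed.

(** The inserted cochain without the insertion in the first position: the first
    and the last position have the same trace, so keeping both would spoil the
    cyclic symmetry. *)
Definition sigma s := supertrace F0 e tr (insertions F0 (pg s) (map (pc s) l)) -
  supertrace F0 e tr (dF F0 (pg s) * dprod F0 (map (pc s) l)).

Lemma sigma_lipschitz : (p <= size l)%N -> clipschitz01 sigma.
Proof.
move=> pl; have [_ _ [Q hQ]] := hr.
have l1 := lip_mull r_ge0 (e * F0) (insertions_lip r_ge0 wl wr w2 l_adapted).
have l2 := lip_mull r_ge0 (e * F0) (dprod_gen_lip r_ge0 wl wr w2 l_adapted).
have c1 : clipschitz01 (fun s => supertrace F0 e tr (insertions F0 (pg s) (map (pc s) l))).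
  exact: (lip_trace r_ge0 r_dec hQ pl l1).
have c2 : clipschitz01 (fun s => supertrace F0 e tr (dF F0 (pg s) * dprod F0 (map (pc s) l))).
  exact: (lip_trace r_ge0 r_dec hQ pl l2).
rewrite (_ : sigma = (fun s => supertrace F0 e tr (insertions F0 (pg s) (map (pc s) l)) +
  -1 * supertrace F0 e tr (dF F0 (pg s) * dprod F0 (map (pc s) l)))).
  by apply: clipschitz01D => //; exact: clipschitz01Z.
by apply/funext => s; rewrite mulN1r.
Qed.

Lemma tau_variation : (p <= size l)%N ->
  cintegral01 (fun s => supertrace F0 e tr (dprod_inner F0 (pg s) (map (pc s) l))) =
  tau F1 e l - tau F0 e l.
Proof.
move=> pl; have [_ _ [Q hQ]] := hr.
have dd := dprod_diff r_ge0 wl wr w2 l_adapted.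
have dc : diff r 0 (fun=> e * F0) (fun=> 0) by apply: diff_const => //; exact: decay_any.
have dT := diffM dc dd.
have [_ lT _] := dT.
have t0 : tau F0 e l = tau F0 e (map (pc 0) l) by rewrite path_conj0.
rewrite tau_path1 // t0.
have eT : forall s, trace (0 * dprod F0 (map (path_conj v w s) l) +
    e * F0 * dprod_inner F0 (path_gen v w s) (map (path_conj v w s) l)) =
    supertrace F0 e tr (dprod_inner F0 (pg s) (map (pc s) l)).
  by move=> s; rewrite mul0r add0r.
apply: (@cintegral01_FTC _ (fun s => tau F0 e (map (pc s) l))).
  have [K hK] := lip_trace r_ge0 r_dec hQ pl lT; exists K => s t hs ht.
  by have := hK s t hs ht; rewrite !eT.
have [K hK] := diff_trace r_ge0 r_dec hQ pl dT; exists K => s t hs ht.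
by have := hK s t hs ht; rewrite eT.
Qed.

End AtRate.

Lemma insertions_linear (F y : bop V) l1 l2 c a b :
  insertions F y (l1 ++ (c *: a + b) :: l2) =
  c *: insertions F y (l1 ++ a :: l2) + insertions F y (l1 ++ b :: l2).
Proof.
have dlin l := dprod_linear F l l2 c a b.
elim: l1 => [|z l1 IHl] /=.
  have /= -> := dlin [::]; rewrite dF_linear mulrDl mulrDr -bop_scalerAl -bop_scalerAr.
  by rewrite scalerBr; zmod.
have /= -> := dlin (z :: l1); rewrite IHl !mulrDr -!bop_scalerAr scalerBr; zmod.
Qed.

Definition transgression l : R[i] := - cintegral01 (sigma l).

Lemma transgression_linear l1 l2 c a b : (p <= size l1 + size l2)%N ->
  {in l1 ++ a :: b :: l2, forall x, biadmissible x} ->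
  transgression (l1 ++ (c *: a + b) :: l2) =
  c * transgression (l1 ++ a :: l2) + transgression (l1 ++ b :: l2).
Proof.
move=> pl /biadmissible_rate[r hr hl]; have [r0 rd _] := hr.
have ha := in_subst (mem_head a [:: b]) hl.
have hb := in_subst (a' := b) (b := b) (a := a) _ hl.
have {}hb := hb ltac:(by rewrite !in_cons eqxx orbT).
have sz x : (p <= size (l1 ++ x :: l2))%N by rewrite size_cat /= addnS leqW.
rewrite /transgression mulrN -opprD; congr (- _).
rewrite -(cintegral01Z _ (sigma_lipschitz hr ha (sz a))) -cintegral01D; first last.
- exact: (sigma_lipschitz hr hb (sz b)).
- exact/clipschitz01Z/(sigma_lipschitz hr ha (sz a)).
apply: cintegral01_eq => s hs.
rewrite /sigma !map_cat !map_cons path_conj_linear insertions_linear dprod_linear.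
have Ja := path_regular ha hs; have Jb := path_regular hb hs.
rewrite !map_cat !map_cons in Ja Jb.
have sz' x : (p <= size (map (pc s) l1 ++ pc s x :: map (pc s) l2))%N.
  by rewrite -map_cons -map_cat size_map.
rewrite mulrDr -bop_scalerAr !(rate_supertrace_linear F0 e hr).
- by rewrite mulrBr; ring.
- by apply: decay_wl; apply: (dprod_regular hr (sz' a) Ja).
- by apply: decay_wl; apply: (dprod_regular hr (sz' b) Jb).
- exact: (insertions_regular hr _ (sz' a) Ja).
- exact: (insertions_regular hr _ (sz' b) Jb).
Qed.

(** Moving the first entry to the end shifts every insertion by one position,
    hence changes its sign. *)
Lemma transgression_cyclic x l : (p <= size l)%N -> odd (size l) ->
  {in x :: l, forall x, biadmissible x} ->
  transgression (x :: l) = - transgression (rcons l x).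
Proof.
move=> pl ol /biadmissible_rate[r hr hl]; have [r0 rd _] := hr.
have hl' : {in rcons l x, forall x, path_entry r x}.
  by move=> y; rewrite mem_rcons; exact: hl.
suff E : cintegral01 (sigma (x :: l)) = -1 * cintegral01 (sigma (rcons l x)).
  by rewrite /transgression E mulN1r.
rewrite -(cintegral01Z _ (sigma_lipschitz hr hl' _)) ?size_rcons ?leqW //.
apply: cintegral01_eq => s hs.
have Jx := path_regular hl hs; rewrite map_cons in Jx.
have [xe _] := Jx _ (mem_head _ _).
rewrite /sigma map_rcons map_cons insertions_rcons [insertions F0 _ (_ :: _)]/=.
move: (pc s x) (map (pc s) l) (size_map (pc s) l) xe Jx => x' l' sl xe Jx.
have Jl : {in l', forall x, regular F0 e (decay r) x}.
  by move=> y yl; apply: Jx; rewrite in_cons yl orbT.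
have ye : even e (pg s) := path_gen_even gen_even wl wr hs.
have cI : decay r p (insertions F0 (pg s) l') by apply: (insertions_regular hr) Jl; rewrite sl.
have cD : decay r p (dprod F0 l') by apply: (dprod_regular hr) Jl; rewrite sl.
have cDr : decay r p (dprod F0 (rcons l' x')) by rewrite dprod_rcons; exact: decay_wr.
have cDx : decay r p (dprod F0 (x' :: l')) by rewrite dprod_cons; exact: decay_wl.
have Tcyc a b : even e a -> decay r p b -> supertrace F0 e tr (dF F0 a * b) = supertrace F0 e tr (b * dF F0 a).
  move=> ae cb; apply: (supertrace_cyclic FF0 Fe0 _ _ _ ae cb); first exact: decay_any.
    by move=> *; exact: decayM.
  by move=> *; exact: (rate_traceC hr).
rewrite even_sg ?mulr1; last by rewrite /= negbK sl.
rewrite (rate_supertraceB _ _ hr); [|exact: decay_wl|exact: decay_wl].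
rewrite (rate_supertraceD _ _ hr); [|exact: decay_wr|exact: decay_wr].
by rewrite (Tcyc _ _ xe cI) -(Tcyc _ _ ye cDr); ring.
Qed.

Section Cochain.
Context {A : calgebra R} (rho : A -> bop V).
Hypothesis rho_lin : linear rho.
Hypothesis rhoM : forall a b : A, rho (amul a b) = rho a * rho b.
Hypothesis rho_adm : forall a : A, biadmissible (rho a).

Lemma transgression_cyclic_cochain :
  cyclic_cochain (fun x : 'I_p.+2 -> A => transgression (values rho x)).
Proof.
have sgn : (-1) ^+ p.+1 = -1 :> R[i] by rewrite exprS -signr_odd (negbTE p_even) mulr1.
apply: (values_cyclic_cochain rho_lin rho_adm) => [l1 l2 c a b st hl|x s st hs].
  by apply: transgression_linear; rewrite ?st.
by rewrite sgn mulN1r; apply: transgression_cyclic; rewrite ?st.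
Qed.

(** The homotopy formula, integrated along the path of representations. *)
Lemma transgression_hochschild (x : 'I_p.+3 -> A) :
  hochschild (fun x : 'I_p.+2 -> A => transgression (values rho x)) x =
  tau F1 e (values rho x) - tau F0 e (values rho x).
Proof.
have [t st [hx ->]] := hochschild_values rhoM transgression x.
have sgn : (-1) ^+ p.+2 = 1 :> R[i] by rewrite -signr_odd /= negbK (negbTE p_even).
have hJ : {in values rho x, forall b, biadmissible b} by exact: values_in.
rewrite {}sgn mul1r; move: hx hJ.
move: (rho (x ord0)) (rho (x ord_max)) (values rho x) => x0 z l.
rewrite /transgression.
have -> : p.+2 = (size t).+1 by rewrite st.
move=> lE /biadmissible_rate[r hr hl]; have [r0 rd _] := hr.
have sl : size l = (size t).+2 by rewrite lE /= size_rcons.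
have hface i : {in face i l, forall x, path_entry r x}.
  by apply: face_in hl; exact: path_entryM.
have hlast : {in z * x0 :: t, forall x, path_entry r x}.
  move=> y; rewrite in_cons => /predU1P[->|yt].
    by apply: path_entryM; apply: hl; rewrite lE ?mem_head // in_cons mem_rcons mem_head orbT.
  by apply: hl; rewrite lE in_cons mem_rcons in_cons yt !orbT.
have pt : (p <= size t)%N by rewrite st.
have lip_face (i : 'I_(size t).+1) : clipschitz01 (sigma (face i l)).
  by apply: (sigma_lipschitz hr (hface i)); rewrite size_face sl //= leqW.
have lip_last : clipschitz01 (sigma (z * x0 :: t)).
  by apply: (sigma_lipschitz hr hlast); rewrite /= leqW.
rewrite -(tau_variation hr hl); last by rewrite sl !leqW.
under eq_bigr do rewrite mulrN.
rewrite sumrN -opprD -cintegral01_sum // -cintegral01D //; last exact: clipschitz01_sum.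
have lf := clipschitz01D (clipschitz01_sum (fun i => (-1) ^+ i) lip_face) lip_last.
rewrite -[LHS]mulN1r -(cintegral01Z _ lf).
apply: cintegral01_eq => s hs.
have Jl := path_regular hl hs.
under eq_bigr do rewrite /sigma map_path_face //.
rewrite /sigma /= path_conjM //; move: Jl; rewrite lE /= map_rcons.
move: (pc s x0) (pc s z) => x0' z' Jl.
have ye : even e (pg s) := path_gen_even gen_even wl wr hs.
have := @supertrace_insertions_coboundary _ _ _ FF0 Fe0 _ p (decay r) tr _ _ _ _ _ _ _ _
  (pg s) x0' (map (pc s) t) z' ye.
rewrite size_map => ->; first by rewrite mulN1r opprK.
all: try by [].
- exact: decay_any.
- by move=> *; exact: decayD.
- by move=> *; exact: decayN.
- by move=> *; exact: decayM.
- by move=> k l' y lk; exact: (decayW r0 rd lk).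
- by move=> *; exact: (rate_traceD hr).
- by move=> *; exact: (rate_traceC hr).
- by move=> *; exact: decay_0.
- by rewrite st /= p_even.
Qed.

End Cochain.
End ClosePair.

(** * Cohomologous cochains *)

Section Cohomologous.
Context {R : realType} {A : calgebra R}.
Implicit Types n : nat.

Lemma cyclic_cochain_lin n c (f g : cochain A n) : cyclic_cochain f -> cyclic_cochain g ->
  cyclic_cochain (fun x => c * f x + g x).
Proof.
move=> [fl fc] [gl gc]; split=> [x i z a b|x].
  by rewrite fl gl; ring.
by rewrite fc gc; ring.
Qed.

Lemma cyclic_cochain0 n : @cyclic_cochain R A n (fun=> 0).
Proof. by split=> [x i z a b|x]; rewrite mulr0 ?addr0. Qed.

Lemma hochschild_lin n c (f g : cochain A n) x :
  hochschild (fun x => c * f x + g x) x = c * hochschild f x + hochschild g x.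
Proof.
rewrite /hochschild [X in _ = X + _]mulrDr [RHS]addrACA mulr_sumr -big_split /=; congr (_ + _); last by ring.
by apply: eq_bigr => i _; ring.
Qed.

Lemma hochschild0 n (x : 'I_n.+2 -> A) : hochschild (fun=> 0 : R[i]) x = 0.
Proof. by rewrite /hochschild mulr0 addr0 big1 // => i _; rewrite mulr0. Qed.

Lemma cyclic_cocycle_lin n c (f g : cochain A n) : cyclic_cocycle f -> cyclic_cocycle g ->
  cyclic_cocycle (fun x => c * f x + g x).
Proof.
move=> [fc f0] [gc g0]; split=> [|x]; first exact: cyclic_cochain_lin.
by rewrite hochschild_lin f0 g0 mulr0 addr0.
Qed.

Lemma cyclic_cocycle0 n : @cyclic_cocycle R A n (fun=> 0).
Proof. by split=> [|x]; [exact: cyclic_cochain0|exact: hochschild0]. Qed.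

Definition cohomologous n (f g : cochain A n.+1) := exists2 psi : cochain A n,
  cyclic_cochain psi & forall x, f x - g x = hochschild psi x.

Lemma cohomologous_refl n (f : cochain A n.+1) : cohomologous f f.
Proof.
by exists (fun=> 0) => [|x]; [exact: cyclic_cochain0|rewrite hochschild0 subrr].
Qed.

Lemma cohomologous_lin n c (f f' g g' : cochain A n.+1) :
  cohomologous f f' -> cohomologous g g' ->
  cohomologous (fun x => c * f x + g x) (fun x => c * f' x + g' x).
Proof.
move=> [psi hpsi fE] [phi hphi gE]; exists (fun x => c * psi x + phi x) => [|x].
  exact: cyclic_cochain_lin.
by rewrite hochschild_lin -fE -gE; ring.
Qed.

Lemma cohomologous_trans n (g f h : cochain A n.+1) :
  cohomologous f g -> cohomologous g h -> cohomologous f h.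
Proof.
move=> [psi hpsi fE] [phi hphi gE]; exists (fun x => 1 * psi x + phi x) => [|x].
  exact: cyclic_cochain_lin.
by rewrite hochschild_lin -fE -gE; ring.
Qed.

Lemma cohomology_class_eq n (f g : cochain A n.+1) : cohomologous f g ->
  cohomology_class f = cohomology_class g.
Proof.
move=> [psi hpsi fE]; apply/seteqP; split=> h /= [_ [phi hphi <-] <-].
  exists (hochschild (fun x => 1 * psi x + phi x)).
    by exists (fun x => 1 * psi x + phi x) => //; exact: cyclic_cochain_lin.
  by apply/funext => x; rewrite hochschild_lin -fE; ring.
exists (hochschild (fun x => -1 * psi x + phi x)).
  by exists (fun x => -1 * psi x + phi x) => //; exact: cyclic_cochain_lin.
by apply/funext => x; rewrite hochschild_lin -fE; ring.
Qed.

End Cohomologous.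

Section Chain.
Context {R : realType} {V : hilbert R} {A : calgebra R}.
Variables (p : nat) (e : bop V) (F : R -> bop V) (rho : A -> bop V).
Hypothesis p0 : (0 < p)%N.
Hypothesis p_even : ~~ odd p.
Hypothesis FF : forall t, unit_itv t -> F t * F t = 1.
Hypothesis Fe : forall t, unit_itv t -> F t * e = - (e * F t).
Hypothesis rho_lin : linear rho.
Hypothesis rhoM : forall a b : A, rho (amul a b) = rho a * rho b.
Hypothesis rho_adm : forall t (a : A), unit_itv t -> admissible p (F t) e (rho a).
Variable C : R.
Hypothesis F_lip : forall s t, unit_itv s -> unit_itv t -> opb (F t - F s) (C * `|t - s|).

Definition tau_cochain t : cochain A p.+2 := fun x => tau (F t) e (values rho x).

Lemma tau_close s t : unit_itv s -> unit_itv t -> opb ((F t - F s) * F s) 1 ->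
  cohomologous (tau_cochain t) (tau_cochain s).
Proof.
move=> hs ht hst.
have [w [wl wr w2]] := path_inverse (FF hs) hst.
have adm a : biadmissible p e (F s) (F t) (rho a) by split; apply: rho_adm.
exists (fun x => transgression e (F s) (F t) w (values rho x)).
  exact: (transgression_cyclic_cochain p0 p_even (FF hs) (Fe hs) (Fe ht) wl wr w2 rho_lin adm).
move=> x; symmetry.
exact: (transgression_hochschild p0 p_even (FF hs) (Fe hs) (FF ht) (Fe ht) wl wr w2 rhoM adm).
Qed.

(** Consecutive points of a fine enough subdivision are close in norm. *)
Lemma tau_cohomologous s t : unit_itv s -> unit_itv t ->
  cohomologous (tau_cochain t) (tau_cochain s).
Proof.
move=> hs ht.
have [M0 hM0] := opb_exists (F 0); have M00 : 0 <= M0 by case: hM0.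
have F_bounded u : unit_itv u -> opb (F u) (M0 + `|C|).
  move=> hu; have -> : F u = F 0 + (F u - F 0) by rewrite addrC subrK.
  apply: (opbD hM0); apply: opb_le (F_lip itv0 hu) _.
  move: hu => /andP[u0 u1]; rewrite subr0 ger0_norm //.
  by apply: le_trans (ler_wpM2r u0 (ler_norm C)) _; rewrite ler_piMr.
pose N := (Num.bound (`|C| * (M0 + `|C|))).+1.
have hN : `|C| * (M0 + `|C|) <= N%:R.
  have h : 0 <= `|C| * (M0 + `|C|) by rewrite mulr_ge0 // addr_ge0.
  by rewrite (le_trans (ltW (archi_boundP h))) // ler_nat.
have N0 : 0 < N%:R :> R by rewrite ltr0n.
pose u k := s + k%:R / N%:R * (t - s).
have u01 k : (k <= N)%N -> unit_itv (u k).
  move=> kN; have k0 : 0 <= k%:R / N%:R :> R by rewrite divr_ge0.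
  have k1 : k%:R / N%:R <= 1 :> R by rewrite ler_pdivrMr // mul1r ler_nat.
  move: hs ht => /andP[s0 s1] /andP[t0 t1]; rewrite /unit_itv /u.
  by apply/andP; split; nra.
suff h k : (k <= N)%N -> cohomologous (tau_cochain (u k)) (tau_cochain s).
  have -> : t = u N by rewrite /u divff ?gt_eqF // mul1r addrC subrK.
  exact: h.
elim: k => [_|k IHk kN]; first by rewrite /u mul0r mul0r addr0; exact: cohomologous_refl.
apply: cohomologous_trans (IHk (ltnW kN)); apply: tau_close; [exact/u01/ltnW|exact: u01|].
have dk : u k.+1 - u k = N%:R^-1 * (t - s).
  rewrite /u -natr1; ring.
apply: opb_le (opbM (F_lip (u01 _ (ltnW kN)) (u01 _ kN)) (F_bounded _ (u01 _ (ltnW kN)))) _.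
rewrite dk normrM normfV (ger0_norm (ltW N0)).
have ts1 : `|t - s| <= 1.
  by move: hs ht; rewrite /unit_itv ler_norml => /andP[? ?] /andP[? ?]; lra.
have h0 : 0 <= `|C| * (M0 + `|C|) by rewrite mulr_ge0 // addr_ge0.
apply: le_trans (_ : `|C| * (N%:R^-1 * 1) * (M0 + `|C|) <= _).
  apply: ler_wpM2r; first by rewrite addr_ge0.
  apply: le_trans (ler_wpM2r _ (ler_norm C)) _; first by rewrite mulr_ge0 ?invr_ge0 // ltW.
  by rewrite ler_wpM2l // ler_wpM2l // invr_ge0 ltW.
by rewrite mulr1 mulrAC ler_pdivrMr // mul1r.
Qed.

Lemma tau_cochain_cocycle t : unit_itv t -> cyclic_cocycle (tau_cochain t).
Proof.
move=> ht; apply: (tau_cyclic_cocycle p0 (FF ht) (Fe ht) rho_lin rhoM).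
- by move=> a; exact: rho_adm.
- by rewrite !leqW.
- by rewrite /= negbK.
Qed.

End Chain.

(** * Components of a morphism *)

Section Components.
Context {R : realType} {X : dagger_tensor_category R} {H : hfunctor X} (c : X).
Implicit Types f g : hmor H H.

Fact component_bounded f : exists M : R, forall x, nm (f c x) <= M * nm x.
Proof.
by have [M hM] := happ_bounded f; exists M => x; have := hM c x; rewrite !nmE -rcM lecR.
Qed.

Definition component f : bop (H c) := Bop (@happ_linear _ _ _ _ f c) (component_bounded f).

Lemma componentD f g : component (f + g) = component f + component g.
Proof. by apply: bopP => x; rewrite bop_addE [LHS]hmor_addE. Qed.

Lemma componentN f : component (- f) = - component f.
Proof. by apply: bopP => x; rewrite bop_oppE [LHS]hmor_oppE. Qed.

Lemma componentB f g : component (f - g) = component f - component g.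
Proof. by rewrite componentD componentN. Qed.

Lemma componentZ z f : component (z *: f) = z *: component f.
Proof. by apply: bopP => x; rewrite bop_scaleE [LHS]hmor_scaleE. Qed.

Lemma componentM f g : component (f * g) = component f * component g.
Proof. by apply: bopP => x. Qed.

Lemma component1 : component 1 = 1.
Proof. by apply: bopP => x. Qed.

End Components.

(** The singular values are a rate, because the supremum of their [l^p] norms is
    finite. *)
Lemma schatten_summable (R : realType) (X : dagger_tensor_category R) (I : Type)
    (irr : I -> X) (p : nat) (H : hfunctor X) (th : hmor H H) i :
  (0 < p)%N -> schatten irr p%:R th -> summable_approx p (component (irr i) th).
Proof.
move=> p0 [cpt [s [sv hs]]]; have [s0 sd _] := sv i.
exists (s i); last by move=> n; apply: (@singular_values_approx _ _ (component (irr i) th) (s i) (cpt _) (sv i)).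
split=> //.
have : (lp_norm p%:R (s i) < +oo)%E by apply: le_lt_trans hs; apply: ereal_sup_ubound; exists i.
rewrite /lp_norm; set S := (\sum_(n <oo) _)%E => hS.
have S0 n : (0 <= (s i n `^ p%:R)%:E)%E by rewrite lee_fin powR_ge0.
have Sfin : S \is a fin_num.
  rewrite ge0_fin_numE; last by apply: nneseries_ge0 => n _ _; exact: S0.
  rewrite ltey; apply/eqP => SE; move: hS; rewrite SE poweRyr ?invr_eq0 ?pnatr_eq0 -?lt0n //.
exists (fine S) => n; rewrite -lee_fin fineK // -sumEFin.
under eq_bigr do rewrite -powR_mulrn //.
rewrite -(big_mkord xpredT (fun k => (s i k `^ p%:R)%:E)).
by apply: nneseries_lim_ge => k _ _; exact: S0.
Qed.

Section GradingSquare.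
Context {R : realType} {X : dagger_tensor_category R} (H : graded_object X).

Lemma grading_sqr : grading H * grading H = 1.
Proof.
apply: hmorP => c h; rewrite hmor_mulE hmor_oneE.
have [x [y ->]] := ginc_sum h.
have gD a b : grading H c (a + b) = grading H c a + grading H c b.
  by have := @happ_linear _ _ _ _ (grading H) c 1 a b; rewrite !scale1r.
have gN a : grading H c (- a) = - grading H c a.
  by apply/eqP; rewrite -addr_eq0 -gD addNr; apply/eqP/(addIr (grading H c 0)); rewrite -gD !add0r.
by rewrite !(gD, gradingp, gradingm, gN) opprK.
Qed.

End GradingSquare.

(** * The character *)

Section CharacterOfComponent.
Context {R : realType} {V : hilbert R}.
Variables (p : nat) (F e : bop V).
Hypothesis p0 : (0 < p)%N.
Hypothesis FF : F * F = 1.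
Hypothesis Fe : F * e = - (e * F).
Hypothesis ee : e * e = 1.
Implicit Types T : bop V.

Lemma graded_commutator_even T : even e T ->
  (F * (2^-1 *: (T + e * T * e)) - (2^-1 *: (T + e * T * e)) * F) +
  (F * (2^-1 *: (T - e * T * e)) + (2^-1 *: (T - e * T * e)) * F) = dF F T.
Proof.
move=> Te; have -> : e * T * e = T by rewrite -Te -mulrA ee mulr1.
rewrite subrr scaler0 mulr0 mul0r !addr0 (_ : 2^-1 *: (T + T) = T) ?dFE //.
by rewrite scalerDr -scalerDl -[2^-1]div1r -splitr scale1r.
Qed.

Lemma dprod_even s : {in s, forall x, even e x} ->
  e * dprod F s = dprod F s * e * sg _ (size s).
Proof.
elim: s => [_|x s IHs hs]; first by rewrite dprod_nil sg0; ncring.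
have xe := hs x (mem_head x s).
have {}IHs := IHs (fun z zs => hs z (mem_behead (s := x :: s) zs)).
by rewrite dprod_cons mulrA (e_dF Fe xe) mulNr -mulrA IHs /= sgS; ncring.
Qed.

Lemma prod_scale n (c : R[i]) (g : 'I_n -> bop V) :
  \prod_(j < n) (c *: g j) = c ^+ n *: \prod_(j < n) g j.
Proof.
elim: n g => [|n IHn] g; first by rewrite !big_ord0 scale1r.
by rewrite !big_ord_recl IHn exprS -bop_scalerAl -bop_scalerAr scalerA.
Qed.

(** [F] commutes with a product of evenly many commutators, so only the
    commutator with the first argument survives in [dF F T]. *)
Lemma supertrace_value (A : calgebra R) (rho : A -> bop V) n (x : 'I_n.+1 -> A) :
  (forall a, admissible p F e (rho a)) -> (p <= n)%N -> ~~ odd n ->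
  let T := rho (x ord0) * \prod_(j < n) ('i%C *: dF F (rho (x (lift ord0 j)))) in
  even e T /\ trace (e * F * dF F T) = 'i%C ^+ n * tau F e (values rho x).
Proof.
move=> adm pn on T.
pose t := mkseq (fun k => rho (x (inord k.+1))) n.
have st : size t = n by rewrite size_mkseq.
have TE : T = 'i%C ^+ n *: (rho (x ord0) * dprod F t).
  rewrite /T prod_scale -bop_scalerAr; congr (_ *: _); congr (rho (x ord0) * _).
  rewrite /dprod /t big_map -[n in iota 0 n]subn0 -/(index_iota 0 n) big_mkord.
  apply: eq_bigr => j _; congr (dF F (rho (x _))).
  by apply: val_inj; rewrite /= inordK //= ltnS.
have te : {in t, forall y, even e y} by move=> y /mapP[k _ ->]; case: (adm (x (inord k.+1))).
have De : even e (dprod F t) by rewrite /even (dprod_even te) even_sg ?st // mulr1.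
have FD : F * dprod F t = dprod F t * F by rewrite (F_dprod FF) even_sg ?st // mulr1.
have [x0e _] := adm (x ord0).
split.
  by rewrite /even TE -bop_scalerAl -bop_scalerAr (evenM x0e De).
have dT : dF F T = 'i%C ^+ n *: dprod F (values rho x).
  rewrite TE values_cons dprod_cons -[X in dF F X]addr0 dF_linear dFM.
  by rewrite [dF F (dprod F t)]dFE FD subrr mulr0 !dFE mulr0 mul0r subrr !addr0.
have hl : {in values rho x, forall y, admissible p F e y} by exact: values_in.
have [r hr hJ] := admissible_rate p0 hl.
rewrite dT -bop_scalerAr (rate_traceZ hr) //.
by apply: decay_wl; apply: (dprod_regular hr _ hJ); rewrite size_values leqW.
Qed.

End CharacterOfComponent.

Section Sums.
Context {R : realType} {A : calgebra R} {I : finType}.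

Lemma cyclic_cocycle_sum n c (f : I -> cochain A n) : (forall i, cyclic_cocycle (f i)) ->
  cyclic_cocycle (fun x => \sum_i c * f i x).
Proof.
move=> hf; elim: (index_enum I) => [|i s IHs].
  by under eq_fun do rewrite big_nil; exact: cyclic_cocycle0.
by under eq_fun do rewrite big_cons; exact: cyclic_cocycle_lin.
Qed.

Lemma cohomologous_sum n c (f g : I -> cochain A n.+1) :
  (forall i, cohomologous (f i) (g i)) ->
  cohomologous (fun x => \sum_i c * f i x) (fun x => \sum_i c * g i x).
Proof.
move=> hfg; elim: (index_enum I) => [|i s IHs].
  by under eq_fun do rewrite big_nil; under [X in cohomologous _ X]eq_fun do rewrite big_nil;
    exact: cohomologous_refl.
under eq_fun do rewrite big_cons; under [X in cohomologous _ X]eq_fun do rewrite big_cons.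
exact: cohomologous_lin.
Qed.

End Sums.

(** The [n] differentials contribute the factor [i ^ n]. *)
Lemma character_cocycleE (R : realType) (X : dagger_tensor_category R) (I : finType)
    (irr : I -> X) (p : nat) (A : calgebra R) (H : graded_object X)
    (rho : degree0_hom A H) (F : hmor H H) n (x : 'I_n.+1 -> A) :
  (0 < p <= n)%N -> ~~ odd n -> summable_fredholm_module irr p%:R rho F ->
  character_cocycle irr rho F x =
  \sum_i ((2 * 'i%C * (pi : R)%:C) ^+ n./2 * (n./2)`!%:R * (2^-1 * 'i%C ^+ n)) *
    tau (component (irr i) F) (component (irr i) (grading H))
        (values (fun a => component (irr i) (rho a)) x).
Proof.
move=> /andP[p0 pn] on [F2 Fodd Fcomm].
rewrite /character_cocycle /Tr_s /Trace -mulr_sumr -!mulrA; do 3!congr (_ * _).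
rewrite mulr_sumr; apply: eq_bigr => i _.
pose C := @component R X H (irr i); pose e := C (grading H).
have FF : C F * C F = 1 by rewrite -componentM F2 component1.
have Fe : C F * e = - (e * C F) by rewrite -!componentM Fodd componentN.
have ee : e * e = 1 by rewrite -componentM grading_sqr component1.
have adm a : admissible p (C F) e (C (rho a)).
  split; first by rewrite /even -!componentM rep_even.
  by rewrite dFE -!componentM -componentB; exact: schatten_summable.
have gE th : even e (C th) -> C (gcomm F th) = dF (C F) (C th).
  move=> he; rewrite -(graded_commutator_even _ ee he) /gcomm /even_part /odd_part.
  rewrite /C; by rewrite !(componentD, componentN, componentM, componentZ).
set th := rho _ * _.
have thE : C th = C (rho (x ord0)) *
    \prod_(j < n) ('i%C *: dF (C F) (C (rho (x (lift ord0 j))))).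
  rewrite /th /C componentM (big_morph _ (@componentM _ _ _ _) (component1 _)).
  congr (_ * _); apply: eq_bigr => j _; rewrite componentZ; congr (_ *: _).
  by apply: gE; case: (adm (x (lift ord0 j))).
have [the] := supertrace_value p0 FF Fe x adm pn on.
by rewrite -thE in the * => <-; rewrite -gE.
Qed.

Theorem corollary6p4 (R : realType) (X : rigid_cstar_category R)
  (I : finType) (irr : I -> X) (hirr : irr_representatives irr)
  (p m : nat) (hpm : p = (2 * m)%N) (hp : (1 <= p)%N)
  (A : calgebra R) (H : graded_object X) (rho : degree0_hom A H)
  (F : R -> hmor H H)
  (hF : forall t : R, 0 <= t <= 1 ->
     summable_fredholm_module irr p%:R rho (F t))
  (hC1 : strongly_C1 F) :
  (forall t : R, 0 <= t <= 1 ->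
     cyclic_cohomology A p.+2 (chern_character irr rho (F t) p.+2)) /\
  (forall s t : R, 0 <= s <= 1 -> 0 <= t <= 1 ->
     chern_character irr rho (F s) p.+2 =
     chern_character irr rho (F t) p.+2).
Proof.
have p_even : ~~ odd p by rewrite hpm mul2n odd_double.
pose K : R[i] := (2 * 'i%C * (pi : R)%:C) ^+ p.+2./2 * (p.+2./2)`!%:R * (2^-1 * 'i%C ^+ p.+2).
pose f i t : cochain A p.+2 :=
  tau_cochain (component (irr i) (grading H)) (fun t => component (irr i) (F t))
              (fun a => component (irr i) (rho a)) t.
have charE t : unit_itv t -> character_cocycle irr rho (F t) (n := p.+2) =
    (fun x => \sum_i K * f i t x).
  by move=> ht; apply/funext => x; rewrite (character_cocycleE x _ _ (hF t ht)) ?hp ?leqW //= negbK.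
have FF i t : unit_itv t -> component (irr i) (F t) * component (irr i) (F t) = 1.
  by move=> ht; rewrite -componentM (fred_sqr (hF t ht)) component1.
have Fe i t : unit_itv t -> component (irr i) (F t) * component (irr i) (grading H) =
    - (component (irr i) (grading H) * component (irr i) (F t)).
  by move=> ht; rewrite -!componentM (fred_odd (hF t ht)) componentN.
have rho_lin i : linear (fun a => component (irr i) (rho a)).
  by move=> z a b; rewrite rep_linear componentD componentZ.
have rhoM i (a b : A) : component (irr i) (rho (amul a b)) =
    component (irr i) (rho a) * component (irr i) (rho b).
  by rewrite rep_mul componentM.
have adm i t (a : A) : unit_itv t -> admissible p (component (irr i) (F t))
    (component (irr i) (grading H)) (component (irr i) (rho a)).
  move=> ht; split; first by rewrite /even -!componentM rep_even.
  rewrite dFE -!componentM -componentB; apply: schatten_summable => //.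
  exact: fred_comm (hF t ht) a.
split=> [t ht|s t hs ht].
  exists (character_cocycle irr rho (F t) (n := p.+2)) => //.
  rewrite charE //; apply: cyclic_cocycle_sum => i.
  exact: (tau_cochain_cocycle hp p_even (FF i) (Fe i) (rho_lin i) (rhoM i) (adm i)).
rewrite /chern_character (charE s hs) (charE t ht).
apply: cohomology_class_eq; apply: cohomologous_sum => i.
have [|C hC] := norm_lipschitz (T := fun t => component (irr i) (F t)).
  move=> h; have [g [cg dg]] := hC1 (irr i) h.
  have [C hC] := strong_C1_lipschitz cg dg; exists C => s' t' hs' ht'.
  exact: hC.
exact: (tau_cohomologous hp p_even (FF i) (Fe i) (rho_lin i) (rhoM i) (adm i) hC).
Qed.
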